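(* Let $T>0$ and $r>0$. Assume that, for some $\zeta\in(0,1)$, the strengthened CFL condition $$\Delta t\le \frac{\beta_0}{\beta_1}\,\frac{a^2}{\lambda^\star}\,(1-\zeta)\,h$$ holds. Then there exists $C_{BV}$ depending only on $T,r,a,\xi,\eta,u_0,\Omega$ and $\zeta$ such that $$\sum_{n=0}^{N_T}\Delta t\sum_{(K,L)\in\mathcal E_r}|\sigma_{KL}|\,\big|G_{KL}(u_K^n,u_L^n)-f(u_K^n)\cdot n_{KL}\big|\le\frac{C_{BV}}{\sqrt h}.$$
   Context: System. $\Omega\subset\mathbb R^m$ is a convex bounded set; $f_\alpha\in C^2(\overline\Omega;\mathbb R^m)$ ($1\le\alpha\le d$) and each $Df_\alpha$ is diagonalizable with real eigenvalues. $\eta\in C^2(\overline\Omega;\mathbb R)$, $\eta\ge0$, satisfies $\mathrm{spec}(D^2\eta(u))\subset[\beta_0;\beta_1]$ for all $u\in\overline\Omega$, where $\beta_1\ge\beta_0>0$, and $\xi=(\xi_\alpha)_\alpha\in C^2(\overline\Omega;\mathbb R^d)$ satisfies $D\xi_\alpha(u)=D\eta(u)Df_\alpha(u)$ on $\Omega$. For $n\in\mathbb R^d$: $f(u)\cdot n=\sum_\alpha n_\alpha f_\alpha(u)\in\mathbb R^m$, $\xi(u)\cdot n=\sum_\alpha n_\alpha\xi_\alpha(u)$. Initial data $u_0:\mathbb R^d\to\Omega$ (measurable). Mesh. $\mathcal T$ is a family of disjoint polygonal/polyhedral connected cells of $\mathbb R^d$, the union of whose closures is $\mathbb R^d$; $h=\sup_{K\in\mathcal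 T}\mathrm{diam}(K)$, $0<h\le1$. $|K|$ is the $d$-dimensional Lebesgue measure of $K$, $\mathcal N(K)$ is the set of cells neighbouring $K$; for $L\in\mathcal N(K)$, $\sigma_{KL}$ is the common interface, $|\sigma_{KL}|$ its $(d-1)$-dimensional measure, $n_{KL}$ its unit normal from $K$ to $L$. There is $a>0$ with $|K|\ge ah^d$ and $\sum_{L\in\mathcal N(K)}|\sigma_{KL}|\le h^{d-1}/a$ for all $K\in\mathcal T$. For $r>0$, $\mathcal T_r=\{K\in\mathcal T:\ K\subset B(0,r)\}$, where $B(0,r)$ is the ball of radius $r$ centred at $0$, and $\mathcal E_r$ is the set of interfaces $\sigma_{KL}$ with $K,L\in\mathcal T_r$, $L\in\mathcal N(K)$; a sum over $(K,L)\in\mathcal E_r$ counts each interface once, with an arbitrary choice of orientation. Numerical fluxes. For each $K\in\mathcal T$, $L\in\mathcal N(K)$, $G_{KL}:\Omega^2\to\mathbb R^m$ is Lipschitz continuous, with $G_{KL}(u,v)=-G_{LK}(v,u)$ and $G_{KL}(u,u)=f(u)\cdot n_{KL}$. There is $\lambda^\star>0$ such that: (i) for all $\lambda>\lambda^\star$ and all $(u,v)\in\Omega^2$, $u-\frac1\lambda(G_{KL}(u,v)-f(u)\cdot n_{KL})\in\Omega$; (ii) there are Lipschitz continuous $\xi_{KL}:\Omega^2\to\mathbb R$ with $\xi_{KL}(u,v)=-\xi_{LK}(v,u)$ and, for all $\lambda\ge\lambda^\star$ and $(u,v)\in\Omega^2$, $$\xi_{KL}(u,v)-\xi(u)\cdot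 n_{KL}\le-\lambda\Big(\eta\big(u-\tfrac1\lambda(G_{KL}(u,v)-f(u)\cdot n_{KL})\big)-\eta(u)\Big).$$ Scheme. $\Delta t>0$, $t^n=n\Delta t$, $N_T=\max\{n\in\mathbb N:\ n\le T/\Delta t+1\}$. The unknowns satisfy $u_K^0=\frac1{|K|}\int_Ku_0\,dx$ and $\frac{u_K^{n+1}-u_K^n}{\Delta t}|K|+\sum_{L\in\mathcal N(K)}|\sigma_{KL}|G_{KL}(u_K^n,u_L^n)=0$; under the CFL condition all $u_K^n$ belong to $\Omega$.
   Formalization: The constant C_BV is also allowed to depend on λ⋆, which the list of dependencies omits; a bound independent of λ⋆ is false (take f=0, ξ=0, η=u²/2, G_KL(u,v)=(λ⋆/2)(u−v) and let λ⋆ tend to infinity). *)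

(* Defs.v *)
From HB Require Import structures.
From mathcomp Require Import all_boot all_order all_algebra.
From mathcomp Require Import all_classical all_reals all_analysis.

Set Implicit Arguments.
Unset Strict Implicit.
Unset Printing Implicit Defensive.

Import Order.TTheory GRing.Theory Num.Theory.
Import numFieldNormedType.Exports.

Local Open Scope classical_set_scope.
Local Open Scope ring_scope.

(* Lebesgue measure on R^n: the n-fold product of the Lebesgue measure of R,  *)
(* on n.-tuple R with the product sigma-algebra.                              *)

Section lebesgue_step.
Context {R : realType} (n : nat).

Definition tcons (p : R * n.-tuple R) : n.+1.-tuple R :=
  [tuple of p.1 :: p.2].

Lemma measurable_tcons : measurable_fun [set: R * n.-tuple R] tcons.
Proof.
apply: (@measurable_cons _ _ (R * n.-tuple R)%type R fst n snd).
  exact: measurable_fst.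
exact: measurable_snd.
Qed.

Variable mu : {sigma_finite_measure set (n.-tuple R) -> \bar R}.

Definition lebesgue_step : set (n.+1.-tuple R) -> \bar R :=
  pushforward (lebesgue_measure \x mu)%E tcons.

HB.instance Definition _ := Measure.copy lebesgue_step
  (measure_function_pushforward__canonical__measure_function_Measure
     (lebesgue_measure \x mu)%E measurable_tcons).

Let tuncons (t : n.+1.-tuple R) : R * n.-tuple R :=
  (tnth t ord0, [tuple of behead t]).

Let tconsK : cancel tcons tuncons.
Proof.
move=> [x t]; rewrite /tuncons /tcons /=; congr pair.
by apply: val_inj.
Qed.

Let measurable_tuncons : measurable_fun [set: n.+1.-tuple R] tuncons.
Proof.
apply: measurable_fun_pair; first exact: measurable_tnth.
exact: measurable_behead.
Qed.

Let lebesgue_step_sigma_finite : sigma_finite setT lebesgue_step.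
Proof.
have /sigma_finiteP[F [TF ndF Foo]] := sigma_finiteT (@lebesgue_measure R).
have /sigma_finiteP[G [TG ndG Goo]] := sigma_finiteT mu.
exists (fun i => tuncons @^-1` (F i `*` G i)).
  apply/esym; rewrite -subTset => t _.
  have [i _ Fi] : (\bigcup_i F i) (tuncons t).1 by rewrite -TF.
  have [j _ Gj] : (\bigcup_j G j) (tuncons t).2 by rewrite -TG.
  exists (maxn i j) => //; split.
    by move: Fi; exact/subsetPset/ndF/leq_maxl.
  by move: Gj; exact/subsetPset/ndG/leq_maxr.
move=> i; have [mF Fi] := Foo i; have [mG Gi] := Goo i.
have mFG : measurable (F i `*` G i) by exact: measurableX.
split; first by rewrite -[X in measurable X]setTI; exact: measurable_tuncons.
rewrite /lebesgue_step /pushforward -comp_preimage.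
have -> : tuncons \o tcons = id by apply/funext => p; exact: tconsK.
by rewrite preimage_id product_measure1E// lte_mul_pinfty// ge0_fin_numE.
Qed.

HB.instance Definition _ :=
  Measure_isSigmaFinite.Build _ _ _ lebesgue_step lebesgue_step_sigma_finite.

End lebesgue_step.

Fixpoint lebesgue (R : realType) (n : nat) :
    {sigma_finite_measure set (n.-tuple R) -> \bar R} :=
  match n with
  | 0 => \d_([tuple] : 0.-tuple R)
  | n'.+1 => lebesgue_step (lebesgue R n')
  end.

(* Euclidean geometry of R^n, points being row vectors.  The library norm of  *)
(* 'rV[R]_n is the sup norm: it defines the same open sets, but lengths,      *)
(* diameters and balls below are Euclidean.                                   *)

Section geometry.
Context {R : realType} {n : nat}.
Implicit Types (x v : 'rV[R]_n) (A : set 'rV[R]_n).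

Definition dotp v x : R := \sum_(i < n) v 0 i * x 0 i.

Definition enorm x : R := Num.sqrt (dotp x x).

Definition eball (r : R) : set 'rV[R]_n := [set x | enorm x < r].

Definition diam A : \bar R :=
  ereal_sup [set (enorm (xy.1 - xy.2))%:E | xy in A `*` A].

Definition row_of_tuple (t : n.-tuple R) : 'rV[R]_n := \row_i tnth t i.

Definition volume A : \bar R := lebesgue R n (row_of_tuple @^-1` A).

Definition hyperplane v (c : R) : set 'rV[R]_n := [set x | dotp v x = c].

Definition prism v A : set 'rV[R]_n :=
  [set xt.1 + xt.2 *: v | xt in A `*` [set t : R | 0 <= t <= 1]].

(* (n-1)-dimensional measure.  A subset of a hyperplane with unit normal v    *)
(* has the (n-1)-dimensional Lebesgue measure of the right prism of height 1  *)
(* over it, computed as an n-dimensional volume.  For A inside one            *)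
(* hyperplane the supremum is that measure, since any other hyperplane cuts A *)
(* in a set of dimension at most n-2.  For A inside finitely many hyperplanes *)
(* it vanishes exactly when A is (n-1)-negligible.                            *)
Definition area A : \bar R :=
  ereal_sup [set volume (prism vc.1 (A `&` hyperplane vc.1 vc.2))
            | vc in [set vc : 'rV[R]_n * R | enorm vc.1 = 1]].

(* The boundary lies in finitely many hyperplanes; A need not be convex. *)
Definition polyhedral_cell A : Prop :=
  [/\ open A, connected A &
      exists2 s : seq ('rV[R]_n * R), (forall vc, vc \in s -> vc.1 != 0) &
        closure A `\` A `<=` [set x | exists2 vc, vc \in s &
                                        hyperplane vc.1 vc.2 x]].

Definition interface A B : set 'rV[R]_n := closure A `&` closure B.

(* v is the unit normal of the flat interface between A and B, oriented from  *)
(* A to B: at almost every point of the interface, A lies behind and B ahead. *)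
Definition interface_normal A B v : Prop :=
  [/\ enorm v = 1, exists c, interface A B `<=` hyperplane v c &
      area [set x | interface A B x /\
        ~ (\forall t \near (0:R)^'+, A (x - t *: v) /\ B (x + t *: v))] = 0%E].

End geometry.

(* C^2 functions on the closure of A: restrictions of functions which are C^2 *)
(* on an open neighbourhood of that closure.                                  *)

Definition C2_closure {R : realType} {m : nat} {V : normedModType R}
    (A : set 'rV[R]_m) (g : 'rV[R]_m -> V) : Prop :=
  exists U : set 'rV[R]_m, [/\ open U, closure A `<=` U &
    forall x, U x -> differentiable g x /\
      forall v, differentiable ('D_v g) x /\
        forall w, {for x, continuous ('D_w ('D_v g))}].

Definition hessian {R : realType} {m : nat} (g : 'rV[R]_m -> R)
    (x : 'rV[R]_m) : 'M[R]_m :=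
  \matrix_(i, j) 'D_(delta_mx 0 i) ('D_(delta_mx 0 j) g) x.

(* nrm K L stands for n_KL and is only constrained when K, L are neighbours. *)

Section mesh.
Context {R : realType} {d : nat}.
Local Notation cell := (set 'rV[R]_d).
Implicit Types (Th : set cell) (nrm : cell -> cell -> 'rV[R]_d).

Definition neighbours Th (K : cell) : set cell :=
  [set L | [/\ Th L, L <> K & (0 < area (interface K L))%E]].

Definition sigma (K L : cell) : R := fine (area (interface K L)).

(* The cells meeting a bounded region are finitely many, because they are
   disjoint with diameter at most h and volume at least a h^d; so the sums over
   neighbours, here and below, have finitely many terms. *)
Record admissible_mesh Th nrm (h a : R) : Prop := AdmissibleMesh {
  mesh_cell : forall K, Th K -> polyhedral_cell K;
  mesh_disjoint : trivIset Th id;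
  mesh_cover : \bigcup_(K in Th) closure K = setT;
  mesh_size : ereal_sup [set diam K | K in Th] = h%:E;
  mesh_normal : forall K L, Th K -> neighbours Th K L ->
    interface_normal K L (nrm K L);
  mesh_volume : forall K, Th K -> ((a * h ^+ d)%:E <= volume K)%E;
  mesh_perimeter : forall K, Th K ->
    \sum_(L \in neighbours Th K) sigma K L <= h ^+ d.-1 / a
}.

Definition cells_in Th (r : R) : set cell := [set K | Th K /\ K `<=` eball r].

(* E lists each interface between two neighbours of T_r once, with an         *)
(* arbitrary orientation.                                                     *)
Definition oriented_interfaces Th (r : R) (E : set (cell * cell)) : Prop :=
  (forall p, E p -> [/\ cells_in Th r p.1, cells_in Th r p.2 &
                        neighbours Th p.1 p.2]) /\
  (forall K L, cells_in Th r K -> cells_in Th r L -> neighbours Th K L ->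
     (E (K, L) /\ ~ E (L, K)) \/ (E (L, K) /\ ~ E (K, L))).

End mesh.

Section scheme.
Context {R : realType} {m d : nat}.
Local Notation cell := (set 'rV[R]_d).
Local Notation state := 'rV[R]_m.
Implicit Types (Th : set cell) (nrm : cell -> cell -> 'rV[R]_d)
  (Omega : set state) (f : 'I_d -> state -> state) (eta : state -> R)
  (xi : 'I_d -> state -> R) (G : cell -> cell -> state -> state -> state).

Definition fdot f (u : state) (n : 'rV[R]_d) : state :=
  \sum_(al < d) n 0 al *: f al u.

Definition xidot xi (u : state) (n : 'rV[R]_d) : R :=
  \sum_(al < d) n 0 al * xi al u.

Definition upwind_state nrm f G (lam : R) (K L : cell) (u v : state) : state :=
  u - lam^-1 *: (G K L u v - fdot f u (nrm K L)).

Record numerical_entropy_flux Th nrm Omega f eta xi G (lamstar : R)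
    (Xi : cell -> cell -> state -> state -> R) : Prop := NumericalEntropyFlux {
  entropy_flux_lipschitz : forall K L, Th K -> neighbours Th K L ->
    [lipschitz Xi K L uv.1 uv.2 | uv in Omega `*` Omega];
  entropy_flux_conservative : forall K L, Th K -> neighbours Th K L ->
    forall u v, Omega u -> Omega v -> Xi K L u v = - Xi L K v u;
  entropy_flux_inequality : forall K L, Th K -> neighbours Th K L ->
    forall lam u v, lamstar <= lam -> Omega u -> Omega v ->
      Xi K L u v - xidot xi u (nrm K L) <=
        - lam * (eta (upwind_state nrm f G lam K L u v) - eta u)
}.

Record admissible_flux Th nrm Omega f eta xi G (lamstar : R) : Prop :=
    AdmissibleFlux {
  flux_lipschitz : forall K L, Th K -> neighbours Th K L ->
    [lipschitz G K L uv.1 uv.2 | uv in Omega `*` Omega];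
  flux_conservative : forall K L, Th K -> neighbours Th K L ->
    forall u v, Omega u -> Omega v -> G K L u v = - G L K v u;
  flux_consistent : forall K L, Th K -> neighbours Th K L ->
    forall u, Omega u -> G K L u u = fdot f u (nrm K L);
  flux_invariant : forall K L, Th K -> neighbours Th K L ->
    forall lam u v, lamstar < lam -> Omega u -> Omega v ->
      Omega (upwind_state nrm f G lam K L u v);
  flux_entropy : exists Xi,
    numerical_entropy_flux Th nrm Omega f eta xi G lamstar Xi
}.

Definition cell_average (u0 : 'rV[R]_d -> state) (K : cell) : state :=
  \row_i ((fine (volume K))^-1 *
    \int[lebesgue R d]_(t in row_of_tuple @^-1` K) u0 (row_of_tuple t) 0 i).

(* u n K is the discrete unknown u_K^n. *)
Definition scheme_solution Th G (dt : R) (u0 : 'rV[R]_d -> state)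
    (u : nat -> cell -> state) : Prop :=
  (forall K, Th K -> u 0 K = cell_average u0 K) /\
  (forall n K, Th K ->
     (fine (volume K) / dt) *: (u n.+1 K - u n K) +
       \sum_(L \in neighbours Th K) sigma K L *: G K L (u n K) (u n L) = 0).

End scheme.

(* Main.v *)
Require Import Defs.
From HB Require Import structures.
From mathcomp Require Import all_boot all_order all_algebra finmap.
From mathcomp Require Import all_classical all_reals all_analysis.
From mathcomp Require Import ring lra.

Set Implicit Arguments.
Unset Strict Implicit.
Unset Printing Implicit Defensive.

Import Order.TTheory GRing.Theory Num.Theory.
Import numFieldNormedType.Exports.

Local Open Scope classical_set_scope.
Local Open Scope ring_scope.

(** The entropy inequality, kept to second order, controls the squares of the
    upwind gaps [g = G_KL(u_K, u_L) - f(u_K) . n_KL], and Cauchy-Schwarz passes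
    to their first powers at the price of a factor [1 / sqrt h].

    On an interface, the flux inequality at [lam = lamstar] compares
    [Xi_KL - xi(u_K) . n_KL] with the increment of [eta] between [u_K] and
    [u_K - g / lam]. As [eta] is strongly convex, it yields the first order term
    [D eta(u_K) g] minus a multiple of [|g| ^ 2] ([interface_entropy]). In the
    update of [u_K] only the gaps matter, because the normals of a cell weighted
    by the areas of its interfaces sum to zero; the same fact removes the terms
    in [xi]. The expansion of [eta (u_K)] in time has a second order error,
    bounded by the Courant number times the same squares. The strengthened
    restriction on the time step makes this error smaller than the gain by a
    fraction [zeta], and a multiple of [sum dt sigma |g| ^ 2] is bounded by the
    decrease of the entropy of the cell minus its entropy outflow
    ([cell_entropy]). Summing over cells with a cutoff in space, which is 1 on
    the ball of radius [r] and of slope 1 outside, the outflow reduces by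
    antisymmetry to differences of the cutoff; these are [O(h)], for a total
    perimeter [O(1 / h)] ([sum_entropy_flux]). So the weighted sum of the
    squares is bounded uniformly in [h] ([dissipation]), while the weights
    [dt sigma] sum to [O(1 / h)].

    Three facts behind this argument take most of the work.

    - The weighted normals of a cell sum to zero ([sum_sigma_normal]). Cells are
      polyhedral but not convex, and areas of interfaces are volumes of prisms,
      so the divergence theorem is proved by following lines. Along almost every
      line of direction [e], the indicator of [K] changes exactly when the line
      crosses an interface of [K], by the sign of [n_KL . e] ([line_balance]).
      Integrated over the starting point, this says that the prisms of
      direction [e] over the interfaces have signed volumes of sum zero, and
      such a prism has volume [sigma_KL |n_KL . e|] by Cavalieri's principle
      ([vol_prism]).

    - The cell averages of the initial datum stay in [Omega], which is convex
      but neither open nor closed: [mean_in_convex], by induction on the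
      dimension of a subspace containing the deviations from the mean. The
      scheme then keeps its values in [Omega] ([invariant]).

    - The bounds on the eigenvalues of the Hessian of [eta] are bounds on the
      quadratic form ([form_lower_bound]), since the Hessian is symmetric
      ([schwarz]); they enter through the Lagrange form of the remainder
      ([taylor_lagrange]). *)

(** * Euclidean geometry of row vectors *)

Section Euclidean.
Context {R : realType} {n : nat}.
Implicit Types (x y z v : 'rV[R]_n) (k : R).

Lemma dotpC x y : dotp x y = dotp y x.
Proof. by apply: eq_bigr => i _; rewrite mulrC. Qed.

Lemma dotpDr x y z : dotp x (y + z) = dotp x y + dotp x z.
Proof. by rewrite -big_split; apply: eq_bigr => i _; rewrite mxE mulrDr. Qed.

Lemma dotpZr k x y : dotp x (k *: y) = k * dotp x y.
Proof. by rewrite mulr_sumr; apply: eq_bigr => i _; rewrite mxE mulrCA. Qed.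

Lemma dotpDl x y z : dotp (x + y) z = dotp x z + dotp y z.
Proof. by rewrite dotpC dotpDr !(dotpC z). Qed.

Lemma dotpZl k x y : dotp (k *: x) y = k * dotp x y.
Proof. by rewrite dotpC dotpZr dotpC. Qed.

Lemma dotpNr x y : dotp x (- y) = - dotp x y.
Proof. by rewrite -scaleN1r dotpZr mulN1r. Qed.

Lemma dotpNl x y : dotp (- x) y = - dotp x y.
Proof. by rewrite dotpC dotpNr dotpC. Qed.

Lemma dotpBr x y z : dotp x (y - z) = dotp x y - dotp x z.
Proof. by rewrite dotpDr dotpNr. Qed.

Lemma dotpBl x y z : dotp (x - y) z = dotp x z - dotp y z.
Proof. by rewrite dotpDl dotpNl. Qed.

Lemma dotp0r x : dotp x 0 = 0.
Proof. by rewrite -(scale0r 0) dotpZr mul0r. Qed.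

Lemma dotp0l x : dotp 0 x = 0.
Proof. by rewrite dotpC dotp0r. Qed.

Lemma dotp_sumr (I : Type) (s : seq I) (F : I -> 'rV[R]_n) x :
  dotp x (\sum_(i <- s) F i) = \sum_(i <- s) dotp x (F i).
Proof.
elim/big_rec2: _ => [|i _ a _ <-]; first exact: dotp0r.
by rewrite dotpDr.
Qed.

Lemma dotp_delta x i : dotp x (delta_mx 0 i) = x 0 i.
Proof.
rewrite /dotp (bigD1 i)//= big1 ?addr0; last first.
  by move=> j ji; rewrite mxE eqxx (negPf ji) mulr0.
by rewrite mxE !eqxx mulr1.
Qed.

Lemma dotp_ge0 x : 0 <= dotp x x.
Proof. by apply: sumr_ge0 => i _; rewrite -expr2 sqr_ge0. Qed.

Lemma dotp_eq0 x : (dotp x x == 0) = (x == 0).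
Proof.
apply/eqP/eqP => [x0|->]; last exact: dotp0r.
apply/rowP => i; rewrite mxE; apply/eqP; rewrite -sqrf_eq0 expr2.
have := @psumr_eq0P _ _ xpredT (fun i => x 0 i * x 0 i).
by move=> -> //= j _; rewrite -expr2 sqr_ge0.
Qed.

Lemma enorm_ge0 x : 0 <= enorm x. Proof. exact: sqrtr_ge0. Qed.

Lemma sqr_enorm x : enorm x ^+ 2 = dotp x x.
Proof. by rewrite sqr_sqrtr// dotp_ge0. Qed.

Lemma enorm0 : enorm (0 : 'rV[R]_n) = 0.
Proof. by rewrite /enorm dotp0r sqrtr0. Qed.

Lemma enorm_gt0 x : (0 < enorm x) = (x != 0).
Proof. by rewrite sqrtr_gt0 lt_def dotp_eq0 dotp_ge0 andbT. Qed.

Lemma enormZ k x : enorm (k *: x) = `|k| * enorm x.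
Proof.
by rewrite /enorm dotpZl dotpZr mulrA -expr2 sqrtrM ?sqr_ge0// sqrtr_sqr.
Qed.

Lemma enormN x : enorm (- x) = enorm x.
Proof. by rewrite -scaleN1r enormZ normrN1 mul1r. Qed.

Lemma enormB x y : enorm (x - y) = enorm (y - x).
Proof. by rewrite -enormN opprB. Qed.

Lemma normr_dotp x y : `|dotp x y| <= enorm x * enorm y.
Proof.
have [->|y0] := eqVneq y 0; first by rewrite dotp0r normr0 enorm0 mulr0.
have yy : 0 < dotp y y by rewrite lt_def dotp_eq0 y0 dotp_ge0.
rewrite -ler_sqr ?nnegrE ?mulr_ge0 ?enorm_ge0// exprMn !sqr_enorm real_normK ?num_real//.
(* nonnegativity of the squared distance from x to the line of y *)
have := dotp_ge0 (dotp y y *: x - dotp x y *: y).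
rewrite !(dotpBl, dotpBr, dotpZl, dotpZr) (dotpC y x).
set a := dotp x x; set b := dotp x y; set c := dotp y y in yy *.
rewrite (_ : _ - _ = c * (a * c - b ^+ 2)); last by ring.
by rewrite pmulr_rge0// subr_ge0.
Qed.

Lemma dotp_le x y : dotp x y <= enorm x * enorm y.
Proof. exact: le_trans (ler_norm _) (normr_dotp _ _). Qed.

Lemma ler_enormD x y : enorm (x + y) <= enorm x + enorm y.
Proof.
rewrite -ler_sqr ?nnegrE ?addr_ge0 ?enorm_ge0//.
rewrite sqr_enorm sqrrD !sqr_enorm dotpDl !dotpDr (dotpC y x).
by have := dotp_le x y; lra.
Qed.

Lemma ler_enorm_distD z x y : enorm (x - y) <= enorm (x - z) + enorm (z - y).
Proof. by apply: le_trans (ler_enormD _ _); rewrite addrA subrK. Qed.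

Lemma ler_enormB x y : enorm x - enorm y <= enorm (x - y).
Proof.
by rewrite lerBlDr; apply: le_trans (ler_enormD _ _); rewrite subrK.
Qed.

Lemma ler_enorm_sum (I : Type) (s : seq I) (F : I -> 'rV[R]_n) :
  enorm (\sum_(i <- s) F i) <= \sum_(i <- s) enorm (F i).
Proof.
elim/big_rec2: _ => [|i a b _ ab]; first by rewrite enorm0.
by apply: le_trans (ler_enormD _ _) _; rewrite lerD2l.
Qed.

Lemma ler_coord_enorm x i : `|x 0 i| <= enorm x.
Proof.
rewrite -sqrtr_sqr ler_wsqrtr// /dotp (bigD1 i)//= expr2 lerDl.
by apply: sumr_ge0 => j _; rewrite -expr2 sqr_ge0.
Qed.

Lemma ler_coord_norm x i : `|x 0 i| <= `|x|.
Proof.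
rewrite [in leRHS]/Num.Def.normr/= mx_normrE.
exact: (@le_bigmax _ _ _ 0 (fun ij : 'I_1 * 'I_n => `|x ij.1 ij.2|) (0, i)).
Qed.

Lemma ler_norm_enorm x : `|x| <= enorm x.
Proof.
rewrite [in leLHS]/Num.Def.normr/= mx_normrE.
apply/bigmax_leP; split; first exact: enorm_ge0.
by move=> [i j] _ /=; rewrite ord1 ler_coord_enorm.
Qed.

Lemma ler_enorm_norm x : enorm x <= n%:R * `|x|.
Proof.
rewrite -ler_sqr ?nnegrE ?enorm_ge0 ?mulr_ge0// sqr_enorm.
apply: (@le_trans _ _ (n%:R * `|x| ^+ 2)).
  rewrite mulr_natl -[X in _ *+ X]card_ord -sumr_const; apply: ler_sum => i _.
  by rewrite -expr2 -real_normK ?num_real// lerXn2r ?nnegrE// ler_coord_norm.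
rewrite exprMn ler_wpM2r ?sqr_ge0// -natrX ler_nat.
by rewrite -mulnn; case: (n) => // k; rewrite leq_pmulr.
Qed.

(** The topology is that of the sup norm, to which [enorm] is equivalent. *)
Lemma nbhs_enormP x (A : set 'rV[R]_n) :
  nbhs x A <-> exists2 e, 0 < e & forall y, enorm (y - x) < e -> A y.
Proof.
split=> [/nbhs_ballP[e /= e0 eA]|[e e0 eA]].
  exists e => // y yx; apply: eA; rewrite -ball_normE /ball_/= distrC.
  exact: le_lt_trans (ler_norm_enorm _) yx.
have n1 : 0 < n.+1%:R :> R by rewrite ltr0n.
apply/nbhs_ballP; exists (e / n.+1%:R) => /=; first exact: divr_gt0.
move=> y; rewrite -ball_normE /ball_/= distrC ltr_pdivlMr// => yx; apply: eA.
apply: le_lt_trans (ler_enorm_norm _) _; apply: le_lt_trans yx.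
by rewrite mulrC ler_wpM2l// ler_nat.
Qed.

Lemma open_enormP (A : set 'rV[R]_n) : open A <->
  forall x, A x -> exists2 e, 0 < e & forall y, enorm (y - x) < e -> A y.
Proof.
rewrite openE; split=> oA x Ax; first exact/nbhs_enormP/oA.
exact/nbhs_enormP/oA.
Qed.

Lemma closure_enormP (A : set 'rV[R]_n) x : closure A x <->
  forall e, 0 < e -> exists2 y, A y & enorm (y - x) < e.
Proof.
split=> [cA e e0|cA B /nbhs_enormP[e e0 eB]].
  have /cA[y [Ay yx]] : nbhs x [set y | enorm (y - x) < e].
    by apply/nbhs_enormP; exists e.
  by exists y.
by have [y Ay yx] := cA _ e0; exists y; split => //; exact: eB.
Qed.

Lemma closed_enormP (A : set 'rV[R]_n) : closed A <->
  forall x, (forall e, 0 < e -> exists2 y, A y & enorm (y - x) < e) -> A x.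
Proof. by split=> cA x; [move/closure_enormP/cA|move/closure_enormP/cA]. Qed.

Lemma continuous_of_enorm (f : 'rV[R]_n -> R) :
  (forall x e, 0 < e -> exists2 d, 0 < d &
     forall y, enorm (y - x) < d -> `|f y - f x| < e) -> continuous f.
Proof.
move=> fc x; have FF := @nbhs_filter _ x.
apply/(@cvgrPdistC_lt _ _ _ _ FF) => e e0.
have [d d0 fd] := fc x e e0.
by apply/(nbhs_enormP x [set y | `|f y - f x| < e]); exists d.
Qed.

Lemma continuous_dotp v : continuous (dotp v).
Proof.
apply: continuous_of_enorm => x e e0.
have v1 : 0 < enorm v + 1 by rewrite ltr_wpDl ?enorm_ge0.
exists (e / (enorm v + 1)); first exact: divr_gt0.
move=> y; rewrite ltr_pdivlMr// => yx.
rewrite -dotpBr; apply: le_lt_trans (normr_dotp _ _) _.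
rewrite mulrC; apply: le_lt_trans yx.
by rewrite ler_wpM2l ?enorm_ge0// lerDl.
Qed.

Lemma continuous_enorm : continuous (@enorm R n).
Proof.
apply: continuous_of_enorm => x e e0; exists e => // y yx.
apply: le_lt_trans yx; rewrite ler_norml ler_enormB andbT.
by rewrite lerNl opprB enormB ler_enormB.
Qed.

Lemma bounded_enormP (A : set 'rV[R]_n) : bounded_set A <->
  exists M, forall x, A x -> enorm x <= M.
Proof.
split=> [[M [Mr AM]]|[M AM]].
  exists (n%:R * (M + 1)) => x Ax; apply: le_trans (ler_enorm_norm _) _.
  by rewrite ler_wpM2l// AM ?ltrDl.
exists M; split; first exact: num_real.
move=> e Me x /AM xM; apply: le_trans (ler_norm_enorm x) _.
exact: le_trans xM (ltW Me).
Qed.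

End Euclidean.

(** * Lebesgue measure of sets of row vectors *)

Section LebesgueTuples.
Context {R : realType}.

Lemma le_integralT d (X : measurableType d) (mu : {measure set X -> \bar R})
    (f g : X -> \bar R) :
  (forall x, 0 <= f x)%E -> (forall x, f x <= g x)%E ->
  (\int[mu]_x f x <= \int[mu]_x g x)%E.
Proof.
move=> f0 fg.
have g0 x : (0 <= g x)%E by exact: le_trans (f0 x) (fg x).
rewrite !ge0_integralTE//; apply: le_ereal_sup => _ [h /= hf <-].
by exists h => // x; exact: le_trans (hf x) (fg x).
Qed.

Lemma lebesgueS n (A : set (n.+1.-tuple R)) :
  lebesgue R n.+1 A =
  (\int[lebesgue_measure]_x lebesgue R n (xsection (@tcons R n @^-1` A) x))%E.
Proof. by []. Qed.

(** The integral of a nonnegative function is a supremum over simple functions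
    below it, hence monotone even for functions that are not measurable. The
    sets to be compared include prisms over arbitrary subsets of an interface. *)
Lemma le_lebesgue n (A B : set (n.-tuple R)) :
  A `<=` B -> (lebesgue R n A <= lebesgue R n B)%E.
Proof.
elim: n A B => [|n IH] A B AB.
  by rewrite /= !diracE lee_fin ler_nat; case: (boolP (_ \in A)) => // /[!inE] /AB;
    rewrite -in_setE => ->.
rewrite !lebesgueS; apply: le_integralT => x //.
by apply: IH => t; rewrite !xsectionE/=; exact: AB.
Qed.

Lemma lebesgue_measure_translate (a : R) (A : set R) : measurable A ->
  lebesgue_measure [set x | A (x + a)] = lebesgue_measure A.
Proof.
move=> mA; pose f : measurableTypeR R -> measurableTypeR R := fun x => x + a.
have mf : measurable_fun setT f.
  exact: measurable_realfun.measurable_funD.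
pose nu := measure_function_pushforward__canonical__measure_function_Measure
  (@lebesgue_measure R) mf.
apply/esym; apply: (@lebesgue_measure_unique R nu) => // _ [[b c] /= bc <-].
rewrite /= /pushforward.
rewrite (_ : _ @^-1` _ = `](b - a), (c - a)]%classic); last first.
  by apply/seteqP; split => x /=; rewrite !in_itv/= ltrBlDr lerBrDr.
rewrite !lebesgue_measure_itv/= !lte_fin ltrD2r; case: ifP => // _.
by rewrite -!EFinB; congr EFin; ring.
Qed.

Definition tadd n (e t : n.-tuple R) : n.-tuple R :=
  [tuple tnth t i + tnth e i | i < n].

Lemma measurable_tadd n (e : n.-tuple R) : measurable_fun setT (tadd e).
Proof.
apply/measurable_fun_tnthP => i.
rewrite (_ : _ \o _ = (fun t => tnth t i + tnth e i)); last first.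
  by apply/funext => t /=; rewrite tnth_mktuple.
by apply: measurable_realfun.measurable_funD => //; exact: measurable_tnth.
Qed.

(** Both sides are product measures agreeing on rectangles. *)
Lemma lebesgue_translate n (e : n.-tuple R) A : measurable A ->
  lebesgue R n (tadd e @^-1` A) = lebesgue R n A.
Proof.
elim: n e A => [|n IH] e A mA.
  by congr (lebesgue R 0 _); apply/funext => t /=; rewrite (tuple0 t) [tadd _ _]tuple0.
pose e' := [tuple of behead e]; pose e0 := tnth e ord0.
pose f (p : measurableTypeR R * n.-tuple R) : measurableTypeR R * n.-tuple R :=
  (p.1 + e0, tadd e' p.2).
have mf : measurable_fun setT f.
  apply: measurable_fun_pair; first by apply: measurable_realfun.measurable_funD.
  by apply: measurableT_comp => //; exact: measurable_tadd.
pose nu := measure_function_pushforward__canonical__measure_function_Measure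
  (@lebesgue_measure R \x lebesgue R n)%E mf.
have ft p : tadd e (@tcons R n p) = @tcons R n (f p).
  case: p => x t; apply: eq_from_tnth => i; rewrite tnth_mktuple.
  case: (unliftP ord0 i) => [j ->|->]; rewrite /tcons /=.
    rewrite !tnthS tnth_mktuple /e' tnth_behead; congr (_ + tnth _ _).
    by apply: val_inj; rewrite /= inordK// ltnS.
  by rewrite !tnth0.
have mA' : measurable (@tcons R n @^-1` A : set (measurableTypeR R * n.-tuple R)).
  by rewrite -[X in measurable X]setTI; exact: measurable_tcons.
rewrite /= /lebesgue_step /pushforward.
rewrite [RHS](@product_measure_unique _ _ _ _ _ _ _ nu)//= /pushforward.
  by congr ((_ \x _)%E _); apply/seteqP; split => p /=; rewrite ft.
move=> B C mB mC; rewrite -(IH e' _ mC) -(lebesgue_measure_translate e0 mB).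
rewrite -product_measure1E//.
- by rewrite -[X in measurable X]setTI; apply: measurable_realfun.measurable_funD.
- by rewrite -[X in measurable X]setTI; apply: measurable_tadd.
Qed.

End LebesgueTuples.

Section Volume.
Context {R : realType} {d : nat}.
Implicit Types (A B : set 'rV[R]_d) (x v e : 'rV[R]_d).

Definition Borel A : Prop := measurable (row_of_tuple @^-1` A : set (d.-tuple R)).

Definition null A : Prop := (lebesgue R d).-negligible (row_of_tuple @^-1` A).

Lemma BorelI A B : Borel A -> Borel B -> Borel (A `&` B).
Proof. exact: measurableI. Qed.

Lemma BorelU A B : Borel A -> Borel B -> Borel (A `|` B).
Proof. exact: measurableU. Qed.

Lemma BorelC A : Borel A -> Borel (~` A).
Proof. exact: measurableC. Qed.

(** Open sets are countable unions of rational boxes. *)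
Lemma open_Borel A : open A -> Borel A.
Proof.
move=> oA.
pose box (p : d.-tuple rat * rat) : set (d.-tuple R) :=
  [set t | forall i, `|tnth t i - ratr (tnth p.1 i)| < ratr p.2].
pose inner := [set p | box p `<=` row_of_tuple @^-1` A].
rewrite /Borel (_ : _ @^-1` _ = \bigcup_(p in inner) box p); last first.
  apply/seteqP; split => [t At|t [p]]; last by move=> pA; exact: pA.
  have /open_enormP/(_ _ At)[e e0 eA] := oA.
  have d0 : 0 < (d.*2.+1)%:R :> R by rewrite ltr0n.
  have [q qe] := @rat_in_itvoo R 0 (e / (d.*2.+1)%:R) (divr_gt0 e0 d0).
  move: qe; rewrite in_itv/= => /andP[q0 qe].
  have near i : exists2 s : rat, (fun s => `|tnth t i - ratr s| < ratr q :> R) s & True.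
    have tq : tnth t i - ratr q < tnth t i + ratr q by lra.
    have [s] := rat_in_itvoo tq.
    rewrite in_itv/= => /andP[s1 s2]; exists s => //.
    by rewrite ltr_norml; apply/andP; split; lra.
  have {near}near i := cid2 (near i).
  exists ([tuple sval (near i) | i < d], q) => /=; last first.
    by move=> i /=; rewrite tnth_mktuple; case: (near i).
  move=> t' /= t'q; apply: eA.
  apply: le_lt_trans (ler_enorm_norm _) _.
  apply: (@le_lt_trans _ _ (d%:R * (2 * ratr q))).
    rewrite ler_wpM2l// [leLHS]mx_normrE; apply/bigmax_leP; split; first by rewrite mulr_ge0// ltW.
    move=> [i j] _ /=; rewrite ord1 !mxE; have := t'q j; rewrite tnth_mktuple.
    case: (near j) => /= s sq _ s't.
    have := ler_distD (ratr s) (tnth t' j) (tnth t j).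
    by rewrite (distrC (ratr s)); lra.
  rewrite mulrA -natrM muln2; move: qe; rewrite ltr_pdivlMr// => qe.
  apply: le_lt_trans qe; rewrite mulrC ler_wpM2l ?ler_nat//; exact: ltW.
rewrite bigcup_mkcond; apply: countable_bigcupT_measurable => // p.
case: ifPn => // _; rewrite (_ : box p = \bigcap_(i in [set: 'I_d])
    [set t | `|tnth t i - ratr (tnth p.1 i)| < ratr p.2]); last first.
  by apply/seteqP; split => t bt => [i _|i]; exact: bt.
apply: fin_bigcap_measurable => // i _.
rewrite (_ : [set _ | _] = (fun t => tnth t i) @^-1`
    ball (ratr (tnth p.1 i) : R) (ratr p.2)); last first.
  by apply/seteqP; split => t /=; rewrite -ball_normE /ball_/= distrC.
by rewrite -[X in measurable X]setTI; apply: measurable_tnth => //; exact: measurable_realfun.measurable_ball.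
Qed.

Lemma closed_Borel A : closed A -> Borel A.
Proof.
by move=> cA; rewrite -[A]setCK; apply: BorelC; apply: open_Borel; rewrite openC.
Qed.

Lemma volume_ge0 A : (0 <= volume A)%E. Proof. exact: measure_ge0. Qed.

Lemma volume0 : volume (set0 : set 'rV[R]_d) = 0%E.
Proof. by rewrite /volume preimage_set0 measure0. Qed.

Lemma le_volume A B : A `<=` B -> (volume A <= volume B)%E.
Proof. by move=> AB; apply: le_lebesgue => t; exact: AB. Qed.

Lemma volume_translate e A : Borel A -> volume [set x | A (x + e)] = volume A.
Proof.
move=> mA; rewrite -[RHS](lebesgue_translate [tuple e 0 i | i < d])//.
congr (lebesgue R d _); apply/seteqP.
suff E t : row_of_tuple t + e = row_of_tuple (tadd [tuple e 0 i | i < d] t).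
  by split => t /=; rewrite E.
by apply/rowP => i; rewrite !mxE !tnth_mktuple.
Qed.

Lemma Borel_translate e A : Borel A -> Borel [set x | A (x + e)].
Proof.
move=> mA; rewrite /Borel.
suff -> : row_of_tuple @^-1` [set x | A (x + e)] =
    setT `&` tadd [tuple e 0 i | i < d] @^-1` (row_of_tuple @^-1` A).
  by apply: measurable_tadd.
rewrite setTI; suff E t : row_of_tuple t + e = row_of_tuple (tadd [tuple e 0 i | i < d] t).
  by apply/seteqP; split => t /=; rewrite E.
by apply/rowP => i; rewrite !mxE !tnth_mktuple.
Qed.

Lemma volumeU A B : Borel A -> Borel B -> A `&` B `<=` set0 ->
  volume (A `|` B) = (volume A + volume B)%E.
Proof.
move=> mA mB AB; apply: measureU => //.
by rewrite -preimage_setI; apply/seteqP; split => t // /AB.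
Qed.

Lemma null_volume A : Borel A -> volume A = 0%E -> null A.
Proof. by move=> mA A0; apply/negligibleP. Qed.

Lemma volume_null A : null A -> volume A = 0%E.
Proof.
move=> [N [mN N0 AN]]; apply/eqP; rewrite eq_le volume_ge0 andbT -N0.
exact: le_lebesgue.
Qed.

Lemma nullS A B : A `<=` B -> null B -> null A.
Proof. by move=> AB; apply: negligibleS => t; exact: AB. Qed.

Lemma nullU A B : null A -> null B -> null (A `|` B).
Proof. exact: negligibleU. Qed.

Lemma null0 : null set0.
Proof. by apply: null_volume; [exact: measurable0|exact: volume0]. Qed.

Lemma null_bigcup (F : (set 'rV[R]_d)^nat) :
  (forall k, null (F k)) -> null (\bigcup_k F k).
Proof. by move=> nF; rewrite /null preimage_bigcup; exact: negligible_bigcup. Qed.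

Lemma null_seq (I : eqType) (s : seq I) (F : I -> set 'rV[R]_d) :
  (forall i, i \in s -> null (F i)) -> null [set x | exists2 i, i \in s & F i x].
Proof.
elim: s => [|i s IH] nF; first by apply: nullS null0 => x [].
apply: (@nullS _ (F i `|` [set x | exists2 i, i \in s & F i x])).
  by move=> x [j]; rewrite inE => /predU1P[->|js] Fj; [left|right; exists j].
apply: nullU; first by apply: nF; rewrite mem_head.
by apply: IH => j js; apply: nF; rewrite inE js orbT.
Qed.

Lemma volumeU0 A B : Borel A -> Borel B -> null (A `&` B) ->
  volume (A `|` B) = (volume A + volume B)%E.
Proof.
move=> mA mB AB.
have mBA : Borel (B `&` ~` A) by apply: BorelI => //; exact: BorelC.
have -> : A `|` B = A `|` (B `&` ~` A) by rewrite setUIr setUCr setIT.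
rewrite volumeU//; last by move=> x [Ax [_ ]].
have {2}-> : B = (B `&` ~` A) `|` (B `&` A) by rewrite -setIUr setUC setUCr setIT.
rewrite volumeU//; last 2 first.
- exact: BorelI.
- by move=> x [[_ nA] [_]].
by rewrite (@volume_null (B `&` A)) ?adde0// setIC.
Qed.

End Volume.

Lemma lebesgue_box (R : realType) n (M : R) : 0 <= M ->
  lebesgue R n [set t | forall i, `|tnth t i| <= M] = ((2 * M) ^+ n)%:E.
Proof.
move=> M0; elim: n => [|n IH].
  by rewrite /= diracE mem_set// => -[].
rewrite /= /lebesgue_step /pushforward.
rewrite (_ : _ @^-1` _ = `[- M, M]%classic `*` [set t : n.-tuple R | forall i, `|tnth t i| <= M]); last first.
  apply/seteqP; split => -[x t] /=.
    move=> xt; split; first by have := xt ord0; rewrite /tcons/= tnth0 in_itv/= ler_norml.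
    by move=> i; have := xt (lift ord0 i); rewrite /tcons/= tnthS.
  rewrite in_itv/= -ler_norml => -[xM tM] i.
  by case: (unliftP ord0 i) => [j ->|->]; rewrite /tcons/= ?tnthS ?tnth0.
rewrite product_measure1E//; last first.
  rewrite (_ : [set _ | _] = \bigcap_(i in [set: 'I_n]) [set t | `|tnth t i| <= M]); last first.
    by apply/seteqP; split => t bt => [i _|i]; exact: bt.
  apply: fin_bigcap_measurable => // i _.
  rewrite (_ : [set _ | _] = (fun t => tnth t i) @^-1` `[- M, M]%classic); last first.
    by apply/seteqP; split => t /=; rewrite in_itv/= ler_norml.
  by rewrite -[X in measurable X]setTI; apply: measurable_tnth.
rewrite IH exprS EFinM; congr (_ * _)%E.
transitivity (lebesgue_measure (`[- M, M]%classic : set R)); first by [].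
rewrite lebesgue_measure_itv/= lte_fin; case: ifPn => [_|].
  by rewrite -EFinB; congr EFin; ring.
by rewrite -leNgt => MM; congr EFin; lra.
Qed.

Section BoundedVolume.
Context {R : realType} {d : nat}.
Implicit Types (A B : set 'rV[R]_d) (x v e : 'rV[R]_d).

Lemma volume_bounded A M : 0 <= M -> (forall x, A x -> enorm x <= M) ->
  (volume A <= ((2 * M) ^+ d)%:E)%E.
Proof.
move=> M0 AM; rewrite -lebesgue_box//; apply: le_lebesgue => t /AM tM i.
by have := le_trans (ler_coord_enorm (row_of_tuple t) i) tM; rewrite mxE.
Qed.

Lemma volume_fin A : bounded_set A -> volume A \is a fin_num.
Proof.
move=> /bounded_enormP[M AM]; rewrite ge0_fin_numE ?volume_ge0//.
apply: le_lt_trans (@volume_bounded A `|M| _ _) (ltry _) => // x /AM xM.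
exact: le_trans xM (ler_norm _).
Qed.

End BoundedVolume.

(** * Hyperplanes and prisms *)

Section Hyperplanes.
Context {R : realType} {d : nat}.
Implicit Types (A B P : set 'rV[R]_d) (x y v w e : 'rV[R]_d) (c : R).

Definition vol A : R := fine (volume A).

Lemma vol_ge0 A : 0 <= vol A.
Proof. exact/fine_ge0/volume_ge0. Qed.

Lemma volE A : bounded_set A -> volume A = (vol A)%:E.
Proof. by move=> bA; rewrite /vol fineK// volume_fin. Qed.

Lemma le_vol A B : bounded_set B -> A `<=` B -> vol A <= vol B.
Proof.
move=> bB AB; have bA : bounded_set A.
  by move/bounded_enormP: bB => [M BM]; apply/bounded_enormP; exists M => x /AB/BM.
by rewrite -lee_fin -!volE//; exact: le_volume.
Qed.

Lemma closed_dotp v (D : set R) : closed D -> closed [set x | D (dotp v x)].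
Proof.
move=> cD; apply: (@closed_comp _ _ (dotp v) D) => // x _; exact: continuous_dotp.
Qed.

Lemma hyperplane_closed v c : closed (hyperplane v c).
Proof. exact: (@closed_dotp v [set c] (@closed_eq R c)). Qed.

Lemma enorm_ball_closed M : closed [set x : 'rV[R]_d | enorm x <= M].
Proof.
apply: (@closed_comp _ _ (@enorm R d) [set r | r <= M]); last exact: closed_le.
by move=> x _; exact: continuous_enorm.
Qed.

Lemma null_translate e A : null A -> null [set x | A (x + e)].
Proof.
move=> [N [mN N0 AN]].
exists ((tadd [tuple e 0 i | i < d]) @^-1` N); split.
- by rewrite -[X in measurable X]setTI; apply: measurable_tadd.
- by rewrite -N0; apply: lebesgue_translate.
move=> t /= Ate; apply: AN => /=.
suff -> : row_of_tuple (tadd [tuple e 0 i | i < d] t) = row_of_tuple t + e by [].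
by apply/rowP => i; rewrite !mxE !tnth_mktuple.
Qed.

Definition stack P e N : set 'rV[R]_d := [set x | exists2 j, (j < N)%N & P (x - j%:R *: e)].

Lemma stackS P e N : stack P e N.+1 = stack P e N `|` [set x | P (x - N%:R *: e)].
Proof.
apply/seteqP; split => x.
  move=> [j]; rewrite ltnS leq_eqVlt => /predU1P[->|jN] Pj; first by right.
  by left; exists j.
by move=> [[j jN Pj]|PN]; [exists j => //; exact: ltnW|exists N].
Qed.

Lemma Borel_stack P e N : Borel P -> Borel (stack P e N).
Proof.
move=> mP; elim: N => [|N IH].
  by rewrite (_ : stack _ _ _ = set0) ?/Borel ?preimage_set0//; apply/seteqP; split => x [].
by rewrite stackS; apply: BorelU => //; exact: Borel_translate.
Qed.

Lemma volume_stack P e N : Borel P -> bounded_set P ->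
  (forall j k, (j < k)%N -> null [set x | P (x - j%:R *: e) /\ P (x - k%:R *: e)]) ->
  volume (stack P e N) = (N%:R * vol P)%:E.
Proof.
move=> mP bP nP; elim: N => [|N IH].
  rewrite mul0r (_ : stack _ _ _ = set0) ?volume0//.
  by apply/seteqP; split => x [].
rewrite stackS volumeU0 ?IH//.
- by rewrite volume_translate// volE// -EFinD -natr1 mulrDl mul1r.
- exact: Borel_stack.
- exact: Borel_translate.
apply: (@nullS _ _ _ [set x | exists2 j, j \in iota 0 N &
    [set x | P (x - j%:R *: e) /\ P (x - N%:R *: e)] x]).
  by move=> x [[j jN Pj] PN]; exists j => //; rewrite mem_iota.
by apply: null_seq => j; rewrite mem_iota => jN; exact: nP.
Qed.

Lemma archi_eq0 (x C : R) : 0 <= x -> (forall N : nat, N%:R * x <= C) -> x = 0.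
Proof.
move=> x0 xC; apply/eqP; rewrite eq_le x0 andbT leNgt; apply/negP => xgt0.
have := xC (Num.truncn (C / x)).+1; rewrite -ler_pdivlMr// leNgt => /negP; apply.
exact: truncnS_gt.
Qed.

(** Arbitrarily many disjoint translates of a bounded piece of a hyperplane
    fit in one ball, so its volume is zero. *)
Lemma hyperplane_null v c : v != 0 -> null (hyperplane v c).
Proof.
move=> v0; pose P (k : nat) := hyperplane v c `&` [set x | enorm x <= k%:R].
apply: (@nullS _ _ _ (\bigcup_k P k)).
  move=> x Hx; exists (Num.truncn (enorm x)).+1 => //; split => //=.
  exact/ltW/truncnS_gt.
apply: null_bigcup => k.
have cP : closed (P k) by apply: closedI; [exact: hyperplane_closed|exact: enorm_ball_closed].
have bP : bounded_set (P k) by apply/bounded_enormP; exists k%:R => x [].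
have vv : 0 < dotp v v by rewrite lt_def dotp_eq0 v0 dotp_ge0.
apply: null_volume; first exact: closed_Borel.
rewrite volE//; congr EFin.
apply: (@archi_eq0 _ ((2 * (k%:R + enorm v)) ^+ d)); first exact: vol_ge0.
case=> [|N]; first by rewrite mul0r exprn_ge0// mulr_ge0// addr_ge0// enorm_ge0.
have N0 : 0 < N.+1%:R :> R by rewrite ltr0n.
rewrite -lee_fin -(@volume_stack (P k) (N.+1%:R^-1 *: v)) => [|||i j ij] //.
- apply: volume_bounded; first by rewrite addr_ge0 ?enorm_ge0.
  move=> x [j jN [_ /= xk]]; rewrite -(subrK (j%:R *: (N.+1%:R^-1 *: v)) x).
  apply: le_trans (ler_enormD _ _) _; apply: lerD => //.
  rewrite scalerA enormZ ger0_norm// -[leRHS]mul1r ler_wpM2r ?enorm_ge0//.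
  by rewrite ler_pdivrMr// mul1r ler_nat ltnW.
- exact: closed_Borel.
apply: nullS (@null0 _ _) => x [[Hi _] [Hj _]].
have : dotp v (x - i%:R *: (N.+1%:R^-1 *: v)) = dotp v (x - j%:R *: (N.+1%:R^-1 *: v)).
  by rewrite Hi Hj.
rewrite !scalerA !(dotpBr, dotpZr) => /addrI/oppr_inj.
move/(mulIf (lt0r_neq0 vv))/(mulIf _); rewrite invr_neq0 ?lt0r_neq0// => /(_ isT).
by move/eqP; rewrite eqr_nat => /eqP ijE; rewrite ijE ltnn in ij.
Qed.

Lemma hyperplane_dotp v c x : hyperplane v c x = (dotp v x = c).
Proof. by []. Qed.

(** If it is null, almost every line of direction [e] avoids [A]. *)
Definition shadow e A : set 'rV[R]_d := [set x | exists s, A (x + s *: e)].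

Lemma shadow_hyperplane_null v c e : v != 0 -> dotp v e = 0 ->
  null (shadow e (hyperplane v c)).
Proof.
move=> v0 ve; apply: nullS (hyperplane_null c v0) => x [s].
by rewrite /hyperplane/= dotpDr dotpZr ve mulr0 addr0.
Qed.

(** The intersection of two distinct hyperplanes has codimension two, so its
    shadow lies in a hyperplane. *)
Lemma shadow_hyperplane2_null v c v' c' e : v != 0 -> v' != 0 ->
  ~ (hyperplane v c `<=` hyperplane v' c') ->
  null (shadow e (hyperplane v c `&` hyperplane v' c')).
Proof.
move=> v0 v'0 HH'.
have [ve|ve] := eqVneq (dotp v e) 0.
  by apply: nullS (shadow_hyperplane_null c v0 ve) => x [s [Hs _]]; exists s.
pose k := dotp v' e / dotp v e; pose w := v' - k *: v.
have [w0|w0] := eqVneq w 0.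
  have v'k : v' = k *: v by apply/eqP; rewrite -subr_eq0 -/w w0.
  apply: nullS (@null0 _ _) => x [s [Hv Hv']]; apply: HH' => y Hy.
  by rewrite hyperplane_dotp -Hv' v'k !dotpZl Hy Hv.
apply: nullS (hyperplane_null (c' - k * c) w0) => x [s [Hv Hv']].
rewrite hyperplane_dotp -Hv -Hv' /w dotpBl dotpZl !dotpDr !dotpZr /k.
by field.
Qed.

End Hyperplanes.

Section Prisms.
Context {R : realType} {d : nat}.
Implicit Types (A B P : set 'rV[R]_d) (x y v w e : 'rV[R]_d) (c : R).

(** Over a subset of a hyperplane transversal to [e], the height of a point of
    the prism is an affine function of the point. *)
Lemma prismP A e v c x : dotp v e != 0 -> A `<=` hyperplane v c ->
  prism e A x <-> let s := (dotp v x - c) / dotp v e in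
                  0 <= s <= 1 /\ A (x - s *: e).
Proof.
move=> ve AH; split=> [[[y t] /= [Ay t01] <-]|/= [s01 As]].
  rewrite dotpDr dotpZr (AH _ Ay) addrAC subrr add0r mulfK//.
  by rewrite addrK.
by exists (x - ((dotp v x - c) / dotp v e) *: e, (dotp v x - c) / dotp v e); rewrite //= subrK.
Qed.

Lemma prism_bounded e A : bounded_set A -> bounded_set (prism e A).
Proof.
move=> /bounded_enormP[M AM]; apply/bounded_enormP; exists (M + enorm e).
move=> _ [[y t] /= [Ay /andP[t0 t1]] <-]; apply: le_trans (ler_enormD _ _) _.
rewrite lerD ?AM// enormZ ger0_norm// -[leRHS]mul1r.
by rewrite ler_wpM2r ?enorm_ge0.
Qed.

Lemma prism_mono e A B : A `<=` B -> prism e A `<=` prism e B.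
Proof. by move=> AB _ [[y t] /= [/AB By t01] <-]; exists (y, t). Qed.

Lemma continuous_affine (f : 'rV[R]_d -> R) e : continuous f ->
  continuous (fun x => x - f x *: e).
Proof.
move=> cf x; have FF := @nbhs_filter _ x.
apply: (@cvgB _ _ _ _ FF _ _ x (f x *: e)); first exact: cvg_id.
exact: (@cvgZr_tmp _ _ _ _ FF f (f x) e (cf x)).
Qed.

Lemma prism_closed e A v c : dotp v e != 0 -> A `<=` hyperplane v c ->
  closed A -> closed (prism e A).
Proof.
move=> ve AH cA; pose f x := (dotp v x - c) / dotp v e.
have cf : continuous f.
  move=> x; apply: (@continuous_comp _ _ _ (dotp v) (fun r => (r - c) / dotp v e)).
    exact: continuous_dotp.
  by apply: cvgMr_tmp; apply: cvgB; [exact: cvg_id|exact: cvg_cst].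
rewrite (_ : prism e A = (f @^-1` `[0, 1]%classic) `&` (fun x => x - f x *: e) @^-1` A).
  apply: closedI.
    apply: (@closed_comp _ _ f); first by move=> x _; exact: cf.
    exact: interval_closed.
  apply: (@closed_comp _ _ (fun x => x - f x *: e)) => // x _.
  exact: continuous_affine.
apply/seteqP; split => x; first by move/(prismP x ve AH) => [] /=; rewrite in_itv.
by rewrite /= in_itv/= => -[f01 Af]; apply/(prismP x ve AH).
Qed.

Lemma prism_parallel_null e A v c : v != 0 -> A `<=` hyperplane v c ->
  dotp v e = 0 -> null (prism e A).
Proof.
move=> v0 AH ve; apply: nullS (hyperplane_null c v0).
by move=> _ [[y t] /= [/AH Hy _] <-]; rewrite hyperplane_dotp dotpDr dotpZr ve mulr0 addr0.
Qed.

Lemma prismN e A x : prism (- e) A x <-> prism e A (x + e).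
Proof.
split=> -[[y t] /= [Ay /andP[t0 t1]]] yx; exists (y, 1 - t); rewrite /=.
- by split => //; apply/andP; split; lra.
- by rewrite -yx scalerBl scale1r scalerN addrA addrAC.
- by split => //; apply/andP; split; lra.
- rewrite scalerN scalerBl scale1r opprB addrA yx.
  by rewrite addrK.
Qed.

Lemma volume_prismN e A v c : dotp v e != 0 -> A `<=` hyperplane v c ->
  closed A -> volume (prism (- e) A) = volume (prism e A).
Proof.
move=> ve AH cA.
have -> : prism (- e) A = [set x | prism e A (x + e)].
  by apply/seteqP; split => x; have [] := prismN e A x.
apply: volume_translate; apply: closed_Borel.
exact: prism_closed ve AH cA.
Qed.

Section transversal.
Variables (v : 'rV[R]_d) (c : R).
Hypothesis v0 : v != 0.

(** A prism along [N e] is a stack of [N] translates of a prism along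
    [e], which overlap in hyperplanes only. *)
Lemma vol_prism_natmul e A N : 0 < dotp v e -> A `<=` hyperplane v c ->
  closed A -> bounded_set A ->
  vol (prism (N.+1%:R *: e) A) = N.+1%:R * vol (prism e A).
Proof.
move=> ve AH cA bA; have ve0 := lt0r_neq0 ve.
have N0 : 0 < N.+1%:R :> R by rewrite ltr0n.
apply: EFin_inj; rewrite -volE; last exact: prism_bounded.
rewrite -(@volume_stack _ _ _ e).
- congr volume; apply/seteqP; split => x.
    move=> [[y t] /= [Ay /andP[t0 t1]] <-].
    have [t1'|t1'] := eqVneq t 1.
      exists N => //; exists (y, 1) => //=; first by rewrite lexx ler01.
      by rewrite t1' scalerA -addrA -scalerBl mul1r; congr (_ + _ *: _); rewrite -natr1; ring.
    pose j := Num.truncn (N.+1%:R * t).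
    have Nt0 : 0 <= N.+1%:R * t by rewrite mulr_ge0.
    have /andP[jt tj] := truncn_itv Nt0.
    exists j.
      by rewrite -(ltr_nat R); apply: le_lt_trans jt _; rewrite -[ltRHS]mulr1 ltr_pM2l// lt_neqAle t1'.
    exists (y, N.+1%:R * t - j%:R) => /=; first split => //.
      have tj' : N.+1%:R * t < j%:R + 1 by rewrite natr1.
      by rewrite subr_ge0 jt lerBlDl ltW.
    by rewrite scalerA -addrA -scalerBl mulrC.
  move=> [j jN [[y t] /= [Ay /andP[t0 t1]] yx]].
  exists (y, (j%:R + t) / N.+1%:R) => /=; first split => //.
    have j1 : j%:R + 1 <= N.+1%:R :> R by rewrite natr1 ler_nat.
    apply/andP; split; first by rewrite divr_ge0 ?addr_ge0 // ltW.
    by rewrite ler_pdivrMr// mul1r; lra.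
  rewrite scalerA divfK ?lt0r_neq0// scalerDl addrCA yx addrC.
  by rewrite subrK.
- by apply: closed_Borel; exact: prism_closed ve0 AH cA.
- exact: prism_bounded.
move=> j k jk; apply: nullS (hyperplane_null (c + k%:R * dotp v e) v0) => x.
move=> [/(prismP _ ve0 AH)[/andP[_ +] _] /(prismP _ ve0 AH)[/andP[+ _] _]].
rewrite !dotpBr !dotpZr ler_pdivrMr// mul1r pmulr_lge0 ?invr_gt0// => xj xk.
have jk1 : j%:R + 1 <= k%:R :> R by rewrite natr1 ler_nat.
have : (j%:R + 1) * dotp v e <= k%:R * dotp v e by rewrite ler_pM2r.
rewrite hyperplane_dotp; lra.
Qed.

Lemma prismZ_mono e A s t : 0 <= s -> s <= t -> prism (s *: e) A `<=` prism (t *: e) A.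
Proof.
move=> s0 st _ [[y k] /= [Ay /andP[k0 k1]] <-].
have [t0|t0] := eqVneq t 0.
  have -> : s = 0 by lra.
  by exists (y, k); rewrite /= ?t0// k0.
have tp : 0 < t by rewrite lt_neqAle eq_sym t0 (le_trans s0).
exists (y, k * (s / t)); rewrite /=; last by rewrite !scalerA; congr (_ + _ *: _); field.
split => //; apply/andP; split; first by rewrite mulr_ge0// divr_ge0// ltW.
by rewrite mulr_ile1// ?divr_ge0// ?ler_pdivrMr ?mul1r// ltW.
Qed.

Lemma vol_prismZ e A t : 0 < dotp v e -> A `<=` hyperplane v c ->
  closed A -> bounded_set A -> 0 < t ->
  vol (prism (t *: e) A) = t * vol (prism e A).
Proof.
move=> ve AH cA bA t0; apply/eqP; rewrite -subr_eq0 -normr_eq0; apply/eqP.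
apply: (@archi_eq0 _ _ (vol (prism e A))) => //.
case=> [|N]; first by rewrite mul0r vol_ge0.
have N0 : 0 < N.+1%:R :> R by rewrite ltr0n.
have N0' := lt0r_neq0 N0.
pose e' := N.+1%:R^-1 *: e.
have ve' : 0 < dotp v e' by rewrite dotpZr mulr_gt0 ?invr_gt0.
have Fe : vol (prism e A) = N.+1%:R * vol (prism e' A).
  by rewrite -(vol_prism_natmul _ ve' AH cA bA) scalerA divff// scale1r.
have te' : t *: e = (t * N.+1%:R) *: e' by rewrite scalerA mulfK.
have tN : 0 <= t * N.+1%:R by rewrite mulr_ge0// ltW.
have /andP[] := truncn_itv tN; set k := Num.truncn _ => kt tk.
have bp w : bounded_set (prism w A) by exact: prism_bounded.
have up : vol (prism (t *: e) A) <= k.+1%:R * vol (prism e' A).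
  rewrite -(vol_prism_natmul _ ve' AH cA bA) te'; apply: le_vol => //.
  by apply: prismZ_mono => //; exact: ltW.
have lo : k%:R * vol (prism e' A) <= vol (prism (t *: e) A).
  case: (k) kt {tk up} => [|k'] kt; first by rewrite mul0r vol_ge0.
  rewrite -(vol_prism_natmul _ ve' AH cA bA) te'; apply: le_vol => //.
  exact: prismZ_mono.
have F0 := vol_ge0 (prism e' A).
rewrite Fe ler_pM2l// ler_norml; apply/andP.
move: up lo; rewrite -natr1; set F := vol (prism e' A) in F0 *; set G := vol _ => up lo.
have tk' : t * N.+1%:R * F <= (k%:R + 1) * F by rewrite ler_wpM2r// natr1 ltW.
have kt' : k%:R * F <= t * N.+1%:R * F by rewrite ler_wpM2r.
by split; lra.
Qed.

End transversal.
End Prisms.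

Section PrismVolume.
Context {R : realType} {d : nat}.
Implicit Types (A B : set 'rV[R]_d) (x y v w e : 'rV[R]_d) (c : R).

(** The closed [r]-neighbourhood of [A] within the hyperplane; the slack [eps]
    makes it closed although the distance to [A] need not be attained. *)
Definition thicken v c A (r : R) : set 'rV[R]_d :=
  [set z | hyperplane v c z /\
           forall eps : R, 0 < eps -> exists2 y, A y & enorm (z - y) < r + eps].

Lemma thicken_closed v c A r : closed (thicken v c A r).
Proof.
apply/closed_enormP => z zA; split.
  have /closed_enormP := @hyperplane_closed R d v c; apply => e /zA[y [Hy _] yz].
  by exists y.
move=> e e0; have e2 : 0 < e / 2 by lra.
have [y [_ /(_ _ e2)[a Aa ya]] yz] := zA _ e2; exists a => //.
apply: le_lt_trans (ler_enorm_distD y _ _) _.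
by rewrite (enormB z y); lra.
Qed.

Lemma thicken_bounded v c A r : bounded_set A -> bounded_set (thicken v c A r).
Proof.
move=> /bounded_enormP[M AM]; apply/bounded_enormP; exists (M + (r + 1)).
move=> z [_ /(_ 1 ltr01)[y Ay zy]]; rewrite -(subrK y z) addrC.
by apply: le_trans (ler_enormD _ _) _; rewrite lerD ?AM// ltW.
Qed.

Lemma thicken_mono v c A r s : r <= s -> thicken v c A r `<=` thicken v c A s.
Proof.
move=> rs z [Hz zA]; split => // e /zA[y Ay zy]; exists y => //.
by apply: lt_le_trans zy _; rewrite lerD2r.
Qed.

Lemma bigcap_thicken v c A r : 0 <= r -> closed A ->
  \bigcap_N thicken v c A (r / N.+1%:R) `<=` A.
Proof.
move=> r0 /closed_enormP cA z zA; apply: cA => e e0.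
have [N rN] : exists N : nat, r / N.+1%:R < e.
  exists (Num.truncn (r / e)); rewrite ltr_pdivrMr ?ltr0n// mulrC -ltr_pdivrMr//.
  exact: truncnS_gt.
have er : 0 < e - r / N.+1%:R by rewrite subr_gt0.
have [_ /(_ _ er)[y Ay zy]] := zA N I.
by exists y => //; rewrite enormB; apply: lt_le_trans zy _; rewrite addrC subrK.
Qed.

(** Cut into [N] slices, a sheared prism is a stack of prisms whose bases are
    slid by less than [enorm w / N]. Straightening the slices puts it inside
    the upright prism over a slightly thickened base; then [N] tends to
    infinity. *)
Lemma prism_shear v c e w A : 0 < dotp v e -> dotp v w = 0 ->
  A `<=` hyperplane v c -> closed A -> bounded_set A ->
  vol (prism (e + w) A) <= vol (prism e A).
Proof.
move=> ve vw AH cA bA.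
have v0 : v != 0 by apply: contraTneq ve => ->; rewrite dotp0l ltxx.
pose B N := thicken v c A (enorm w / N.+1%:R).
have BH N : B N `<=` hyperplane v c by move=> z [].
have cB N : closed (B N) by exact: thicken_closed.
have bB N : bounded_set (B N) by exact: thicken_bounded.
pose F N := prism e (B N).
have bF N : bounded_set (F N) by exact: prism_bounded.
have cF N : closed (F N) by exact: prism_closed (lt0r_neq0 ve) (BH N) (cB N).
have vFN N : vol (prism (e + w) A) <= vol (F N).
  have N0 : 0 < N.+1%:R :> R by rewrite ltr0n.
  have ve' : 0 < dotp v (N.+1%:R^-1 *: (e + w)).
    by rewrite dotpZr dotpDr vw addr0 mulr_gt0 ?invr_gt0.
  have ve'' : 0 < dotp v (N.+1%:R^-1 *: e) by rewrite dotpZr mulr_gt0 ?invr_gt0.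
  have NK (u : 'rV[R]_d) : u = N.+1%:R *: (N.+1%:R^-1 *: u).
    by rewrite scalerA divff ?scale1r// lt0r_neq0.
  rewrite /F {1}(NK (e + w)) (vol_prism_natmul v0 _ ve' AH)// [in leRHS](NK e).
  rewrite (vol_prism_natmul v0 _ ve'' (@BH N))// ler_pM2l//.
  apply: le_vol; first exact: prism_bounded.
  move=> _ [[y t] /= [Ay t01] <-]; exists (y + (t / N.+1%:R) *: w, t) => /=.
    split => //; split.
      by rewrite hyperplane_dotp dotpDr dotpZr vw mulr0 addr0; exact: AH.
    move=> a a0; exists y => //; rewrite addrC addKr enormZ mulrC.
    move/andP: t01 => [t0 t1]; rewrite ger0_norm ?divr_ge0//.
    apply: (@le_lt_trans _ _ (enorm w / N.+1%:R)); last by rewrite ltrDl.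
    by rewrite ler_wpM2l ?enorm_ge0// ler_piMl ?invr_ge0.
  by rewrite -addrA; congr (_ + _); rewrite !scalerDr !scalerA addrC.
have capF : \bigcap_N F N = prism e A.
  apply/seteqP; split => x.
    move=> xF; have ve0 := lt0r_neq0 ve.
    have [/= s01 _] := proj1 (prismP x ve0 (BH 0%N)) (xF 0%N I).
    apply/(prismP x ve0 AH); split => //.
    apply: (@bigcap_thicken v c A (enorm w)); [exact: enorm_ge0|exact: cA|].
    by move=> N _; have [] := proj1 (prismP x ve0 (BH N)) (xF N I).
  move=> xA N _; apply: prism_mono xA => z Az; split; first exact: AH.
  move=> r r0; exists z => //; rewrite subrr enorm0 ltr_wpDl// divr_ge0//.
  exact: enorm_ge0.
have mF N : Borel (F N) by exact: closed_Borel.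
have := @nonincreasing_cvg_mu _ _ R (lebesgue R d) (fun N => row_of_tuple @^-1` F N).
rewrite -preimage_bigcap capF => /(_ _ mF) cvF.
rewrite -lee_fin -!volE; try exact: prism_bounded.
apply: (@cvge_ge nat \oo _ R (fun N => volume (F N))).
  apply: nearW => N.
  rewrite !volE//; first by rewrite lee_fin.
  exact: prism_bounded.
apply: cvF.
- by rewrite -ge0_fin_numE; [exact: volume_fin|exact: volume_ge0].
- by apply: closed_Borel; exact: prism_closed (lt0r_neq0 ve) AH cA.
move=> N M NM; apply/subsetPset => t; apply: prism_mono; apply: thicken_mono.
by rewrite ler_wpM2l ?enorm_ge0// lef_pV2 ?posrE ?ltr0n// ler_nat ltnS.
Qed.

Lemma vol_prism_pos v c e A : enorm v = 1 -> 0 < dotp v e ->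
  A `<=` hyperplane v c -> closed A -> bounded_set A ->
  vol (prism e A) = dotp v e * vol (prism v A).
Proof.
move=> v1 ve AH cA bA.
have vv : dotp v v = 1 by rewrite -sqr_enorm v1 expr1n.
have v0 : v != 0 by apply: contraTneq ve => ->; rewrite dotp0l ltxx.
rewrite -(vol_prismZ v0 _ AH)//; last by rewrite vv.
pose w := e - dotp v e *: v.
have vw : dotp v w = 0 by rewrite dotpBr dotpZr vv mulr1 subrr.
apply/eqP; rewrite eq_le; apply/andP; split.
  rewrite -[X in vol (prism X _) <= _](subrK (dotp v e *: v)) addrC.
  by apply: prism_shear AH _ _ => //; rewrite dotpZr vv mulr1.
rewrite (_ : dotp v e *: v = e + - w); last by rewrite opprB addrC subrK.
by apply: prism_shear AH _ _ => //; rewrite dotpNr vw oppr0.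
Qed.

(** Cavalieri for prisms: shearing along the base does not change the volume,
    so [e] may be replaced by its component along the unit normal. *)
Lemma vol_prism v c e A : enorm v = 1 ->
  A `<=` hyperplane v c -> closed A -> bounded_set A ->
  vol (prism e A) = `|dotp v e| * vol (prism v A).
Proof.
move=> v1 AH cA bA; have v0 : v != 0 by rewrite -enorm_gt0 v1.
have [ve|ve|ve] := ltrgtP (dotp v e) 0.
- rewrite ltr0_norm// -dotpNr -(vol_prism_pos v1 _ AH)//; last by rewrite dotpNr oppr_gt0.
  by rewrite /vol (volume_prismN _ AH)//; exact: ltr0_neq0.
- by rewrite gtr0_norm// -(vol_prism_pos v1 _ AH).
- rewrite ve normr0 mul0r /vol volume_null//.
  exact: prism_parallel_null v0 AH ve.
Qed.

Lemma prism_shadow e A : prism e A `<=` shadow e A.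
Proof.
move=> _ [[y t] /= [Ay _] <-]; exists (- t).
by rewrite scaleNr addrK.
Qed.

(** Another unit normal direction only shortens the height of the prism, and
    another hyperplane meets [A] in codimension two. *)
Lemma area_flat v c A : enorm v = 1 -> A `<=` hyperplane v c ->
  closed A -> bounded_set A -> area A = (vol (prism v A))%:E.
Proof.
move=> v1 AH cA bA; have v0 : v != 0 by rewrite -enorm_gt0 v1.
apply/eqP; rewrite eq_le; apply/andP; split; last first.
  apply: ereal_sup_ubound; exists (v, c) => //=.
  by rewrite setIidl// volE//; exact: prism_bounded.
apply: ub_ereal_sup => _ [[v' c'] /= v'1 <-].
have v'0 : v' != 0 by rewrite -enorm_gt0 v'1.
have [HH'|HH'] := pselect (hyperplane v c `<=` hyperplane v' c').
  rewrite setIidl; last exact: subset_trans AH HH'.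
  rewrite volE; last exact: prism_bounded.
  rewrite lee_fin (vol_prism _ v1 AH)// -[leRHS]mul1r ler_wpM2r ?vol_ge0//.
  by apply: le_trans (normr_dotp _ _) _; rewrite v1 v'1 mul1r.
rewrite volume_null ?lee_fin ?vol_ge0//.
apply: nullS (shadow_hyperplane2_null v' v0 v'0 HH') => x /prism_shadow[s [Ax Hx]].
by exists s; split => //; exact: AH.
Qed.

(** For flat sets, being negligible as seen along one direction does not
    depend on the direction. *)
Lemma shadow_null v c e A B : v != 0 -> area B = 0%E ->
  A `<=` B `&` hyperplane v c -> closed A -> bounded_set A -> null (shadow e A).
Proof.
move=> v0 B0 ABH cA bA.
have AH : A `<=` hyperplane v c by move=> x /ABH[].
pose v1 := (enorm v)^-1 *: v.
have ev : 0 < enorm v by rewrite enorm_gt0.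
have v11 : enorm v1 = 1 by rewrite enormZ ger0_norm ?invr_ge0 ?enorm_ge0// mulVf ?lt0r_neq0.
have HH x : hyperplane v c x <-> hyperplane v1 (c / enorm v) x.
  rewrite !hyperplane_dotp dotpZl mulrC; split=> [->//|].
  by move/(mulIf _); apply; rewrite invr_eq0 lt0r_neq0.
have AH1 : A `<=` hyperplane v1 (c / enorm v) by move=> x /AH/HH.
have P0 : vol (prism v1 A) = 0.
  apply/eqP; rewrite eq_le vol_ge0 andbT -lee_fin -volE; last exact: prism_bounded.
  apply: (@le_trans _ _ (area B)); last by rewrite B0.
  apply: (@le_trans _ _ (volume (prism v1 (B `&` hyperplane v1 (c / enorm v))))).
    by apply/le_volume/prism_mono => x Ax; split; [have [] := ABH _ Ax|exact: AH1].
  by apply: ereal_sup_ubound; exists (v1, c / enorm v).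
have prism0 e' : null (prism e' A).
  have [ve|ve] := eqVneq (dotp v e') 0; first exact: prism_parallel_null v0 AH ve.
  apply: null_volume; first by apply: closed_Borel; exact: prism_closed ve AH cA.
  rewrite volE; last exact: prism_bounded.
  by rewrite (vol_prism _ v11 AH1)// P0 mulr0.
have half e' x s : 0 <= s -> A (x - s *: e') -> (\bigcup_k prism (k.+1%:R *: e') A) x.
  move=> s0 As; exists (Num.truncn s) => //.
  have k0 : 0 < (Num.truncn s).+1%:R :> R by rewrite ltr0n.
  exists (x - s *: e', s / (Num.truncn s).+1%:R) => /=.
    by split => //; rewrite divr_ge0//= ler_pdivrMr// mul1r ltW// truncnS_gt.
  by rewrite scalerA divfK ?lt0r_neq0// subrK.
apply: (@nullS _ _ _ (\bigcup_k prism (k.+1%:R *: e) A `|` \bigcup_k prism (k.+1%:R *: (- e)) A)).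
  move=> x [s As]; have [s0|s0] := leP 0 s.
    by right; apply: (@half _ _ s) => //; rewrite scalerN opprK.
  by left; apply: (@half _ _ (- s)); rewrite ?oppr_ge0 1?ltW// scaleNr opprK.
by apply: nullU; apply: null_bigcup.
Qed.

End PrismVolume.

(** * Cells of a mesh *)

Section Elements.
Context {T : choiceType}.
Implicit Types A : set T.

Definition elements A : seq T := enum_fset (fset_set A).

Lemma mem_elements A x : finite_set A -> (x \in elements A) <-> A x.
Proof. by move=> fA; rewrite in_fset_set// inE. Qed.

Lemma elements_uniq A : uniq (elements A).
Proof. exact: fset_uniq. Qed.

Lemma fsum_elements (V : nmodType) A (F : T -> V) : finite_set A ->
  \sum_(x \in A) F x = \sum_(x <- elements A) F x.
Proof. exact: fsbig_finite. Qed.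

End Elements.

Section Mesh.
Context {R : realType} {d : nat}.
Variables (Th : set (set 'rV[R]_d)) (nrm : set 'rV[R]_d -> set 'rV[R]_d -> 'rV[R]_d).
Variables (h a : R).
Hypotheses (h0 : 0 < h) (a0 : 0 < a) (mesh : admissible_mesh Th nrm h a).
Implicit Types (K L M : set 'rV[R]_d) (x y z v e : 'rV[R]_d).

Lemma cell_open K : Th K -> open K.
Proof. by move=> /(mesh_cell mesh)[]. Qed.

Lemma cell_Borel K : Th K -> Borel K.
Proof. by move=> /cell_open; exact: open_Borel. Qed.

Lemma cell_diam K x y : Th K -> K x -> K y -> enorm (x - y) <= h.
Proof.
move=> TK Kx Ky; rewrite -lee_fin -(mesh_size mesh).
apply: (@le_trans _ _ (diam K)).
  by apply: ereal_sup_ubound; exists (x, y).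
by apply: ereal_sup_ubound; exists K.
Qed.

Lemma cell_diam_closure K x y : Th K -> closure K x -> closure K y ->
  enorm (x - y) <= h.
Proof.
move=> TK /closure_enormP Kx /closure_enormP Ky; apply/ler_addgt0Pr => e e0.
have e2 : 0 < e / 2 by lra.
have [x' Kx' xx'] := Kx _ e2; have [y' Ky' yy'] := Ky _ e2.
apply: le_trans (ler_enorm_distD x' _ _) _.
have := ler_enorm_distD y' x' y; have := cell_diam TK Kx' Ky'.
rewrite (enormB x x'); lra.
Qed.

Lemma cell_vol_gt0 K : Th K -> (0 < volume K)%E.
Proof.
move=> /(mesh_volume mesh); apply: lt_le_trans.
by rewrite lte_fin mulr_gt0// exprn_gt0.
Qed.

Lemma cell_nonempty K : Th K -> K !=set0.
Proof.
move=> /cell_vol_gt0; apply: contraPP => /set0P/negP; rewrite negbK => /eqP ->.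
by rewrite volume0 ltxx.
Qed.

Lemma closure_cell_bounded K : Th K -> bounded_set (closure K).
Proof.
move=> TK; have [x Kx] := cell_nonempty TK; apply/bounded_enormP.
exists (h + enorm x) => y cKy; rewrite -(subrK x y).
apply: le_trans (ler_enormD _ _) _; rewrite lerD2r.
by apply: (cell_diam_closure TK) => //; exact: subset_closure.
Qed.

Lemma cell_bounded K : Th K -> bounded_set K.
Proof.
move=> /closure_cell_bounded/bounded_enormP[M KM]; apply/bounded_enormP; exists M.
by move=> x Kx; apply/KM/subset_closure.
Qed.

Lemma cell_vol K : Th K -> a * h ^+ d <= vol K.
Proof.
by move=> TK; rewrite -lee_fin -volE ?(mesh_volume mesh)//; exact: cell_bounded.
Qed.

Lemma cell_eq K L x : Th K -> Th L -> K x -> L x -> K = L.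
Proof. by move=> TK TL Kx Lx; apply: (mesh_disjoint mesh) => //; exists x. Qed.

Lemma cell_closure_eq K L x : Th K -> Th L -> K x -> closure L x -> K = L.
Proof.
move=> TK TL Kx /closure_enormP cL.
have [e e0 eK] := proj1 (open_enormP K) (cell_open TK) x Kx.
by have [y Ly yx] := cL e e0; apply: (@cell_eq _ _ y) => //; exact: eK.
Qed.

Lemma interfaceC K L : interface K L = interface L K :> set 'rV[R]_d.
Proof. exact: setIC. Qed.

Lemma neighboursC K L : Th K -> neighbours Th K L -> neighbours Th L K.
Proof.
by move=> TK [TL LK aKL]; split => //; [exact/nesym|rewrite interfaceC].
Qed.

Lemma sigmaC K L : sigma K L = sigma L K.
Proof. by rewrite /sigma interfaceC. Qed.

(** In dimension 0 there is no unit vector, and the supremum is over nothing. *)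
Lemma area_ge0 (A : set 'rV[R]_d) : (0 <= area A)%E \/ area A = -oo%E.
Proof.
have [[vc]|] := pselect (exists vc : 'rV[R]_d * R, enorm vc.1 = 1).
  move=> vc1; left; apply: le_trans (ereal_sup_ubound _); last by exists vc.
  exact: volume_ge0.
move=> n; right; rewrite /area (_ : image _ _ = set0) ?ereal_sup0//.
by apply/seteqP; split => // x [vc vc1 _]; apply: n; exists vc.
Qed.

Lemma sigma_ge0 K L : 0 <= sigma K L.
Proof. by rewrite /sigma; case: (area_ge0 (interface K L)) => [/fine_ge0//|->]. Qed.

Lemma interface_closed K L : closed (interface K L : set 'rV[R]_d).
Proof. by apply: closedI; exact: closed_closure. Qed.

Lemma interface_bounded K L : Th K -> bounded_set (interface K L).
Proof.
move=> /closure_cell_bounded/bounded_enormP[M KM]; apply/bounded_enormP; exists M.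
by move=> x [/KM].
Qed.

Definition cells_near (r : R) : set (set 'rV[R]_d) :=
  [set K | Th K /\ exists2 x, closure K x & enorm x <= r].

Lemma cells_near_enorm (r : R) K x : cells_near r K -> closure K x -> enorm x <= r + h.
Proof.
move=> [TK [y Ky yr]] Kx; rewrite -(subrK y x) addrC.
by apply: le_trans (ler_enormD _ _) _; rewrite lerD// (cell_diam_closure TK).
Qed.

Lemma sum_vol_cells (B : seq (set 'rV[R]_d)) (r : R) : uniq B -> 0 <= r ->
  (forall K, K \in B -> Th K /\ forall x, K x -> enorm x <= r) ->
  \sum_(K <- B) vol K <= (2 * r) ^+ d.
Proof.
move=> uB r0 BT; rewrite -lee_fin.
apply: (@le_trans _ _ (volume (\bigcup_(K in [set` B]) K))); last first.
  by apply: volume_bounded => // x [K /= /BT[_ Kr]] /Kr.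
rewrite /volume preimage_bigcup measure_fin_bigcup; last 3 first.
- exact: finite_seq.
- move=> K L KB LB [t [Kt Lt]]; have [TK _] := BT _ KB; have [TL _] := BT _ LB.
  exact: cell_eq TK TL Kt Lt.
- by move=> K /BT[TK _]; exact: cell_Borel.
rewrite -fsbig_seq// -sumEFin big_seq [leRHS]big_seq; apply: lee_sum => K /BT[TK _].
by rewrite -volE//; exact: cell_bounded.
Qed.

Lemma card_cells (B : seq (set 'rV[R]_d)) (r : R) : uniq B -> 0 <= r ->
  (forall K, K \in B -> Th K /\ forall x, K x -> enorm x <= r) ->
  (size B)%:R * (a * h ^+ d) <= (2 * r) ^+ d.
Proof.
move=> uB r0 BT; apply: le_trans (sum_vol_cells uB r0 BT).
rewrite mulr_natl -iter_addr_0 -[size B](count_predT B) -big_const_seq.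
by rewrite big_seq [leRHS]big_seq; apply: ler_sum => K /BT[TK _]; exact: cell_vol.
Qed.

(** A bounded region has finite volume, while the cells that meet it are
    disjoint, remain at bounded distance and have volume at least [a h ^ d]. *)
Lemma finite_cells_near (r : R) : finite_set (cells_near r).
Proof.
apply: contrapT => inf.
have r1 : 0 <= `|r| + h by rewrite addr_ge0// ltW.
have ah : 0 < a * h ^+ d by rewrite mulr_gt0// exprn_gt0.
have [B BT Bn] := infinite_set_fset (Num.truncn ((2 * (`|r| + h)) ^+ d / (a * h ^+ d))).+1 inf.
have := @card_cells (enum_fset B) _ (fset_uniq B) r1.
rewrite -ler_pdivlMr// => /(_ _)/wrap[].
  move=> K KB; have [TK _] := BT _ KB; split => // x Kx.
  apply: (@le_trans _ _ (r + h)); last by rewrite lerD2r ler_norm.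
  exact: cells_near_enorm (BT _ KB) (@subset_closure _ _ _ Kx).
rewrite leNgt => /negP; apply; apply: lt_le_trans (truncnS_gt _) _.
by rewrite ler_nat.
Qed.

Lemma neighbours_touch K L : neighbours Th K L -> interface K L !=set0.
Proof.
move=> [_ _ aKL]; apply: contrapT => /set0P/negP; rewrite negbK => /eqP KL0.
move: aKL; rewrite KL0; apply/negP; rewrite -leNgt.
apply: ub_ereal_sup => _ [[v c] /= _ <-].
rewrite set0I (_ : prism _ _ = set0) ?volume0//.
by apply/seteqP; split => // y [[z t] [[]]].
Qed.

Lemma neighbours_near K L (r : R) : (forall x, closure K x -> enorm x <= r) ->
  Th K -> neighbours Th K L -> cells_near r L.
Proof.
move=> Kr TK KL; have [TL _ _] := KL; split => //.
by have [x [Kx Lx]] := neighbours_touch KL; exists x => //; exact: Kr.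
Qed.

Lemma finite_neighbours K : Th K -> finite_set (neighbours Th K).
Proof.
move=> TK; have /bounded_enormP[r Kr] := closure_cell_bounded TK.
by apply: sub_finite_set (finite_cells_near r) => L; exact: neighbours_near.
Qed.

End Mesh.

(** * Lines in general position *)

Section Lines.
Context {R : realType} {d : nat}.
Implicit Types (A K L M : set 'rV[R]_d) (x y z u v e : 'rV[R]_d) (c : R).

Lemma open_line A z u t : open A -> A (z + t *: u) ->
  exists2 rho, 0 < rho & forall s, `|s - t| < rho -> A (z + s *: u).
Proof.
move=> /open_enormP oA /oA[r r0 rA].
have u1 : 0 < enorm u + 1 by rewrite ltr_wpDl ?enorm_ge0.
exists (r / (enorm u + 1)); first exact: divr_gt0.
move=> s; rewrite ltr_pdivlMr// => st; apply: rA.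
rewrite opprD addrACA subrr add0r -scalerBl enormZ.
by apply: le_lt_trans st; rewrite ler_wpM2l// lerDl.
Qed.

(** Connectedness of the unit interval, with relative neighbourhoods. *)
Lemma unit_interval_clopen (B : set R) :
  (forall s, 0 <= s <= 1 -> exists2 rho, 0 < rho &
     (B s -> forall t, 0 <= t <= 1 -> `|t - s| < rho -> B t) /\
     (~ B s -> forall t, 0 <= t <= 1 -> `|t - s| < rho -> ~ B t)) ->
  B 0 -> B 1.
Proof.
move=> BB B0; pose I01 := `[(0:R), 1]%classic.
have in01 s : I01 s <-> 0 <= s <= 1 by rewrite /I01/= in_itv.
pose U (P : set R) := \bigcup_(p in [set p : R * R | 0 <= p.1 <= 1 /\ P p.1 /\
  0 < p.2 /\ (forall t, 0 <= t <= 1 -> `|t - p.1| < p.2 -> P t)]) ball p.1 p.2.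
have oU P : open (U P) by apply: bigcup_open => p _; exact: ball_open.
have UP P s : I01 s -> U P s -> P s.
  move=> /in01 s01 [[t rho] /= [_ [_ [_ tP]]]].
  by rewrite -ball_normE /ball_/= distrC; exact: tP.
have PU P s : 0 <= s <= 1 -> P s -> (exists2 rho, 0 < rho &
    forall t, 0 <= t <= 1 -> `|t - s| < rho -> P t) -> U P s.
  by move=> s01 Ps [rho rho0 sP]; exists (s, rho) => //=; exact: ballxx.
have : I01 `&` B = I01.
  apply: (@segment_connected R 0 1).
  - by exists 0; split => //; apply/in01; rewrite lexx ler01.
  - exists (U B) => //; apply/seteqP; split => s [s01 Bs]; split => //.
      apply: (PU B s (proj1 (in01 s) s01) Bs).
      have [rho rho0 [BsB _]] := BB s (proj1 (in01 s) s01).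
      by exists rho => //; exact: BsB.
    exact: UP Bs.
  - exists (~` U (~` B)); first exact: open_closedC.
    apply/seteqP; split => s [s01 Bs]; split => //.
      by move=> /(UP _ _ s01).
    apply: contrapT => nBs; apply: Bs.
    apply: (PU (~` B) s (proj1 (in01 s) s01) nBs).
    have [rho rho0 [_ BsB]] := BB s (proj1 (in01 s) s01).
    by exists rho => //; exact: BsB.
have i1 : I01 1 by apply/in01; rewrite lexx ler01.
by move/seteqP => [_ /(_ 1 i1)[]].
Qed.

Lemma off_planes (s : seq ('rV[R]_d * R)) y : exists2 rho, 0 < rho &
  forall vc, vc \in s -> ~ hyperplane vc.1 vc.2 y ->
  forall z, enorm (z - y) < rho -> ~ hyperplane vc.1 vc.2 z.
Proof.
elim: s => [|vc s [rho rho0 IH]]; first by exists 1.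
have [Hy|Hy] := pselect (hyperplane vc.1 vc.2 y).
  by exists rho => // vc'; rewrite inE => /predU1P[->//|]; exact: IH.
have oH : open (~` hyperplane vc.1 vc.2) by rewrite openC; exact: hyperplane_closed.
have [r r0 rH] := proj1 (open_enormP _) oH y Hy.
exists (Num.min rho r); first by rewrite lt_min rho0.
move=> vc'; rewrite inE => /predU1P[->|vc's] H'y z; rewrite lt_min => /andP[z1 z2].
  exact: rH.
exact: IH.
Qed.

Lemma hyperplane_sub v c v' c' : v != 0 -> v' != 0 ->
  hyperplane v c `<=` hyperplane v' c' -> hyperplane v' c' `<=` hyperplane v c.
Proof.
move=> v0 v'0 HH' z H'z.
have vv : dotp v v != 0 by rewrite dotp_eq0.
have v'v' : dotp v' v' != 0 by rewrite dotp_eq0.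
have v'v : dotp v' v != 0.
  apply: contraNneq v'v' => v'v; pose p := (c / dotp v v) *: v.
  have Hp : hyperplane v c p by rewrite hyperplane_dotp dotpZr divfK.
  have Hpv : hyperplane v c (p + v') by rewrite hyperplane_dotp dotpDr Hp dotpC v'v addr0.
  by move: (HH' _ Hpv); rewrite hyperplane_dotp dotpDr (HH' _ Hp) => /eqP;
    rewrite -subr_eq0 addrAC subrr add0r => /eqP ->.
pose k := (dotp v z - c) / dotp v v.
have Hk : hyperplane v c (z - k *: v).
  by rewrite hyperplane_dotp dotpBr dotpZr /k divfK// opprB addrC subrK.
move: (HH' _ Hk); rewrite hyperplane_dotp dotpBr dotpZr H'z => /eqP.
rewrite subr_eq addrC -subr_eq subrr eq_sym mulf_eq0 (negPf v'v) orbF /k.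
by rewrite mulf_eq0 invr_eq0 (negPf vv) orbF subr_eq0 => /eqP.
Qed.

(** The local form of an oriented normal. It constrains a whole neighbourhood
    of [y], so it can be read along any line through [y], while the normal of
    an interface is only oriented along the orthogonal line. *)
Definition sides A B v c y : Prop := exists2 rho, 0 < rho &
  forall z, enorm (z - y) < rho -> (dotp v z < c -> A z) /\ (c < dotp v z -> B z).

End Lines.

Section GeneralPosition.
Context {R : realType} {d : nat}.
Variables (Th : set (set 'rV[R]_d)) (nrm : set 'rV[R]_d -> set 'rV[R]_d -> 'rV[R]_d).
Variables (h a : R).
Hypotheses (h0 : 0 < h) (a0 : 0 < a) (mesh : admissible_mesh Th nrm h a).
Implicit Types (L M : set 'rV[R]_d) (x y z v : 'rV[R]_d).

(** Cells are open and disjoint, so a segment that never leaves their union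
    stays in one of them. *)
Lemma segment_cell M z w :
  (forall t, 0 <= t <= 1 -> exists2 N, Th N & N (z + t *: (w - z))) ->
  Th M -> M z -> M w.
Proof.
move=> cover TM Mz.
suff : M (z + 1 *: (w - z)) by rewrite scale1r addrC subrK.
apply: (@unit_interval_clopen _ [set t | M (z + t *: (w - z))]); last first.
  by rewrite /= scale0r addr0.
move=> s s01; have [N TN Ns] := cover s s01.
have [rho rho0 rhoN] := open_line (cell_open mesh TN) Ns; exists rho => //=.
split=> [Ms t t01 ts|nMs t t01 ts Mt].
  by rewrite (cell_eq mesh TM TN Ms Ns); exact: rhoN.
by apply: nMs; rewrite (cell_eq mesh TM TN Mt (rhoN _ ts)).
Qed.

Definition boundary_planes M : seq ('rV[R]_d * R) :=
  xget [::] [set s : seq ('rV[R]_d * R) | (forall vc, vc \in s -> vc.1 != 0) /\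
    closure M `\` M `<=` [set x | exists2 vc, vc \in s & hyperplane vc.1 vc.2 x]].

Lemma boundary_planesP M : Th M ->
  (forall vc, vc \in boundary_planes M -> vc.1 != 0) /\
  closure M `\` M `<=` [set x | exists2 vc, vc \in boundary_planes M & hyperplane vc.1 vc.2 x].
Proof.
move=> /(mesh_cell mesh)[_ _ [s s0 Ms]].
by apply: (@xgetPex _ [::] [set s : seq ('rV[R]_d * R) | (forall vc, vc \in s -> vc.1 != 0) /\
  closure M `\` M `<=` [set x | exists2 vc, vc \in s & hyperplane vc.1 vc.2 x]]); exists s.
Qed.

Variables (K : set 'rV[R]_d) (e : 'rV[R]_d) (r : R).
Hypothesis TK : Th K.

Definition offset L : R := xget 0 [set c | interface K L `<=` hyperplane (nrm K L) c].

Lemma offsetP L : neighbours Th K L -> interface K L `<=` hyperplane (nrm K L) (offset L).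
Proof.
move=> KL; have [_ [c Hc] _] := mesh_normal mesh TK KL.
by apply: (@xgetPex _ 0 [set c | interface K L `<=` hyperplane (nrm K L) c]); exists c.
Qed.

Lemma enorm_nrm L : neighbours Th K L -> enorm (nrm K L) = 1.
Proof. by move=> /(mesh_normal mesh TK)[]. Qed.

Lemma nrm_neq0 L : neighbours Th K L -> nrm K L != 0.
Proof. by move=> KL; rewrite -enorm_gt0 enorm_nrm. Qed.

(** They carry the boundaries of the cells that meet the ball of radius [r], so
    off them a point of the ball is inside some cell; they also carry the
    interfaces of [K]. *)
Definition planes : seq ('rV[R]_d * R) :=
  flatten [seq boundary_planes M | M <- elements (cells_near Th r)] ++
  [seq (nrm K L, offset L) | L <- elements (neighbours Th K)].

Lemma mem_near M : (M \in elements (cells_near Th r)) <-> cells_near Th r M.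
Proof.
exact: mem_elements (finite_cells_near h0 a0 mesh r).
Qed.

Lemma mem_neighbours L : (L \in elements (neighbours Th K)) <-> neighbours Th K L.
Proof.
exact: mem_elements (finite_neighbours h0 a0 mesh TK).
Qed.

Lemma boundary_in_planes M vc : cells_near Th r M -> vc \in boundary_planes M -> vc \in planes.
Proof.
move=> Mr vcM; rewrite mem_cat; apply/orP; left; apply/flattenP.
by exists (boundary_planes M) => //; apply/mapP; exists M => //; apply/mem_near.
Qed.

Lemma offset_in_planes L : neighbours Th K L -> (nrm K L, offset L) \in planes.
Proof.
by move=> KL; rewrite mem_cat; apply/orP; right; apply/mapP; exists L => //; apply/mem_neighbours.
Qed.

Lemma planes_neq0 vc : vc \in planes -> vc.1 != 0.
Proof.
rewrite mem_cat => /orP[/flattenP[s /mapP[M /mem_near[TM _] ->]]|].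
  exact: (boundary_planesP TM).1.
by move=> /mapP[L /mem_neighbours KL ->]; exact: nrm_neq0.
Qed.

Lemma covered y : enorm y <= r ->
  (forall vc, vc \in planes -> ~ hyperplane vc.1 vc.2 y) -> exists2 M, Th M & M y.
Proof.
move=> yr Hy; have : (\bigcup_(M in Th) closure M) y by rewrite (mesh_cover mesh).
move=> [M TM cMy]; exists M => //; apply: contrapT => nMy.
have [vc vcM Hvc] := (boundary_planesP TM).2 y (conj cMy nMy).
by apply: (Hy vc) => //; apply: boundary_in_planes vcM; split => //; exists y.
Qed.

(** Half balls are convex. *)
Lemma half_ball v c y rho :
  (forall z, enorm (z - y) < rho -> dotp v z < c -> exists2 M, Th M & M z) ->
  forall M z w, Th M -> enorm (z - y) < rho -> enorm (w - y) < rho ->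
    dotp v z < c -> dotp v w < c -> M z -> M w.
Proof.
move=> cover M z w TM zy wy vz vw; apply: segment_cell => // t /andP[t0 t1].
apply: cover.
  have -> : z + t *: (w - z) - y = (1 - t) *: (z - y) + t *: (w - y).
    by apply/rowP => i; rewrite !mxE; ring.
  apply: le_lt_trans (ler_enormD _ _) _; rewrite !enormZ !ger0_norm ?subr_ge0//.
  have : (1 - t) * enorm (z - y) <= (1 - t) * Num.max (enorm (z - y)) (enorm (w - y)).
    by rewrite ler_wpM2l ?subr_ge0// le_max lexx.
  have : t * enorm (w - y) <= t * Num.max (enorm (z - y)) (enorm (w - y)).
    by rewrite ler_wpM2l// le_max lexx orbT.
  have : Num.max (enorm (z - y)) (enorm (w - y)) < rho by rewrite gt_max zy.
  by lra.
rewrite dotpDr dotpZr dotpBr.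
have : (1 - t) * dotp v z <= (1 - t) * Num.max (dotp v z) (dotp v w).
  by rewrite ler_wpM2l ?subr_ge0// le_max lexx.
have : t * dotp v w <= t * Num.max (dotp v z) (dotp v w).
  by rewrite ler_wpM2l// le_max lexx orbT.
have : Num.max (dotp v z) (dotp v w) < c by rewrite gt_max vz.
by lra.
Qed.

(** As no other hyperplane passes near [y], each half of a small ball around
    [y] lies in a single cell. Both [K] and [L] accumulate at [y], so they are
    these two cells. *)
Lemma two_sides L y : neighbours Th K L -> interface K L y -> enorm y < r ->
  (forall vc, vc \in planes -> hyperplane vc.1 vc.2 y ->
     hyperplane (nrm K L) (offset L) `<=` hyperplane vc.1 vc.2) ->
  sides K L (nrm K L) (offset L) y \/ sides L K (nrm K L) (offset L) y.
Proof.
move=> KL yS yr nice; set n := nrm K L in nice *; set c := offset L in nice *.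
have [TL LK _] := KL; have [cKy cLy] := yS.
have n1 : dotp n n = 1 by rewrite -sqr_enorm enorm_nrm// expr1n.
have Hy : dotp n y = c by exact: (offsetP KL yS).
have [rho' rho'0 off] := off_planes planes y.
pose rho := Num.min rho' (r - enorm y).
have rho0 : 0 < rho by rewrite lt_min rho'0 subr_gt0.
have cover z : enorm (z - y) < rho -> dotp n z != c -> exists2 M, Th M & M z.
  rewrite lt_min => /andP[zy1 zy2] nz; apply: covered.
    by apply: ltW; have := ler_enormB z y; lra.
  move=> vc vcp; have [Hvc|Hvc] := pselect (hyperplane vc.1 vc.2 y); last exact: off Hvc _ zy1.
  move=> Hz; move/eqP: nz; apply.
  exact: (hyperplane_sub (nrm_neq0 KL) (planes_neq0 vcp) (nice _ vcp Hvc)).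
have coverm z : enorm (z - y) < rho -> dotp n z < c -> exists2 M, Th M & M z.
  by move=> zy zc; apply: cover => //; rewrite lt_eqF.
have coverp z : enorm (z - y) < rho -> dotp (- n) z < - c -> exists2 M, Th M & M z.
  by move=> zy; rewrite dotpNl ltrN2 => zc; apply: cover => //; rewrite gt_eqF.
have halfm := half_ball coverm; have halfp := half_ball coverp.
have ball_half k : `|k| = rho / 2 -> enorm (y + k *: n - y) < rho.
  by move=> kr; rewrite addrC addKr enormZ kr enorm_nrm// mulr1; lra.
have r2 : `|rho / 2| = rho / 2 by rewrite ger0_norm// ltW// divr_gt0.
have bp : enorm (y + (rho / 2) *: n - y) < rho by exact: ball_half.
have bm : enorm (y + (- (rho / 2)) *: n - y) < rho by apply: ball_half; rewrite normrN.
have dp k : dotp n (y + k *: n) = c + k by rewrite dotpDr dotpZr n1 mulr1 Hy.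
have [M TM Mm] : exists2 M, Th M & M (y + (- (rho / 2)) *: n).
  by apply: coverm => //; rewrite dp; lra.
have [N TN Np] : exists2 N, Th N & N (y + (rho / 2) *: n).
  by apply: coverp => //; rewrite dotpNl dp; lra.
have sidesMN A B : A = M -> B = N -> sides A B n c y.
  move=> -> ->; exists rho => // z zy; split => nz.
    by apply: halfm Mm => //; rewrite dp; lra.
  by apply: halfp Np => //; rewrite dotpNl ?dp; lra.
have MN A : Th A -> closure A y -> A = M \/ A = N.
  move=> TA /closure_enormP cA; have [w Aw wy] := cA _ rho0.
  have [s s0 sA] := proj1 (open_enormP _) (cell_open mesh TA) w Aw.
  pose k := Num.min (s / 2) ((rho - enorm (w - y)) / 2).
  have k0 : 0 < k by rewrite lt_min !divr_gt0 ?subr_gt0.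
  have ks : k < s by rewrite gt_min; apply/orP; left; lra.
  have kw : k < rho - enorm (w - y).
    by rewrite gt_min; apply/orP; right; move: wy; lra.
  have [z [Az zy nz]] : exists z, [/\ A z, enorm (z - y) < rho & dotp n z != c].
    have [nw|nw] := eqVneq (dotp n w) c; last by exists w.
    exists (w + k *: n); split.
    - by apply: sA; rewrite addrC addKr enormZ enorm_nrm// mulr1 gtr0_norm.
    - rewrite addrAC; apply: le_lt_trans (ler_enormD _ _) _.
      by rewrite enormZ enorm_nrm// mulr1 gtr0_norm//; move: kw; lra.
    - by rewrite dotpDr dotpZr nw n1 mulr1; apply/eqP; lra.
  have [zc|zc|zc] := ltgtP (dotp n z) c.
  - left; apply: (cell_eq mesh TA TM Az).
    by apply: (halfm _ _ z TM bm) Mm => //; rewrite dp; lra.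
  - right; apply: (cell_eq mesh TA TN Az).
    by apply: (halfp _ _ z TN bp) Np => //; rewrite dotpNl ?dp; lra.
  - by rewrite zc eqxx in nz.
have [KM|KN] := MN K TK cKy; have [LM|LN] := MN L TL cLy.
- by case: LK; rewrite KM.
- by left; apply: sidesMN.
- by right; apply: sidesMN.
- by case: LK; rewrite KN.
Qed.

(** At such points the normal points the wrong way, which is possible on a set
    of zero area only. They are a countable union of closed sets, namely those
    where the ball has radius at least [1 / k]. *)
Lemma wrong_sides_null L : neighbours Th K L ->
  null (shadow e [set y | interface K L y /\ sides L K (nrm K L) (offset L) y]).
Proof.
move=> KL; set n := nrm K L; set c := offset L; have [TL LK _] := KL.
have [n1 _ area0] := mesh_normal mesh TK KL.
pose W k := interface K L `&` [set y | forall z, enorm (z - y) < k.+1%:R^-1 ->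
  (dotp n z < c -> L z) /\ (c < dotp n z -> K z)].
apply: (@nullS _ _ _ (\bigcup_k shadow e (W k))).
  move=> x [s [Sy [rho rho0 rhoy]]].
  exists (Num.truncn rho^-1) => //; exists s; split => // z zy; apply: rhoy.
  apply: lt_trans zy _; rewrite invf_plt ?posrE//; exact: truncnS_gt.
apply: null_bigcup => k; apply: (@shadow_null R d (nrm K L) (offset L) e (W k) _ (nrm_neq0 KL) area0).
- move=> y [Sy yk]; split; last exact: (offsetP KL Sy).
  split => // near0.
  have k0 : 0 < k.+1%:R^-1 :> R by rewrite invr_gt0.
  have [t [[/= Kt Lt] t0 tk]] : exists t, [/\ K (y - t *: n) /\ L (y + t *: n), 0 < t & t < k.+1%:R^-1].
    near (0:R)^'+ => t; exists t; split.
    - by near: t.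
    - by near: t; exact: nbhs_right_gt.
    - by near: t; exact: nbhs_right_lt.
  have zy : enorm (y - t *: n - y) < k.+1%:R^-1.
    by rewrite addrC addKr enormN enormZ n1 mulr1 gtr0_norm.
  have [Lt' _] := yk _ zy; apply: LK; apply: (cell_eq mesh TL TK _ Kt); apply: Lt'.
  rewrite dotpBr dotpZr -sqr_enorm n1 expr1n mulr1.
  by rewrite (offsetP KL Sy : dotp n y = c) gtrBl.
- apply: closedI; first exact: interface_closed.
  apply/closed_enormP => y yW z zy.
  have k0 : 0 < k.+1%:R^-1 - enorm (z - y) by rewrite subr_gt0.
  have [w wW wy] := yW _ k0; apply: wW.
  apply: le_lt_trans (ler_enorm_distD y _ _) _.
  by rewrite (enormB y w) addrC -ltrBrDr.
- have /bounded_enormP[M SM] := interface_bounded h0 a0 mesh L TK.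
  by apply/bounded_enormP; exists M => y [/SM].
Unshelve. all: by end_near.
Qed.

End GeneralPosition.

Section GoodLines.
Context {R : realType} {d : nat}.
Variables (Th : set (set 'rV[R]_d)) (nrm : set 'rV[R]_d -> set 'rV[R]_d -> 'rV[R]_d).
Variables (h a : R).
Hypotheses (h0 : 0 < h) (a0 : 0 < a) (mesh : admissible_mesh Th nrm h a).
Implicit Types (L M : set 'rV[R]_d) (x y z v : 'rV[R]_d).
Variables (K : set 'rV[R]_d) (e : 'rV[R]_d) (r : R).
Hypothesis TK : Th K.
Hypothesis Kr : forall y, closure K y -> enorm y < r.

Local Notation planes := (planes Th nrm K r).
Local Notation offset := (offset nrm K).

(** What makes the indicator of [K] computable along the segment from [x] to
    [x + e]: its ends are off the planes, it crosses each plane at most once,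
    and it meets the boundary of [K] only at points of interfaces with
    neighbours, where the two sides are known. *)
Definition good_line x : Prop :=
  [/\ forall vc, vc \in planes -> ~ hyperplane vc.1 vc.2 x /\ ~ hyperplane vc.1 vc.2 (x + e),
      forall vc, vc \in planes -> dotp vc.1 e = 0 -> ~ shadow e (hyperplane vc.1 vc.2) x,
      forall L, cells_near Th r L -> L <> K -> ~ neighbours Th K L ->
        ~ shadow e (interface K L) x &
      forall L, neighbours Th K L -> forall s, interface K L (x + s *: e) ->
        sides K L (nrm K L) (offset L) (x + s *: e)].

Lemma interface_boundary L : Th L -> L <> K -> interface K L `<=` closure K `\` K.
Proof.
move=> TL LK y [cKy cLy]; split => // Ky; apply: LK.
by rewrite (cell_closure_eq mesh TK TL Ky cLy).
Qed.

Lemma not_neighbour_null L : Th L -> L <> K -> ~ neighbours Th K L ->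
  null (shadow e (interface K L)).
Proof.
move=> TL LK nKL; have [vc0 Kb] := boundary_planesP mesh TK.
apply: (@nullS _ _ _ [set x | exists2 vc, vc \in boundary_planes K &
    shadow e (interface K L `&` hyperplane vc.1 vc.2) x]).
  move=> x [s Sx]; have [vc vcK Hvc] := Kb _ (interface_boundary TL LK Sx).
  by exists vc => //; exists s.
apply: null_seq => -[v c] vcK; have v0 := vc0 _ vcK.
have area0 : area (interface K L) = 0%E.
  have [A0|Aoo] := area_ge0 (interface K L).
    by apply/eqP; rewrite eq_le A0 andbT leNgt; apply/negP => A1; apply: nKL.
  suff : (0 <= area (interface K L))%E by rewrite Aoo.
  apply: le_trans (ereal_sup_ubound _).
    2: by exists ((enorm v)^-1 *: v, 0) => //=; rewrite enormZ ger0_norm ?invr_ge0 ?enorm_ge0// mulVf// lt0r_neq0// enorm_gt0.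
  exact: volume_ge0.
apply: (@shadow_null R d v c e _ _ v0 area0) => //.
  by apply: closedI; [exact: interface_closed|exact: hyperplane_closed].
have /bounded_enormP[M SM] := interface_bounded h0 a0 mesh L TK.
by apply/bounded_enormP; exists M => y [/SM].
Qed.

Lemma wrong_interface_null L : neighbours Th K L ->
  null (shadow e [set y | interface K L y /\ ~ sides K L (nrm K L) (offset L) y]).
Proof.
move=> KL; pose P := hyperplane (nrm K L) (offset L).
apply: (@nullS _ _ _
  ([set x | exists2 vc, vc \in planes & ([set x | ~ (P `<=` hyperplane vc.1 vc.2)] `&`
      shadow e (P `&` hyperplane vc.1 vc.2)) x] `|`
   shadow e [set y | interface K L y /\ sides L K (nrm K L) (offset L) y])).
  move=> x [s [Sy nsides]].
  have [[vc [vcp [nP Hvc]]]|nice] := pselect (exists vc, vc \in planes /\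
      ~ (P `<=` hyperplane vc.1 vc.2) /\ hyperplane vc.1 vc.2 (x + s *: e)).
    left; exists vc => //; split => //; exists s; split => //.
    exact: (offsetP mesh TK KL Sy).
  right; exists s; split => //.
  have [] // := @two_sides _ _ _ _ _ _ h0 a0 mesh K r TK L (x + s *: e) KL Sy _ _.
    by apply: Kr; have [] := Sy.
  move=> vc vcp Hvc; apply: contrapT => nP; apply: nice; by exists vc.
apply: nullU; last exact: (wrong_sides_null h0 a0 mesh e TK KL).
apply: null_seq => vc vcp; have [PH|PH] := pselect (P `<=` hyperplane vc.1 vc.2).
  by apply: nullS (@null0 _ _) => x [].
apply: nullS (shadow_hyperplane2_null e _ _ PH) => [x []//||].
- exact: (nrm_neq0 mesh TK KL).
- exact: (planes_neq0 h0 a0 mesh TK vcp).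
Qed.

(** What fails is contained in finitely many hyperplanes and shadows, of
    hyperplanes parallel to [e], of sets of codimension two, and of negligible
    parts of interfaces. *)
Lemma good_line_null : null [set x | ~ good_line x].
Proof.
apply: (@nullS _ _ _
  (([set x | exists2 vc, vc \in planes &
      (hyperplane vc.1 vc.2 `|` [set x | hyperplane vc.1 vc.2 (x + e)]) x] `|`
   [set x | exists2 vc, vc \in planes & ([set x | dotp vc.1 e = 0] `&`
      shadow e (hyperplane vc.1 vc.2)) x]) `|`
   ([set x | exists2 L, L \in elements (cells_near Th r) &
      ([set x | L <> K /\ ~ neighbours Th K L] `&` shadow e (interface K L)) x] `|`
   [set x | exists2 L, L \in elements (neighbours Th K) &
      shadow e [set y | interface K L y /\ ~ sides K L (nrm K L) (offset L) y] x]))).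
  move=> x /= ngood; apply: contrapT => nx; apply: ngood; split.
  - move=> vc vcp; split => Hvc; apply: nx; left; left; exists vc => //; by [left|right].
  - by move=> vc vcp ve Hvc; apply: nx; left; right; exists vc.
  - move=> L Lr LK nKL xL; apply: nx; right; left; exists L => //.
    exact/(mem_near h0 a0 mesh).
  - move=> L KL s Sx; apply: contrapT => nsides; apply: nx; right; right; exists L.
      exact/(mem_neighbours h0 a0 mesh TK).
    by exists s.
apply: nullU; apply: nullU; apply: null_seq.
- move=> vc vcp; have v0 := planes_neq0 h0 a0 mesh TK vcp; have H0 := hyperplane_null vc.2 v0.
  by apply: nullU => //; exact: null_translate.
- move=> vc vcp; have v0 := planes_neq0 h0 a0 mesh TK vcp.
  have [ve|ve] := eqVneq (dotp vc.1 e) 0; last first.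
    by apply: nullS (@null0 _ _) => x [/= /eqP]; rewrite (negPf ve).
  by apply: nullS (shadow_hyperplane_null vc.2 v0 ve) => x [].
- move=> L Ln; have [[LK nKL]|nL] := pselect (L <> K /\ ~ neighbours Th K L); last first.
    by apply: nullS (@null0 _ _) => x [].
  have [TL _] := proj1 (mem_near h0 a0 mesh _ L) Ln.
  by apply: nullS (not_neighbour_null TL LK nKL) => x [].
- by move=> L Ln; apply: wrong_interface_null; exact/(mem_neighbours h0 a0 mesh TK).
Qed.

Section OneLine.
Variable x : 'rV[R]_d.
Hypothesis x_good : good_line x.
Hypothesis x_near : enorm x + 3 * enorm e <= r.

Local Notation y s := (x + s *: e).

Definition off s : Prop := forall vc, vc \in planes -> ~ hyperplane vc.1 vc.2 (y s).

Lemma y_near s : -1 <= s <= 2 -> enorm (y s) <= r.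
Proof.
move=> /andP[s1 s2]; apply: le_trans (ler_enormD _ _) _; rewrite enormZ.
apply: le_trans x_near; rewrite lerD2l ler_wpM2r ?enorm_ge0//.
by rewrite ler_norml; apply/andP; split; lra.
Qed.

Lemma off_near s : exists2 rho, 0 < rho &
  forall t, 0 < `|t| -> `|t| < rho -> off (s + t).
Proof.
have [_ par _ _] := x_good; rewrite /off.
elim: (planes) par => [|vc l IH] par; first by exists 1.
have [|rho rho0 lrho] := IH.
  by move=> vc' vc'l; apply: par; rewrite inE vc'l orbT.
suff [rho' rho'0 vcrho] : exists2 rho', 0 < rho' &
    forall t, 0 < `|t| -> `|t| < rho' -> ~ hyperplane vc.1 vc.2 (y (s + t)).
  exists (Num.min rho rho'); first by rewrite lt_min rho0.
  move=> t t0; rewrite lt_min => /andP[t1 t2] vc'; rewrite inE => /predU1P[->|].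
    exact: vcrho.
  exact: lrho.
have [Hs|Hs] := pselect (hyperplane vc.1 vc.2 (y s)).
  exists 1 => // t t0 _; rewrite hyperplane_dotp scalerDl addrA dotpDr Hs dotpZr.
  move/eqP; rewrite -subr_eq0 addrAC subrr add0r mulf_eq0 => /orP[/eqP t00|/eqP ve].
    by rewrite t00 normr0 ltxx in t0.
  by apply: (par vc (mem_head _ _) ve); exists s.
have oH : open (~` hyperplane vc.1 vc.2) by rewrite openC; exact: hyperplane_closed.
have [rho' rho'0 Hrho'] := open_line oH Hs.
by exists rho' => // t _ t1; apply: Hrho'; rewrite addrAC subrr add0r.
Qed.

Lemma off_cell s : -1 <= s <= 2 -> off s -> exists2 M, Th M & M (y s).
Proof. by move=> s12 offs; apply: (@covered _ _ _ _ _ _ h0 a0 mesh K r) => //; exact: y_near. Qed.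

Lemma same_cell M s1 s2 : -1 <= s1 <= 2 -> -1 <= s2 <= 2 ->
  (forall t, 0 <= t <= 1 -> off (s1 + t * (s2 - s1))) ->
  Th M -> M (y s1) -> M (y s2).
Proof.
move=> /andP[s11 s12] /andP[s21 s22] offt TM; apply: (segment_cell mesh) => // t t01.
have -> : y s1 + t *: (y s2 - y s1) = y (s1 + t * (s2 - s1)).
  by apply/rowP => i; rewrite !mxE; ring.
apply: off_cell (offt t t01); move: t01 => /andP[t0 t1].
have : t * (s2 - s1) = t * s2 - t * s1 by ring.
have : 0 <= t * (s2 + 1) by rewrite mulr_ge0//; lra.
have : 0 <= (1 - t) * (s1 + 1) by rewrite mulr_ge0//; lra.
have : 0 <= t * (2 - s2) by rewrite mulr_ge0//; lra.
have : 0 <= (1 - t) * (2 - s1) by rewrite mulr_ge0//; lra.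
by rewrite !mulrBl !mulrBr !mulrDr; lra.
Qed.

(** The planes are met at isolated points, and between these the line cannot
    change cells. *)
Lemma side_cells s : 0 <= s <= 1 -> exists rho M N, [/\ 0 < rho, Th M /\ Th N &
  forall t, 0 < t -> t < rho ->
    [/\ off (s - t), off (s + t), M (y (s - t)) & N (y (s + t))]].
Proof.
move=> /andP[s0 s1]; have [rho0 rho00 offrho] := off_near s.
pose rho := Num.min rho0 1; have rho_gt0 : 0 < rho by rewrite lt_min rho00 ltr01.
have offp t : 0 < t -> t < rho -> off (s + t).
  move=> t0; rewrite lt_min => /andP[t1 _]; apply: offrho; rewrite gtr0_norm//.
have offm t : 0 < t -> t < rho -> off (s - t).
  move=> t0; rewrite lt_min => /andP[t1 _]; apply: offrho; rewrite normrN gtr0_norm//.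
have rho1 : rho <= 1 by rewrite ge_min lexx orbT.
have r2 : 0 < rho / 2 by lra.
have r2r : rho / 2 < rho by lra.
have [M TM Mm] : exists2 M, Th M & M (y (s - rho / 2)).
  by apply: off_cell; [lra|exact: offm].
have [N TN Np] : exists2 N, Th N & N (y (s + rho / 2)).
  by apply: off_cell; [lra|exact: offp].
exists rho, M, N; split => // t t0 t1.
have between k : 0 <= k <= 1 -> 0 < rho / 2 + k * (t - rho / 2) /\ rho / 2 + k * (t - rho / 2) < rho.
  move=> /andP[k0 k1].
  have -> : rho / 2 + k * (t - rho / 2) = (1 - k) * (rho / 2) + k * t by ring.
  split.
    have : (1 - k) * Num.min (rho / 2) t <= (1 - k) * (rho / 2).
      by rewrite ler_wpM2l ?subr_ge0// ge_min lexx.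
    have : k * Num.min (rho / 2) t <= k * t by rewrite ler_wpM2l// ge_min lexx orbT.
    have : 0 < Num.min (rho / 2) t by rewrite lt_min r2.
    by rewrite mulrBl mul1r; lra.
  have : (1 - k) * (rho / 2) <= (1 - k) * Num.max (rho / 2) t.
    by rewrite ler_wpM2l ?subr_ge0// le_max lexx.
  have : k * t <= k * Num.max (rho / 2) t by rewrite ler_wpM2l// le_max lexx orbT.
  have : Num.max (rho / 2) t < rho by rewrite gt_max r2r.
  by rewrite mulrBl mul1r; lra.
split; [exact: offm|exact: offp| |].
  apply: (@same_cell M (s - rho / 2) (s - t)) => //; try lra.
  move=> k /between[b1 b2]; have -> : s - rho / 2 + k * (s - t - (s - rho / 2)) =
    s - (rho / 2 + k * (t - rho / 2)) by ring.
  exact: offm.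
apply: (@same_cell N (s + rho / 2) (s + t)) => //; try lra.
move=> k /between[b1 b2]; have -> : s + rho / 2 + k * (s + t - (s + rho / 2)) =
  s + (rho / 2 + k * (t - rho / 2)) by ring.
exact: offp.
Qed.

End OneLine.
End GoodLines.

Section Jumps.
Context {R : realType} {d : nat}.
Variables (Th : set (set 'rV[R]_d)) (nrm : set 'rV[R]_d -> set 'rV[R]_d -> 'rV[R]_d).
Variables (h a : R).
Hypotheses (h0 : 0 < h) (a0 : 0 < a) (mesh : admissible_mesh Th nrm h a).
Implicit Types (L M : set 'rV[R]_d) (z v : 'rV[R]_d).
Variables (K : set 'rV[R]_d) (e : 'rV[R]_d) (r : R).
Hypothesis TK : Th K.
Variable x : 'rV[R]_d.
Hypothesis x_good : good_line Th nrm K e r x.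
Hypothesis x_near : enorm x + 3 * enorm e <= r.

Local Notation y s := (x + s *: e).
Local Notation off := (off Th nrm K e r x).
Local Notation nb := (elements (neighbours Th K)).
Local Notation slope L := (dotp (nrm K L) e).

Lemma indic_cell M z : Th M -> M z -> \1_K z = `[< M = K >]%:R :> R.
Proof.
move=> TM Mz; rewrite indicE; case: asboolP => [<-|MK]; first by rewrite mem_set.
by rewrite memNset// => Kz; apply: MK; exact: (cell_eq mesh TM TK Mz Kz).
Qed.

Lemma slope_neq0 L s : neighbours Th K L -> interface K L (y s) -> slope L != 0.
Proof.
move=> KL Sy; apply/eqP => ve; have [_ par _ _] := x_good.
apply: (par _ (offset_in_planes h0 a0 mesh r TK KL) ve).
by exists s; exact: (offsetP mesh TK KL Sy).
Qed.

Lemma off_interface L s : neighbours Th K L -> off s -> ~ interface K L (y s).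
Proof.
move=> KL offs Sy; apply: (offs _ (offset_in_planes h0 a0 mesh r TK KL)).
exact: (offsetP mesh TK KL Sy).
Qed.

Lemma interface_once L s s' : neighbours Th K L -> interface K L (y s) ->
  interface K L (y s') -> s = s'.
Proof.
move=> KL Sy Sy'; have := slope_neq0 KL Sy.
have := offsetP mesh TK KL Sy; rewrite -(offsetP mesh TK KL Sy' : dotp _ _ = _).
rewrite hyperplane_dotp !dotpDr !dotpZr => /addrI eqs ve; exact: mulIf ve _ _ eqs.
Qed.

(** Exactly one cell lies just before the point and one just after it. If they
    differ and one of them is [K], the other one is a neighbour, on the side
    given by the sign of [n_KL . e]. *)
Lemma jump s : 0 <= s <= 1 -> exists2 rho, 0 < rho & exists i : R,
  forall t, 0 < t -> t < rho ->
    [/\ off (s - t), off (s + t), \1_K (y (s - t)) = i &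
        \1_K (y (s + t)) = i - \sum_(L <- nb) Num.sg (slope L) * \1_(interface K L) (y s)].
Proof.
move=> s01; have [rho [M [N [rho0 [TM TN] MN]]]] := side_cells h0 a0 mesh x_good x_near s01.
have [good1 good2 good3 good4] := x_good.
have orient L : neighbours Th K L -> interface K L (y s) ->
    (0 < slope L /\ M = K /\ N = L) \/ (slope L < 0 /\ M = L /\ N = K).
  move=> KL Sy; have [TL LK _] := KL; have [q q0 qs] := good4 L KL s Sy.
  have ve := slope_neq0 KL Sy.
  have e1 : 0 < enorm e + 1 by rewrite ltr_wpDl ?enorm_ge0.
  pose t := Num.min (rho / 2) (q / (enorm e + 1) / 2).
  have t0 : 0 < t by rewrite lt_min !divr_gt0.
  have tr : t < rho by rewrite gt_min; apply/orP; left; lra.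
  have tq : t * enorm e < q.
    have t1 : t <= q / (enorm e + 1) / 2 by rewrite ge_min lexx orbT.
    have t2 : t < q / (enorm e + 1).
      by apply: le_lt_trans t1 _; have : 0 < q / (enorm e + 1) by [exact: divr_gt0]; lra.
    move: t2; rewrite ltr_pdivlMr// mulrDr mulr1; lra.
  have [_ _ Mt Nt] := MN t t0 tr.
  have Hy : dotp (nrm K L) (y s) = offset nrm K L by exact: (offsetP mesh TK KL Sy).
  have sidesm : enorm (y (s - t) - y s) < q.
    by rewrite (_ : _ - _ = - t *: e) ?enormZ ?normrN ?gtr0_norm//; apply/rowP => i; rewrite !mxE; ring.
  have sidesp : enorm (y (s + t) - y s) < q.
    by rewrite (_ : _ - _ = t *: e) ?enormZ ?gtr0_norm//; apply/rowP => i; rewrite !mxE; ring.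
  have dm : dotp (nrm K L) (y (s - t)) = offset nrm K L - t * slope L.
    by rewrite -Hy !dotpDr !dotpZr; ring.
  have dp : dotp (nrm K L) (y (s + t)) = offset nrm K L + t * slope L.
    by rewrite -Hy !dotpDr !dotpZr; ring.
  have [m1 m2] := qs _ sidesm; have [p1 p2] := qs _ sidesp.
  rewrite dm in m1 m2; rewrite dp in p1 p2.
  have [ve0|ve0|ve0] := ltgtP (slope L) 0; last by rewrite ve0 eqxx in ve.
    have tve : t * slope L < 0 by rewrite pmulr_rlt0.
    right; split => //; split; first by apply: (cell_eq mesh TM TL Mt); apply: m2; lra.
    by apply: (cell_eq mesh TN TK Nt); apply: p1; lra.
  have tve : 0 < t * slope L by rewrite pmulr_rgt0.
  left; split => //; split; first by apply: (cell_eq mesh TM TK Mt); apply: m1; lra.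
  by apply: (cell_eq mesh TN TL Nt); apply: p2; lra.
have clos A b : `|b| = 1 -> (forall t, 0 < t -> t < rho -> A (y (s + b * t))) -> closure A (y s).
  move=> b1 At; apply/closure_enormP => q q0.
  have e1 : 0 < enorm e + 1 by rewrite ltr_wpDl ?enorm_ge0.
  pose t := Num.min (rho / 2) (q / (enorm e + 1) / 2).
  have t0 : 0 < t by rewrite lt_min !divr_gt0.
  exists (y (s + b * t)); first by apply: At => //; rewrite gt_min; apply/orP; left; lra.
  rewrite (_ : _ - _ = (b * t) *: e); last by apply/rowP => i; rewrite !mxE; ring.
  rewrite enormZ normrM b1 mul1r gtr0_norm//.
  have t1 : t <= q / (enorm e + 1) / 2 by rewrite ge_min lexx orbT.
  have t2 : t < q / (enorm e + 1).
    by apply: le_lt_trans t1 _; have : 0 < q / (enorm e + 1) by [exact: divr_gt0]; lra.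
  by move: t2; rewrite ltr_pdivlMr// mulrDr mulr1; lra.
have cM : closure M (y s).
  by apply: (clos M (-1)) => [|t t0 t1]; rewrite ?normrN1// mulN1r; have [] := MN t t0 t1.
have cN : closure N (y s).
  by apply: (clos N 1) => [|t t0 t1]; rewrite ?normr1// mul1r; have [] := MN t t0 t1.
have ys : enorm (y s) <= r.
  by move: s01 => /andP[s0 s1]; apply: (y_near x_near); apply/andP; split; lra.
have nbP L : L <> K -> closure K (y s) -> Th L -> closure L (y s) -> neighbours Th K L.
  move=> LK cK TL cL; apply: contrapT => nKL; apply: (good3 L _ LK nKL).
    by split => //; exists (y s).
  by exists s.
have nb_mem L : (L \in nb) <-> neighbours Th K L by exact: (mem_neighbours h0 a0 mesh TK).
pose S := \sum_(L <- nb) Num.sg (slope L) * \1_(interface K L) (y s) : R.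
have S0 : (forall L, neighbours Th K L -> ~ interface K L (y s)) -> S = 0.
  move=> nS; rewrite /S big1_seq// => L /andP[_ /nb_mem KL].
  by rewrite indicE memNset ?mulr0//; exact: nS.
have S1 L0 : neighbours Th K L0 -> interface K L0 (y s) ->
    (forall L, neighbours Th K L -> interface K L (y s) -> L = L0) -> S = Num.sg (slope L0).
  move=> KL0 S0' only; rewrite /S (bigD1_seq L0)//=; last 2 first.
  - exact/nb_mem.
  - exact: elements_uniq.
  rewrite indicE mem_set// mulr1 big_seq_cond big1 ?addr0//.
  move=> L /andP[/nb_mem KL LL0]; rewrite indicE memNset ?mulr0// => SL.
  by move/eqP: LL0; apply; exact: only.
exists rho => //; exists (`[< M = K >]%:R) => t t0 t1.
have [offm offp Mt Nt] := MN t t0 t1; split => //; first exact: indic_cell.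
rewrite (indic_cell TN Nt) -/S.
have [MK|MK] := pselect (M = K); have [NK|NK] := pselect (N = K).
- rewrite S0 ?subr0 ?(asboolT MK) ?(asboolT NK)// => L KL Sy; have [_ LK _] := KL.
  have [[_ [_ NL]]|[_ [ML _]]] := orient L KL Sy; first by apply: LK; rewrite -NL.
  by apply: LK; rewrite -ML.
- have KN : neighbours Th K N by apply: nbP => //; rewrite -MK.
  have SN : interface K N (y s) by split => //; rewrite -MK.
  rewrite (S1 N) // => [|L KL Sy]; last first.
    by have [[_ [_ ->]]//|[_ [_ NK']]] := orient L KL Sy.
  have [[ve _]|[_ [_ NK']]//] := orient N KN SN.
  by rewrite gtr0_sg// (asboolF NK) (asboolT MK) subrr.
- have KM : neighbours Th K M by apply: nbP => //; rewrite -NK.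
  have SM : interface K M (y s) by split => //; rewrite -NK.
  rewrite (S1 M) // => [|L KL Sy]; last first.
    by have [[_ [MK' _]]//|[_ [-> _]]] := orient L KL Sy.
  have [[_ [MK' _]]//|[ve _]] := orient M KM SM.
  by rewrite ltr0_sg// (asboolF MK) (asboolT NK) opprK add0r.
- rewrite S0 ?subr0 ?(asboolF MK) ?(asboolF NK)// => L KL Sy.
  by have [[_ [MK' _]]|[_ [_ NK']]] := orient L KL Sy.
Qed.

(** The indicator of [K], corrected by the interfaces already crossed. It is
    locally constant along the line, hence constant. *)
Definition crossed L s : R := `[< exists2 t, 0 <= t <= s & interface K L (y t) >]%:R.

Definition balance s : R := \1_K (y s) + \sum_(L <- nb) Num.sg (slope L) * crossed L s.

Lemma balance_near s : 0 <= s <= 1 -> exists2 rho, 0 < rho & exists k,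
  forall t, `|t| < rho -> 0 <= s + t <= 1 -> (t != 0 \/ off s) -> balance (s + t) = k.
Proof.
move=> s01; have [rho rho0 [i rhoP]] := jump s01.
have nb_mem L : (L \in nb) <-> neighbours Th K L by exact: (mem_neighbours h0 a0 mesh TK).
pose before L : R := `[< exists2 t, 0 <= t < s & interface K L (y t) >]%:R.
exists rho => //; exists (i + \sum_(L <- nb) Num.sg (slope L) * before L) => t trho t01 toff.
have beforeE L t' : neighbours Th K L -> t' < s -> s - rho < t' -> crossed L t' = before L.
  move=> KL t's st'; congr (nat_of_bool _)%:R; apply: asbool_equiv_eq.
  split=> -[q /andP[q0 q1] Sq]; exists q => //; rewrite q0 /=; first exact: le_lt_trans t's.
  rewrite leNgt; apply/negP => t'q.
  have sq0 : 0 < s - q by lra.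
  have sqr : s - q < rho by lra.
  have [offq _ _ _] := rhoP _ sq0 sqr.
  by apply: (off_interface KL _ Sq); move: offq; rewrite opprB addrC subrK.
have [tneg|tpos|t0] := ltgtP t 0.
- have [_ _ K1 _] : [/\ off (s - - t), off (s + - t), \1_K (y (s - - t)) = i &
    \1_K (y (s + - t)) = i - \sum_(L <- nb) Num.sg (slope L) * \1_(interface K L) (y s)].
    by apply: rhoP; move: trho; rewrite ltr0_norm//; lra.
  rewrite /balance -{1}(opprK t) K1; congr (_ + _).
  apply: eq_big_seq => L /nb_mem KL; rewrite beforeE//; first lra.
  by move: trho; rewrite ltr0_norm//; lra.
- have trho' : t < rho by move: trho; rewrite gtr0_norm.
  have [_ _ _ K2] := rhoP t tpos trho'.
  rewrite /balance K2 -addrA; congr (_ + _).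
  rewrite -sumrN -big_split; apply: eq_big_seq => L /nb_mem KL /=.
  rewrite -mulrN -mulrDr; congr (_ * _); apply/eqP; rewrite addrC subr_eq; apply/eqP.
  have [Sy|Sy] := pselect (interface K L (y s)).
    rewrite indicE mem_set// /before asboolF ?add0r; last first.
      move=> [q /andP[_ qs] Sq]; have := interface_once KL Sy Sq; lra.
    by rewrite /crossed asboolT//; exists s => //; move: s01 => /andP[-> _] /=; lra.
  rewrite indicE memNset// addr0; congr (nat_of_bool _)%:R; apply: asbool_equiv_eq.
  split=> -[q /andP[q0 q1] Sq]; exists q => //; rewrite q0 /=; last by apply: le_trans (ltW q1) _; rewrite lerDl ltW.
  have [//|sq|qs] := ltgtP q s; last by rewrite -qs in Sy.
  have sq0 : 0 < q - s by lra.
  have sqr : q - s < rho by lra.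
  have [_ offq _ _] := rhoP _ sq0 sqr.
  by exfalso; apply: (off_interface KL _ Sq); move: offq; rewrite addrC subrK.
case: toff => [|offs]; first by rewrite t0 eqxx.
rewrite t0 addr0 /balance.
have [M TM Ms] : exists2 M, Th M & M (y s).
  apply: (off_cell h0 a0 mesh x_near _ offs); lra.
have [q q0 Mq] := open_line (cell_open mesh TM) Ms.
pose p := Num.min (rho / 2) (q / 2).
have p0 : 0 < p by rewrite lt_min !divr_gt0.
have pr : p < rho by rewrite gt_min; apply/orP; left; lra.
have pq : p < q by rewrite gt_min; apply/orP; right; lra.
have [_ _ K1 _] := rhoP p p0 pr.
have Mp : M (y (s - p)) by apply: Mq; rewrite addrAC subrr add0r normrN gtr0_norm.
rewrite (indic_cell TM Ms) -(indic_cell TM Mp) K1; congr (_ + _).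
apply: eq_big_seq => L /nb_mem KL; congr (_ * _).
congr (nat_of_bool _)%:R; apply: asbool_equiv_eq.
split=> -[u /andP[u0 u1] Su]; exists u => //; rewrite u0 /=; last exact: ltW.
have [//|su|us] := ltgtP u s; first lra.
by rewrite us in Su; have := off_interface KL offs Su.
Qed.

Lemma balance01 : balance 0 = balance 1.
Proof.
have [good1 _ _ _] := x_good.
have off0 : off 0 by move=> vc vcp; rewrite scale0r addr0; have [] := good1 vc vcp.
have off1 : off 1 by move=> vc vcp; rewrite scale1r; have [] := good1 vc vcp.
pose B s := exists2 rho, 0 < rho & forall t, 0 < `|t| -> `|t| < rho ->
  0 <= s + t <= 1 -> balance (s + t) = balance 0.
have pick s (rho : R) : 0 <= s <= 1 -> 0 < rho -> exists t, [/\ 0 < `|t|, `|t| < rho & 0 <= s + t <= 1].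
  move=> /andP[s0 s1] rho0; pose p := Num.min (rho / 2) (1 / 2).
  have p0 : 0 < p by rewrite lt_min !divr_gt0.
  have pr : p < rho by rewrite gt_min; apply/orP; left; lra.
  have p1 : p <= 1 / 2 by rewrite ge_min lexx orbT.
  have [s2|s2] := leP s (1 / 2).
    by exists p; rewrite gtr0_norm//; split => //; apply/andP; split; lra.
  by exists (- p); rewrite normrN gtr0_norm//; split => //; apply/andP; split; lra.
have BE s rho k : 0 <= s <= 1 -> 0 < rho -> (forall t, `|t| < rho -> 0 <= s + t <= 1 ->
    (t != 0 \/ off s) -> balance (s + t) = k) -> (B s <-> k = balance 0).
  move=> s01 rho0 rhok; split=> [[q q0 qs]|kE].
    have m0 : 0 < Num.min rho q by rewrite lt_min rho0.
    have [t [t0 t1 t2]] := pick s _ s01 m0.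
    move: t1; rewrite lt_min => /andP[tr tq].
    by rewrite -(qs t)// (rhok t)//; left; rewrite -normr_gt0.
  exists rho => // t t0 tr t1; rewrite -kE; apply: rhok => //.
  by left; rewrite -normr_gt0.
suff B1 : B 1.
  have s1 : 0 <= (1 : R) <= 1 by rewrite ler01 lexx.
  have [rho rho0 [k rhok]] := balance_near s1.
  rewrite -(proj1 (BE _ _ _ s1 rho0 rhok) B1).
  by rewrite -(rhok 0) ?addr0 ?normr0//; right.
apply: (@unit_interval_clopen _ B); last first.
  have s0 : 0 <= (0 : R) <= 1 by rewrite ler01 lexx.
  have [rho rho0 [k rhok]] := balance_near s0.
  apply/(BE _ _ _ s0 rho0 rhok).
  by rewrite -(rhok 0) ?addr0 ?normr0//; right.
move=> s s01; have [rho rho0 [k rhok]] := balance_near s01; exists rho => //.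
suff Bt t : 0 <= t <= 1 -> `|t - s| < rho -> (B t <-> B s).
  by split=> [Bs t t01 ts|nBs t t01 ts]; [exact/(Bt t t01 ts)|move/(Bt t t01 ts)].
move=> t01 ts; have [->//|tneqs] := eqVneq t s.
rewrite (BE _ _ _ s01 rho0 rhok).
have ts0 : 0 < `|t - s| by rewrite normr_gt0 subr_eq0.
pose q := Num.min (rho - `|t - s|) `|t - s|.
have q0 : 0 < q by rewrite lt_min subr_gt0 ts.
apply: (BE _ _ _ t01 q0) => u; rewrite lt_min => /andP[u1 u2] tu _.
rewrite (_ : t + u = s + (t - s + u)); last by ring.
apply: rhok; rewrite ?(addrCA s) ?addrA ?(addrC s) ?subrK//.
  by apply: le_lt_trans (ler_normD _ _) _; lra.
left; apply: contraTneq u2 => /eqP; rewrite addr_eq0 => /eqP ->.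
by rewrite normrN ltxx.
Qed.

Lemma line_balance : \1_K x = \1_K (x + e) +
  \sum_(L <- nb) Num.sg (slope L) * \1_(prism (- e) (interface K L)) x :> R.
Proof.
have nb_mem L : (L \in nb) <-> neighbours Th K L by exact: (mem_neighbours h0 a0 mesh TK).
have [good1 _ _ _] := x_good.
have off0 : off 0 by move=> vc vcp; rewrite scale0r addr0; have [] := good1 vc vcp.
have := balance01; rewrite /balance scale0r addr0 scale1r.
rewrite (_ : \sum_(L <- nb) _ * crossed L 0 = 0) ?addr0; last first.
  rewrite big1_seq// => L /andP[_ /nb_mem KL]; rewrite /crossed asboolF ?mulr0//.
  move=> [t t0 St]; have t00 : t = 0 by lra.
  by rewrite t00 in St; exact: off_interface KL off0 St.
move=> ->; congr (_ + _); apply: eq_bigr => L _; congr (_ * _).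
rewrite /crossed; case: asboolP => [[t t01 St]|nc].
  rewrite indicE mem_set//; exists (y t, t) => //=.
  by rewrite scalerN addrK.
rewrite indicE memNset// => -[[z t] /= [Sz t01] zx]; apply: nc; exists t => //.
by rewrite -zx scalerN subrK.
Qed.

End Jumps.

(** * The discrete divergence theorem *)

Section Divergence.
Context {R : realType} {d : nat}.
Variables (Th : set (set 'rV[R]_d)) (nrm : set 'rV[R]_d -> set 'rV[R]_d -> 'rV[R]_d).
Variables (h a : R).
Hypotheses (h0 : 0 < h) (a0 : 0 < a) (mesh : admissible_mesh Th nrm h a).
Implicit Types (K L : set 'rV[R]_d) (e : 'rV[R]_d).

Lemma measurable_indics (s : seq (R * set 'rV[R]_d)) :
  (forall p, p \in s -> Borel p.2) ->
  measurable_fun [set: d.-tuple R] (fun t => \sum_(p <- s) p.1 * \1_(p.2) (row_of_tuple t) : R).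
Proof.
elim: s => [|p s IH] ms.
  by rewrite (_ : (fun _ => _) = cst 0)//; apply/funext => t; rewrite big_nil.
rewrite (_ : (fun _ => _) = (fun t => p.1 * \1_(row_of_tuple @^-1` p.2) t) \+
    (fun t => \sum_(p <- s) p.1 * \1_(p.2) (row_of_tuple t) : R)); last first.
  by apply/funext => t; rewrite big_cons.
apply: measurable_realfun.measurable_funD.
  apply: measurable_realfun.measurable_funM => //.
  by apply: measurable_realfun.measurable_indic; apply: ms; rewrite mem_head.
by apply: IH => q qs; apply: ms; rewrite inE qs orbT.
Qed.

Lemma integral_indics (s : seq (R * set 'rV[R]_d)) :
  (forall p, p \in s -> [/\ 0 <= p.1, Borel p.2 & bounded_set p.2]) ->
  (\int[lebesgue R d]_t (\sum_(p <- s) p.1 * \1_(p.2) (row_of_tuple t))%:E =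
   (\sum_(p <- s) p.1 * vol p.2)%:E)%E.
Proof.
elim: s => [|p s IH] ms.
  rewrite big_nil (eq_integral (fun=> 0%E)) ?integral0// => t _.
  by rewrite big_nil.
have [p0 mp bp] := ms p (mem_head _ _).
have ms' q : q \in s -> [/\ 0 <= q.1, Borel q.2 & bounded_set q.2].
  by move=> qs; apply: ms; rewrite inE qs orbT.
rewrite big_cons EFinD -IH//.
rewrite (eq_integral (fun t => ((p.1 * \1_(row_of_tuple @^-1` p.2) t)%:E +
    (\sum_(p <- s) p.1 * \1_(p.2) (row_of_tuple t))%:E)%E)); last first.
  by move=> t _; rewrite big_cons EFinD.
rewrite ge0_integralD//=; last 4 first.
- by move=> t _; rewrite lee_fin mulr_ge0// indicE.
- apply/measurable_realfun.measurable_EFinP; apply: measurable_realfun.measurable_funM => //.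
- move=> t _; rewrite lee_fin big_seq sumr_ge0// => q /ms'[q0 _ _].
  by rewrite mulr_ge0// indicE.
- by apply/measurable_realfun.measurable_EFinP; apply: measurable_indics => q /ms'[].
congr (_ + _)%E; under eq_integral do rewrite EFinM.
rewrite ge0_integralZl//=; last first.
  by apply/measurable_realfun.measurable_EFinP; apply: measurable_realfun.measurable_indic; exact: mp.
by rewrite integral_indic// setIT EFinM -volE.
Qed.

(** Integrating the balance along the lines of direction [e]: [K] and its
    translate have the same volume, and the interface with [L] contributes its
    area times the height [n_KL . e] of the prism that it sweeps. *)
Lemma sum_slope K e : Th K ->
  \sum_(L <- elements (neighbours Th K)) sigma K L * dotp (nrm K L) e = 0.
Proof.
move=> TK; set nb := elements _.
have nb_mem L : (L \in nb) <-> neighbours Th K L by exact: (mem_neighbours h0 a0 mesh TK).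
have /bounded_enormP[rK KrK] := closure_cell_bounded h0 a0 mesh TK.
pose r := rK + 4 * enorm e + 1; have e0 := enorm_ge0 e.
have Kr z : closure K z -> enorm z < r by move=> /KrK; rewrite /r; lra.
pose slope L := dotp (nrm K L) e.
(* a prism along a direction parallel to its base is null but perhaps not Borel *)
pose P L := if slope L == 0 then set0 else prism (- e) (interface K L).
have SH L : neighbours Th K L -> interface K L `<=` hyperplane (nrm K L) (offset nrm K L).
  exact: (offsetP mesh TK).
have bS L : bounded_set (interface K L) by exact: (interface_bounded h0 a0 mesh L TK).
have cS L : closed (interface K L) by exact: interface_closed.
have bP L : bounded_set (P L).
  rewrite /P; case: ifP => _; last exact: prism_bounded.
  by apply/bounded_enormP; exists 0 => x.
have mP L : neighbours Th K L -> Borel (P L).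
  move=> KL; rewrite /P; case: ifPn => sl.
    by apply: open_Borel; exact: open0.
  apply: closed_Borel; apply: (prism_closed _ (SH L KL)) => //.
  by rewrite dotpNr oppr_eq0.
have volP L : neighbours Th K L -> Num.sg (slope L) * vol (P L) = sigma K L * slope L.
  move=> KL; rewrite /P; case: ifPn => [/eqP ->|sl]; first by rewrite sgr0 mul0r mulr0.
  have n1 := enorm_nrm mesh TK KL.
  rewrite (vol_prism _ n1 (SH L KL))// dotpNr normrN mulrA -/(slope L) -numEsg mulrC.
  by rewrite /sigma (area_flat n1 (SH L KL)).
(* the terms of either sign are put on different sides, so that only
   nonnegative functions are integrated *)
pose l1 := (1, K) :: [seq ((slope L < 0)%R%:R, P L) | L <- nb] : seq (R * set 'rV[R]_d).
pose l2 := (1, [set x | K (x + e)]) :: [seq ((0 < slope L)%R%:R, P L) | L <- nb] : seq (R * set 'rV[R]_d).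
have bKe : bounded_set [set x | K (x + e)].
  apply/bounded_enormP; exists (rK + enorm e) => x Kx; rewrite -(addrK e x).
  apply: le_trans (ler_enormD _ _) _; rewrite enormN lerD2r; apply: KrK.
  exact: subset_closure.
have mKe : Borel [set x | K (x + e)] by apply: Borel_translate; exact: (cell_Borel mesh TK).
have ok1 p : p \in l1 -> [/\ 0 <= p.1, Borel p.2 & bounded_set p.2].
  rewrite inE => /predU1P[->|/mapP[L /nb_mem KL ->]] /=; split => //.
  - exact: (cell_Borel mesh TK).
  - exact: (cell_bounded h0 a0 mesh TK).
  - exact: mP.
  - exact: bP.
have ok2 q : q \in l2 -> [/\ 0 <= q.1, Borel q.2 & bounded_set q.2].
  rewrite inE => /predU1P[->|/mapP[L /nb_mem KL ->]] /=; split => //.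
  - exact: mP.
  - exact: bP.
have sgE (x : R) : Num.sg x = (0 < x)%R%:R - (x < 0)%R%:R.
  by rewrite sgr_def; have [||] := ltrgtP x 0; rewrite ?eqxx//= => *; lra.
have ae : (\sum_(p <- l1) p.1 * vol p.2)%:E = (\sum_(p <- l2) p.1 * vol p.2)%:E.
  rewrite -!integral_indics//; apply: ge0_ae_eq_integral => //.
  - apply/measurable_realfun.measurable_EFinP; apply: measurable_indics => p /ok1[] //.
  - apply/measurable_realfun.measurable_EFinP; apply: measurable_indics => p /ok2[] //.
  - by move=> t _; rewrite lee_fin big_seq sumr_ge0// => p /ok1[p0 _ _]; rewrite mulr_ge0// indicE.
  - by move=> t _; rewrite lee_fin big_seq sumr_ge0// => p /ok2[p0 _ _]; rewrite mulr_ge0// indicE.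
  apply: negligibleS (@good_line_null _ _ _ _ _ _ h0 a0 mesh K e r TK Kr) => t /= nt good.
  apply: nt => _; congr EFin; set x := row_of_tuple t in good *.
  rewrite /l1 /l2 !big_cons !big_map /= !mul1r.
  have -> : \1_[set x | K (x + e)] x = \1_K (x + e) :> R by rewrite !indicE.
  have balance : \1_K x = \1_K (x + e) +
      \sum_(L <- nb) Num.sg (slope L) * \1_(prism (- e) (interface K L)) x :> R.
    have [xr|xr] := leP (enorm x + 3 * enorm e) r.
      exact: (line_balance h0 a0 mesh TK good xr).
    have farK z : enorm (x - z) <= enorm e -> ~ closure K z.
      move=> xz /KrK zr; have := ler_enormB x z; move: xr; rewrite /r; lra.
    rewrite !indicE !memNset; last 2 first.
    - by move=> /subset_closure; apply: farK; rewrite opprD addrA subrr add0r enormN.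
    - by move=> /subset_closure; apply: farK; rewrite subrr enorm0.
    rewrite big1 ?addr0// => L _; rewrite indicE memNset ?mulr0//.
    move=> [[z s] /= [[cz _] /andP[s0 s1]] zx]; apply: (farK z) cz.
    rewrite -zx addrC addKr scalerN enormN enormZ ger0_norm//.
    by rewrite -[leRHS]mul1r ler_wpM2r.
  rewrite balance -addrA -big_split; congr (_ + _); apply: eq_bigr => L _ /=.
  rewrite /P; case: ifPn => [/eqP ->|_]; first by rewrite sgr0 ltxx !mul0r addr0.
  by rewrite -mulrDl sgE subrK.
have := EFin_inj ae; rewrite /l1 /l2 !big_cons !big_map /= !mul1r.
have -> : vol [set x | K (x + e)] = vol K.
  by rewrite /vol volume_translate//; exact: (cell_Borel mesh TK).
move/addrI => sum_eq; rewrite big_seq.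
rewrite (eq_bigr (fun L => Num.sg (slope L) * vol (P L))); last by move=> L /nb_mem/volP.
rewrite -big_seq (eq_bigr (fun L => (0 < slope L)%R%:R * vol (P L) - (slope L < 0)%R%:R * vol (P L))); last first.
  by move=> L _; rewrite -mulrBl -sgE.
by rewrite sumrB sum_eq subrr.
Qed.

(** The vector is orthogonal to every direction [e], in particular to itself. *)
Theorem sum_sigma_normal K : Th K ->
  \sum_(L <- elements (neighbours Th K)) sigma K L *: nrm K L = 0.
Proof.
move=> TK; set v := \sum_(L <- _) _; apply/eqP; rewrite -dotp_eq0 {2}/v dotp_sumr.
apply/eqP; rewrite -[RHS](sum_slope v TK).
by apply: eq_bigr => L _; rewrite dotpZr dotpC.
Qed.

End Divergence.

(** * Convex sets *)

Section Convex.
Context {R : realType} {m : nat}.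
Implicit Types (C : set 'rV[R]_m) (x y p : 'rV[R]_m).

Definition convex C : Prop := forall x y t,
  C x -> C y -> 0 <= t <= 1 -> C (t *: x + (1 - t) *: y).

Lemma convex_setP C : convex_set C -> convex C.
Proof.
move=> cC x y t Cx Cy /andP[t0 t1].
have := cC x y (Itv01 t0 t1); rewrite !inE => /(_ Cx Cy).
by [].
Qed.

Lemma convex_comb (I : eqType) (s : seq I) (w : I -> R) (x : I -> 'rV[R]_m) C :
  convex C -> (forall i, i \in s -> 0 <= w i /\ C (x i)) -> 0 < \sum_(i <- s) w i ->
  C ((\sum_(i <- s) w i)^-1 *: \sum_(i <- s) w i *: x i).
Proof.
move=> cC; elim: s => [|i s IH] wx; first by rewrite big_nil ltxx.
have [wi Ci] := wx i (mem_head _ _).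
have wx' j : j \in s -> 0 <= w j /\ C (x j) by move=> js; apply: wx; rewrite inE js orbT.
have W0 : 0 <= \sum_(j <- s) w j.
  by rewrite big_seq sumr_ge0// => j /wx'[].
rewrite !big_cons; set W := \sum_(j <- s) w j in W0 *.
have [W00|W00] := eqVneq W 0.
  rewrite W00 addr0 => wi0; rewrite [X in _ + X]big1_seq ?addr0.
    by rewrite scalerA mulVf ?scale1r// lt0r_neq0.
  move=> j /andP[_ js]; have -> : w j = 0.
    apply/eqP; rewrite eq_le (wx' j js).1 andbT -W00 /W (perm_big _ (perm_to_rem js))/=.
    rewrite big_cons lerDl big_seq sumr_ge0// => k /mem_rem /wx'[] //.
  by rewrite scale0r.
have Wpos : 0 < W by rewrite lt_neqAle eq_sym W00.
move=> wW; have wW0 := lt0r_neq0 wW.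
have k01 : 0 <= w i / (w i + W) <= 1.
  by rewrite ler_pdivrMr// mul1r lerDl W0 andbT divr_ge0// ltW.
have := cC _ _ (w i / (w i + W)) Ci (IH wx' Wpos) k01.
congr (C _); rewrite scalerDr !scalerA; congr (_ *: _ + _ *: _).
  by rewrite mulrC.
by rewrite -/W; field; rewrite wW0 W00.
Qed.

(** The first order condition at the end point of a segment. *)
Lemma quadratic_first_order (b q : R) :
  (forall t, 0 < t <= 1 -> 0 <= t * b + t ^+ 2 * q) -> 0 <= b.
Proof.
move=> bq; rewrite leNgt; apply/negP => b0.
have q1 : 0 < `|q| + 1 by rewrite ltr_wpDl.
pose t := Num.min 1 (- b / (`|q| + 1) / 2).
have t0 : 0 < t by rewrite lt_min ltr01 !divr_gt0// oppr_gt0.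
have t1 : t <= 1 by rewrite ge_min lexx.
have tb : t * (`|q| + 1) <= - b / 2.
  by rewrite -ler_pdivlMr// mulrAC ge_min lexx orbT.
have := bq t; rewrite t0 t1 => /(_ isT); rewrite expr2 -mulrA -mulrDr pmulr_rge0//.
have : t * q <= t * `|q| by rewrite ler_pM2l// ler_norm.
by move: tb; rewrite mulrDr mulr1; lra.
Qed.

(** The nearest point to the origin of the hull of a finite family pairs
    positively with the family. *)
Lemma finite_separation (n : nat) (X : 'I_n -> 'rV[R]_m) C : convex C -> ~ C 0 ->
  (0 < n)%N -> (forall i, C (X i)) ->
  exists2 w : 'I_n -> R, let p := \sum_i w i *: X i in p != 0 &
    let p := \sum_i w i *: X i in forall i, 0 < dotp p (X i).
Proof.
move=> cC C0 n0 CX.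
pose P (t : 'rV[R]_n) : 'rV[R]_m := \sum_i t 0 i *: X i.
pose simplex := [set t : 'rV[R]_n | (forall i, 0 <= t 0 i) /\ \sum_i t 0 i = 1].
have PB (t t' : 'rV[R]_n) : P t - P t' = P (t - t').
  by rewrite /P -sumrB; apply: eq_bigr => i _; rewrite !mxE scalerBl.
have Plip (t : 'rV[R]_n) : enorm (P t) <= enorm t * \sum_i enorm (X i).
  apply: le_trans (ler_enorm_sum _ _) _; rewrite mulr_sumr; apply: ler_sum => i _.
  by rewrite enormZ ler_wpM2r ?enorm_ge0// ler_coord_enorm.
have cP : continuous (fun t => enorm (P t)).
  apply: continuous_of_enorm => t e e0; set B := \sum_i enorm (X i).
  have B0 : 0 <= B by rewrite sumr_ge0// => i _; exact: enorm_ge0.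
  have B1 : 0 < B + 1 by rewrite ltr_wpDl.
  exists (e / (B + 1)); first exact: divr_gt0.
  move=> t'; rewrite ltr_pdivlMr// => tt'.
  apply: (@le_lt_trans _ _ (enorm (P t' - P t))).
    by rewrite ler_norml ler_enormB andbT lerNl opprB enormB ler_enormB.
  rewrite PB; apply: le_lt_trans (Plip _) _; apply: le_lt_trans tt'.
  by rewrite ler_wpM2l ?enorm_ge0// lerDl.
have simplex_nonempty : simplex !=set0.
  exists (delta_mx 0 (Ordinal n0)); split => [i|]; first by rewrite mxE ler0n.
  rewrite (bigD1 (Ordinal n0))//= mxE !eqxx big1 ?addr0// => i iN.
  by rewrite mxE eqxx (negPf iN).
have csum : continuous (fun t : 'rV[R]_n => \sum_i t 0 i).
  have -> : (fun t : 'rV[R]_n => \sum_i t 0 i) = dotp (const_mx 1).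
    by apply/funext => t; apply: eq_bigr => i _; rewrite mxE mul1r.
  exact: continuous_dotp.
have simplex_compact : compact simplex.
  apply: bounded_closed_compact.
    apply/bounded_enormP; exists (n%:R) => t [t0 t1].
    rewrite (row_sum_delta t); apply: le_trans (ler_enorm_sum _ _) _.
    rewrite -[X in _ <= X%:R]card_ord -sumr_const; apply: ler_sum => i _.
    rewrite enormZ ger0_norm// /enorm dotp_delta mxE !eqxx sqrtr1 mulr1 -t1.
    by rewrite (bigD1 i)//= lerDl sumr_ge0.
  have -> : simplex = (\bigcap_(i in [set: 'I_n]) [set t : 'rV[R]_n | 0 <= t 0 i]) `&`
     [set t : 'rV[R]_n | \sum_i t 0 i = 1].
    by apply/seteqP; split => t [t0 t1]; split => // i; [move=> _|]; exact: t0.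
  apply: closedI.
    apply: closed_bigI => i _.
    apply: (@closed_comp _ _ (fun t : 'rV[R]_n => t 0 i) [set s | 0 <= s]); last exact: closed_ge.
    by move=> t _; exact: coord_continuous.
  apply: (@closed_comp _ _ (fun t : 'rV[R]_n => \sum_i t 0 i) [set s | s = 1]); last exact: closed_eq.
  by move=> t _; exact: csum.
have [|t st tmin] := @EVT_min_rV R n (fun t => enorm (P t)) simplex simplex_nonempty simplex_compact.
  exact: continuous_subspaceT.
move: st; rewrite inE => -[t0 t1].
have CP (s : 'rV[R]_n) : simplex s -> C (P s).
  move=> [s0 s1]; have := @convex_comb 'I_n (index_enum 'I_n) (fun i => s 0 i) X C cC.
  by rewrite s1 invr1 scale1r; apply.
have p0 : P t != 0 by apply/eqP => p0; apply: C0; rewrite -p0; exact: CP.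
exists (fun i => t 0 i) => //= i; rewrite -/(P t).
have pp : 0 < dotp (P t) (P t) by rewrite lt_def dotp_eq0 p0 dotp_ge0.
suff : 0 <= 2 * dotp (P t) (X i - P t) by rewrite dotpBr; lra.
apply: (@quadratic_first_order _ (dotp (X i - P t) (X i - P t))) => k /andP[k0 k1].
pose t' := t + k *: (delta_mx 0 i - t).
have Pt' : P t' = P t + k *: (X i - P t).
  rewrite /P scalerBr scaler_sumr [X in _ = _ + (_ - X)](eq_bigr (fun j => (k * t 0 j) *: X j)); last first.
    by move=> j _; rewrite scalerA.
  rewrite (eq_bigr (fun j => t 0 j *: X j + ((k * (j == i)%:R) *: X j - (k * t 0 j) *: X j))); last first.
    by move=> j _; rewrite !mxE eqxx -scalerBl -scalerDl; congr (_ *: _); rewrite /=; ring.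
  rewrite big_split sumrB /=; congr (_ + (_ - _)).
  rewrite (bigD1 i)//= eqxx mulr1 big1 ?addr0// => j ji.
  by rewrite (negPf ji) mulr0 scale0r.
have st' : simplex t'.
  split=> [j|].
    rewrite !mxE eqxx/= (_ : _ + _ = (1 - k) * t 0 j + k * (j == i)%:R); last by ring.
    by rewrite addr_ge0// mulr_ge0// ?subr_ge0// ltW.
  rewrite (eq_bigr (fun j => (1 - k) * t 0 j + k * (j == i)%:R)); last first.
    by move=> j _; rewrite !mxE eqxx/=; ring.
  rewrite big_split /= -!mulr_sumr t1 (bigD1 i)//= eqxx big1 ?addr0; last first.
    by move=> j ji; rewrite (negPf ji).
  by rewrite !mulr1 subrK.
have := tmin t'; rewrite inE => /(_ st').
rewrite -ler_sqr ?nnegrE ?enorm_ge0// !sqr_enorm Pt'.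
move: (X i - P t) => D.
by rewrite dotpDl !dotpDr !(dotpZr, dotpZl) (dotpC D); lra.
Qed.

(** The set may accumulate at the origin, so it may have no nearest point.
    Finitely many of its points are separated from the origin by the nearest
    point of their hull, and compactness of the unit sphere of [W] gives one
    direction for all of them. *)
Lemma separation (W : 'M[R]_m) C : convex C -> ~ C 0 -> C !=set0 ->
  (forall x, C x -> (x <= W)%MS) ->
  exists p, [/\ p != 0, (p <= W)%MS & forall x, C x -> 0 <= dotp p x].
Proof.
move=> cC C0 [x0 Cx0] CW.
pose sphere := [set p : 'rV[R]_m | enorm p = 1 /\ (p <= W)%MS].
have Wclosed : closed [set p : 'rV[R]_m | (p <= W)%MS].
  have -> : [set p : 'rV[R]_m | (p <= W)%MS] =
      \bigcap_(i in [set: 'I_m]) [set p | dotp (col i (cokermx W))^T p = 0].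
    apply/seteqP; split => p /=.
      rewrite submxE => /eqP pW i _; have := congr1 (fun M : 'rV_m => M 0 i) pW.
      by rewrite !mxE => <-; apply: eq_bigr => j _; rewrite !mxE mulrC.
    move=> pW; rewrite submxE; apply/eqP/rowP => i; rewrite !mxE -[RHS](pW i I).
    by apply: eq_bigr => j _; rewrite !mxE mulrC.
  by apply: closed_bigI => i _; exact: (@closed_dotp R m _ [set r | r = 0] (@closed_eq R 0)).
have sphere_compact : compact sphere.
  apply: bounded_closed_compact.
    by apply/bounded_enormP; exists 1 => p [-> _].
  apply: closedI => //.
  apply: (@closed_comp _ _ (@enorm R m) [set r | r = 1]); last exact: closed_eq.
  by move=> p _; exact: continuous_enorm.
apply: contrapT => nop.
have cover : sphere `<=` \bigcup_(x in C) [set p | dotp p x < 0].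
  move=> p [p1 pW]; apply: contrapT => np; apply: nop; exists p; split => //.
    by rewrite -enorm_gt0 p1.
  by move=> x Cx; rewrite leNgt; apply/negP => px; apply: np; exists x.
move: sphere_compact; rewrite compact_cover => sphere_compact.
have [|D DC Dcover] := sphere_compact _ C (fun x => [set p | dotp p x < 0]) _ cover.
  move=> x _; have -> : [set p | dotp p x < 0] = dotp x @^-1` [set r | r < 0].
    by apply/seteqP; split => p /=; rewrite dotpC.
  by apply: open_comp; [move=> p _; exact: continuous_dotp|exact: open_lt].
pose X := tnth (in_tuple (enum_fset D)).
have CX i : C (X i).
  have : X i \in enum_fset D by exact: mem_tnth.
  by move=> /DC; rewrite inE.
have WX (w : 'I_(size (enum_fset D)) -> R) : ((\sum_i w i *: X i)%R <= W)%MS.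
  by apply: summx_sub => i _; apply: scalemx_sub; exact: CW.
have n0 : (0 < size (enum_fset D))%N.
  have [w /= w0 Ww] : exists2 p : 'rV[R]_m, p != 0 & (p <= W)%MS.
    by exists x0; [apply: contra_notN C0 => /eqP <-|exact: CW].
  have w1 : sphere ((enorm w)^-1 *: w).
    split; last exact: scalemx_sub.
    by rewrite enormZ ger0_norm ?invr_ge0 ?enorm_ge0// mulVf// lt0r_neq0// enorm_gt0.
  have [x Dx _] := Dcover _ w1.
  have : x \in enum_fset D by exact: Dx.
  by case: (enum_fset D).
have [w /= p0 pX] := finite_separation cC C0 n0 CX; set p := \sum_i _ in p0 pX.
have ep : 0 < enorm p by rewrite enorm_gt0.
have p1 : sphere ((enorm p)^-1 *: p).
  split; last by apply: scalemx_sub; exact: WX.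
  by rewrite enormZ ger0_norm ?invr_ge0 ?enorm_ge0// mulVf// lt0r_neq0.
have [x Dx /=] := Dcover _ p1.
rewrite dotpZl pmulr_rlt0 ?invr_gt0// ltNge => /negP; apply.
have /tnthP[i ->] : x \in in_tuple (enum_fset D) by [].
exact/ltW/pX.
Qed.

End Convex.

(** * Averages of functions with values in a convex set *)

Section Mean.
Context d (T : measurableType d) {R : realType} (mu : {measure set T -> \bar R}) {m : nat}.
Variables (D : set T) (g : T -> 'rV[R]_m) (C : set 'rV[R]_m).
Hypotheses (mD : measurable D) (D0 : (0 < mu D)%E) (Doo : (mu D < +oo)%E).
Hypothesis mg : forall i, measurable_fun D (fun t => g t 0 i).
Hypotheses (cC : convex C) (bC : bounded_set C) (gC : forall t, D t -> C (g t)).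

Definition mean : 'rV[R]_m := \row_i ((fine (mu D))^-1 * \int[mu]_(t in D) g t 0 i).

Lemma integrable_coord i : mu.-integrable D (EFin \o (fun t => g t 0 i)).
Proof.
apply: measurable_bounded_integrable => //.
have /bounded_enormP[M CM] := bC; exists M; split; first exact: num_real.
move=> M' MM' t Dt /=; apply: le_trans (ler_coord_enorm _ _) _.
exact: le_trans (CM _ (gC Dt)) (ltW MM').
Qed.

Lemma integral_dotp (p : 'rV[R]_m) :
  mu.-integrable D (EFin \o (fun t => dotp p (g t))) /\
  \int[mu]_(t in D) dotp p (g t) = fine (mu D) * dotp p mean.
Proof.
have V0 : fine (mu D) != 0.
  by rewrite lt0r_neq0// fine_gt0// D0.
rewrite /dotp mulr_sumr (eq_bigr (fun i => p 0 i * \int[mu]_(t in D) g t 0 i)); last first.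
  by move=> i _; rewrite mxE; field.
elim: (index_enum _) => [|i s [IHi IHe]].
  split; last first.
    rewrite big_nil -[RHS](mul0r (fine (mu D))) -Rintegral_cst//; apply: eq_Rintegral => t _.
    by rewrite big_nil.
  apply: (eq_integrable mD (cst 0%E)); last exact: integrable0.
  by move=> t _; rewrite /= big_nil.
have Ii : mu.-integrable D (EFin \o (fun t => p 0 i * g t 0 i)).
  have -> : EFin \o (fun t => p 0 i * g t 0 i) = (fun t => (p 0 i)%:E * (g t 0 i)%:E)%E.
    by apply/funext => t; rewrite /= EFinM.
  exact: (integrableZl mD (p 0 i) (integrable_coord i)).
split.
  apply: (eq_integrable mD ((EFin \o (fun t => (p 0 i * g t 0 i)%R)) \+
      (EFin \o (fun t => (\sum_(j <- s) p 0 j * g t 0 j)%R)))%E); last exact: integrableD.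
  by move=> t _; rewrite /= big_cons EFinD.
rewrite big_cons -IHe -RintegralZl//; last exact: integrable_coord.
rewrite -RintegralD//; apply: eq_Rintegral => t _; by rewrite big_cons.
Qed.

(** If the mean were not in [C], a hyperplane through it would have [C] on one
    side. A function on one side of a hyperplane whose mean is on the hyperplane
    stays in it almost everywhere, so the dimension can be lowered, down to a
    contradiction. *)
Theorem mean_in_convex : C mean.
Proof.
apply: contrapT => nC.
suff dim n (W : 'M[R]_m) : (\rank W < n)%N -> ~ {ae mu, forall t, D t -> (g t - mean <= W)%MS}.
  apply: (dim m.+1 1%:M); first by rewrite mxrank1.
  by apply: aeW => t _; exact: submx1.
elim: n W => [//|n IH] W Wn aeW.
pose C' := [set x | C (x + mean) /\ (x <= W)%MS].
have cC' : convex C'.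
  move=> x y t [Cx Wx] [Cy Wy] t01; split; last first.
    by apply: addmx_sub; exact: scalemx_sub.
  have -> : t *: x + (1 - t) *: y + mean = t *: (x + mean) + (1 - t) *: (y + mean).
    by apply/rowP => i; rewrite !mxE; ring.
  exact: cC.
have C'0 : ~ C' 0 by move=> []; rewrite add0r.
have [t0 Dt0 Wt0] : exists2 t, D t & (g t - mean <= W)%MS.
  apply: contrapT => nt; suff : mu D = 0%E by move=> D00; move: D0; rewrite D00 ltxx.
  apply: measure_negligible => //; apply: negligibleS aeW => t Dt /= Wt.
  by apply: nt; exists t => //; exact: Wt.
have C'g t : D t -> (g t - mean <= W)%MS -> C' (g t - mean).
  by move=> Dt Wt; split => //; rewrite subrK; exact: gC.
have C'ne : C' !=set0 by exists (g t0 - mean); exact: C'g.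
have [p [p0 pW pC']] : exists p, [/\ p != 0, (p <= W)%MS & forall x, C' x -> 0 <= dotp p x].
  by apply: (separation cC' C'0 C'ne) => x [].
pose phi t := dotp p (g t) - dotp p mean.
have [Ip Ep] := integral_dotp p.
have Ic : mu.-integrable D (EFin \o cst (dotp p mean)).
  by apply: measurable_bounded_integrable => //; exact: bounded_cst.
have Iphi : mu.-integrable D (EFin \o phi).
  apply: (eq_integrable mD ((EFin \o (fun t => dotp p (g t))) \- (EFin \o cst (dotp p mean)))%E).
    by move=> t _; rewrite /= EFinB.
  exact: integrableB.
have phi0 : (\int[mu]_(t in D) (phi t)%:E = 0)%E.
  have : \int[mu]_(t in D) phi t = 0.
    by rewrite RintegralB// Ep Rintegral_cst// mulrC subrr.
  rewrite /Rintegral => f0; rewrite -[LHS]fineK ?f0//.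
  exact: integrable_fin_num.
have /integrableP[mphi _] := Iphi.
have ae0 : ae_eq mu D (EFin \o phi) (cst 0%E).
  apply/ae_eq_integral_abs => //; rewrite -[RHS]phi0; apply: ae_eq_integral => //.
    by have /integrableP[mabs _] := integrable_abse Iphi; exact: mabs.
  apply: filterS aeW => t Wt Dt /=; rewrite ger0_norm//.
  by rewrite /phi -dotpBr; apply: pC'; apply: C'g => //; exact: Wt.
pose W' := (W :&: kermx p^T)%MS.
have pker (x : 'rV[R]_m) : (x <= kermx p^T)%MS = (dotp x p == 0).
  apply/idP/eqP => [/sub_kermxP xp|xp].
    by have := congr1 (fun M : 'M[R]_(1, 1) => M 0 0) xp; rewrite !mxE => <-; apply: eq_bigr => i _; rewrite mxE.
  apply/sub_kermxP/matrixP => i j; rewrite !ord1 !mxE -[RHS]xp.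
  by apply: eq_bigr => k _; rewrite mxE.
apply: (IH W').
  apply: leq_trans (_ : \rank W' < \rank W)%N _; last by [].
  apply: rank_ltmx; rewrite ltmxE capmxSl /=; apply/negP => /(submx_trans pW).
  by rewrite sub_capmx pker dotp_eq0 (negPf p0) andbF.
apply: filterS2 aeW ae0 => t Wt pt Dt; rewrite sub_capmx Wt//= pker dotpC dotpBr.
have pt0 : (phi t)%:E = 0%:E := pt Dt.
by move: (EFin_inj pt0); rewrite /phi => ->.
Qed.

End Mean.

(** * Second order calculus *)

Section Calculus.
Context {R : realType} {m : nat}.
Implicit Types (g : 'rV[R]_m -> R) (x y v w : 'rV[R]_m) (Omega U : set 'rV[R]_m).

Lemma is_derive_line g x v s : differentiable g (x + s *: v) ->
  is_derive s 1 (fun s => g (x + s *: v)) ('D_v g (x + s *: v)).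
Proof.
move=> dg; set y := x + s *: v in dg *.
have E : (fun h : R => h^-1 *: (((fun s => g (x + s *: v)) \o shift s) (h *: 1) - g y)) =
         (fun h : R => h^-1 *: ((g \o shift y) (h *: v) - g y)).
  apply/funext => h /=; congr (_ *: (g _ - _)).
  by rewrite /y [h *: 1]mulr1 scalerDl addrCA addrA addrC addrA.
have gv : derivable g y v by exact: diff_derivable.
by split; rewrite /derivable /derive -/y E.
Qed.

Lemma mean_value (f df : R -> R) (a b : R) : a < b ->
  (forall s, a <= s <= b -> is_derive s 1 f (df s)) ->
  exists2 c, a < c < b & f b - f a = df c * (b - a).
Proof.
move=> ab fd; have fdo s : s \in `]a, b[%R -> is_derive s 1 f (df s).
  by rewrite in_itv/= => /andP[/ltW ? /ltW ?]; apply: fd; apply/andP.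
have fc : {within `[a, b], continuous f}.
  apply: derivable_within_continuous => s; rewrite in_itv/= => /fd sd.
  exact: ex_derive.
by have [c] := MVT ab fdo fc; rewrite in_itv/= => cab E; exists c.
Qed.

Definition C2_on U g : Prop := open U /\ forall x, U x -> differentiable g x /\
  forall v, differentiable ('D_v g) x /\ forall w, {for x, continuous ('D_w ('D_v g))}.

(** The second difference on the left is symmetric in [v] and [w], which is
    what makes mixed derivatives equal. *)
Lemma mixed_difference U g x v w (s : R) : C2_on U g -> 0 < s ->
  (forall a b, 0 <= a <= s -> 0 <= b <= s -> U (x + a *: v + b *: w)) ->
  exists a b, [/\ 0 <= a <= s, 0 <= b <= s &
    g (x + s *: v + s *: w) - g (x + s *: v) - (g (x + s *: w) - g x) =
    'D_w ('D_v g) (x + a *: v + b *: w) * s * s].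
Proof.
move=> [_ Ug] s0 box; have s1 : 0 <= (0 : R) <= s by rewrite lexx ltW.
have ss : 0 <= s <= s by rewrite lexx ltW.
have box0 a : 0 <= a <= s -> U (x + a *: v) by move=> /box/(_ s1); rewrite scale0r addr0.
pose F a := g (x + s *: w + a *: v) - g (x + a *: v).
have [a a01 Fa] : exists2 a, 0 < a < s &
    F s - F 0 = ('D_v g (x + s *: w + a *: v) - 'D_v g (x + a *: v)) * (s - 0).
  apply: (@mean_value F (fun a => 'D_v g (x + s *: w + a *: v) - 'D_v g (x + a *: v))) => // a a0s.
  apply: is_deriveB; apply: is_derive_line; apply: (Ug _ _).1; last exact: box0.
  by rewrite addrAC; apply: box.
have as01 : 0 <= a <= s by move/andP: a01 => [? ?]; rewrite !ltW.
have [b b01 Fb] := @mean_value (fun b => 'D_v g (x + a *: v + b *: w))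
  (fun b => 'D_w ('D_v g) (x + a *: v + b *: w)) 0 s s0
  (fun b b01 => is_derive_line ((Ug _ (box a b as01 b01)).2 v).1).
exists a, b; split => //; first by move/andP: b01 => [? ?]; rewrite !ltW.
move: Fa Fb; rewrite /F !subr0 !scale0r !addr0.
rewrite (addrAC x (s *: w) (a *: v)) (addrAC x (s *: w) (s *: v)) => -> ->.
by [].
Qed.

Lemma half_distance (z A B : R) :
  `|z - B| < `|A - B| / 2 -> `|z - A| < `|A - B| / 2 -> False.
Proof. by have := ler_distD z A B; rewrite (distrC A z); lra. Qed.

Lemma schwarz U g x v w : C2_on U g -> U x -> 'D_w ('D_v g) x = 'D_v ('D_w g) x.
Proof.
move=> CU Ux; have [oU Ug] := CU.
apply/eqP; rewrite -subr_eq0 -normr_eq0; apply: contraT => ne.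
set A := 'D_w ('D_v g) x in ne *; set B := 'D_v ('D_w g) x in ne *.
pose eps := `|A - B| / 2.
have eps0 : 0 < eps by rewrite divr_gt0// lt_neqAle eq_sym ne normr_ge0.
have near_x (F : 'rV[R]_m -> R) : {for x, continuous F} ->
    exists2 rho, 0 < rho & forall y, enorm (y - x) < rho -> `|F y - F x| < eps.
  move=> /(_ [set z | `|z - F x| < eps]) Fx; apply/(nbhs_enormP x).
  apply: Fx; apply/nbhs_ballP; exists eps => // z /=.
  by rewrite -ball_normE /ball_/= distrC.
have [r1 r10 Ar] := near_x _ (((Ug x Ux).2 v).2 w).
have [r2 r20 Br] := near_x _ (((Ug x Ux).2 w).2 v).
have [r3 r30 Ur] := proj1 (open_enormP U) oU x Ux.
pose r := Num.min r1 (Num.min r2 r3).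
have r0 : 0 < r by rewrite !lt_min r10 r20.
have vw0 : 0 < enorm v + enorm w + 1 by rewrite ltr_wpDl// addr_ge0// enorm_ge0.
pose s := r / (enorm v + enorm w + 1).
have s0 : 0 < s by exact: divr_gt0.
have near_box (v' w' : 'rV[R]_m) a b : enorm v' + enorm w' = enorm v + enorm w ->
    0 <= a <= s -> 0 <= b <= s -> enorm (x + a *: v' + b *: w' - x) < r.
  move=> vw' /andP[a0 a1] /andP[b0 b1]; have -> : x + a *: v' + b *: w' - x = a *: v' + b *: w'.
    by apply/rowP => i; rewrite !mxE; ring.
  apply: le_lt_trans (ler_enormD _ _) _; rewrite !enormZ !ger0_norm//.
  have : a * enorm v' <= s * enorm v' by rewrite ler_wpM2r// enorm_ge0.
  have : b * enorm w' <= s * enorm w' by rewrite ler_wpM2r// enorm_ge0.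
  have : s * enorm v' + s * enorm w' = s * (enorm v + enorm w) by rewrite -mulrDr vw'.
  have : s * (enorm v + enorm w + 1) = r by rewrite /s divfK// lt0r_neq0.
  by rewrite [s * (_ + 1)]mulrDr mulr1; lra.
have lt_r z : z < r -> [/\ z < r1, z < r2 & z < r3].
  by rewrite !lt_min => /and3P[].
have box v' w' : enorm v' + enorm w' = enorm v + enorm w ->
    forall a b, 0 <= a <= s -> 0 <= b <= s -> U (x + a *: v' + b *: w').
  by move=> vw' a b a01 b01; apply: Ur; have /lt_r[] := near_box v' w' a b vw' a01 b01.
have [a [b [a01 b01 E1]]] := mixed_difference CU s0 (box v w erefl).
have wv : enorm w + enorm v = enorm v + enorm w by rewrite addrC.
have [a' [b' [a'01 b'01 E2]]] := mixed_difference CU s0 (box w v wv).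
have /lt_r[n1 _ _] := near_box v w a b erefl a01 b01.
have /lt_r[_ n2 _] := near_box w v a' b' wv a'01 b'01.
have := Ar _ n1; have := Br _ n2.
have -> : 'D_v ('D_w g) (x + a' *: w + b' *: v) = 'D_w ('D_v g) (x + a *: v + b *: w).
  apply: (mulIf (lt0r_neq0 s0)); apply: (mulIf (lt0r_neq0 s0)).
  rewrite -[RHS]E1 -[LHS]E2 (addrAC x (s *: w)).
  move: (g _) (g _) (g _) (g _) => g1 g2 g3 g4; ring.
by move=> zB zA; case: (half_distance zB zA).
Qed.

Lemma hessian_sym U g x : C2_on U g -> U x -> (hessian g x)^T = hessian g x.
Proof.
move=> CU Ux; apply/matrixP => i j; rewrite !mxE.
exact: (@schwarz U g x (delta_mx 0 i) (delta_mx 0 j) CU Ux).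
Qed.

Lemma derive_coord g x v : differentiable g x ->
  'D_v g x = \sum_i v 0 i * 'D_(delta_mx 0 i) g x.
Proof.
move=> dg; rewrite deriveE// {1}(row_sum_delta v) linear_sum.
by apply: eq_bigr => i _; rewrite linearZ deriveE.
Qed.

Lemma derive2_hessian U g x w : C2_on U g -> U x ->
  'D_w ('D_w g) x = dotp (w *m hessian g x) w.
Proof.
move=> CU Ux; have [oU Ug] := CU.
have dg i : differentiable ('D_(delta_mx 0 i) g) x by exact: ((Ug x Ux).2 _).1.
have -> : 'D_w ('D_w g) x = 'D_w (\sum_i (w 0 i \*: 'D_(delta_mx 0 i) g)) x.
  apply: near_eq_derive; have : nbhs x U by exact: open_nbhs_nbhs.
  apply: filterS => y Uy; rewrite derive_coord; last exact: (Ug y Uy).1.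
  by rewrite fct_sumE.
rewrite derive_sum; last by move=> i; apply: derivableZ; exact: diff_derivable.
apply: eq_bigr => i _; rewrite deriveZ; last exact: diff_derivable.
rewrite derive_coord// mxE [RHS]mulrC; congr (_ * _).
by apply: eq_bigr => j _; rewrite mxE.
Qed.

End Calculus.

(** * Quadratic forms and Taylor expansion *)

Section SpectralBounds.
Context {R : realType} {m : nat}.
Implicit Types (H : 'M[R]_m) (w z : 'rV[R]_m).

Lemma dotp_mulmx_sym H w z : H^T = H -> dotp (w *m H) z = dotp (z *m H) w.
Proof.
move=> Hsym.
have E (u v : 'rV[R]_m) : dotp u v = (u *m v^T) 0 0.
  by rewrite !mxE; apply: eq_bigr => i _; rewrite mxE.
have T : (w *m H *m z^T)^T = z *m H *m w^T by rewrite !trmx_mul trmxK Hsym mulmxA.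
by rewrite !E -T [RHS]mxE.
Qed.

Lemma continuous_form H : continuous (fun w => dotp (w *m H) w).
Proof.
have -> : (fun w => dotp (w *m H) w) = (fun w => \sum_i (dotp (col i H)^T w * w 0 i)).
  apply/funext => w; apply: eq_bigr => i _; congr (_ * _).
  by rewrite mxE; apply: eq_bigr => j _; rewrite !mxE mulrC.
apply: continuous_big => [|i _ w]; first by move=> x; apply: cvgD; [exact: cvg_fst|exact: cvg_snd].
by apply: continuousM; [exact: continuous_dotp|exact: coord_continuous].
Qed.

(** The minimum of the quadratic form on the unit sphere is an eigenvalue. *)
Lemma form_lower_bound H (b : R) : H^T = H ->
  (forall x, eigenvalue H x -> b <= x) ->
  forall w, b * dotp w w <= dotp (w *m H) w.
Proof.
move=> Hsym Hb.
have [m0|m0] := posnP m.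
  move=> w; have -> : w = 0 by apply/rowP => i; have := ltn_ord i; rewrite {2}m0.
  by rewrite mul0mx !dotp0l mulr0.
pose sphere := [set w : 'rV[R]_m | enorm w = 1].
have sphere_compact : compact sphere.
  apply: bounded_closed_compact; first by apply/bounded_enormP; exists 1 => w ->.
  apply: (@closed_comp _ _ (@enorm R m) [set r | r = 1]); last exact: closed_eq.
  by move=> w _; exact: continuous_enorm.
have sphere0 : sphere !=set0.
  exists (delta_mx 0 (Ordinal m0)).
  by rewrite /sphere/= /enorm dotp_delta mxE !eqxx sqrtr1.
have [w0 w0s wmin] := EVT_min_rV sphere0 sphere_compact
  (continuous_subspaceT (@continuous_form H)).
move: w0s; rewrite inE /sphere/= => w01; set mu := dotp (w0 *m H) w0 in wmin.
have ww0 : dotp w0 w0 = 1 by rewrite -sqr_enorm w01 expr1n.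
have mu_le z : mu * dotp z z <= dotp (z *m H) z.
  have [->|z0] := eqVneq z 0; first by rewrite mul0mx !dotp0l mulr0.
  have ez : 0 < enorm z by rewrite enorm_gt0.
  have /wmin : (enorm z)^-1 *: z \in sphere.
    by rewrite inE /sphere/= enormZ ger0_norm ?invr_ge0 ?enorm_ge0// mulVf// lt0r_neq0.
  rewrite -scalemxAl dotpZl dotpZr mulrA -invfM -expr2 sqr_enorm mulrC.
  by rewrite ler_pdivlMr// -sqr_enorm exprn_gt0.
have first_order z : 0 <= 2 * (dotp (w0 *m H) z - mu * dotp w0 z).
  apply: (@quadratic_first_order _ _ (dotp (z *m H) z - mu * dotp z z)) => t /andP[t0 t1].
  have := mu_le (w0 + t *: z).
  rewrite mulmxDl -scalemxAl !(dotpDl, dotpDr, dotpZl, dotpZr) -/mu ww0.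
  by rewrite (dotp_mulmx_sym z w0 Hsym) (dotpC z w0); lra.
have eig : w0 *m H = mu *: w0.
  apply/eqP; rewrite -subr_eq0 -dotp_eq0; apply/eqP.
  set u := w0 *m H - mu *: w0.
  have uE z : dotp u z = dotp (w0 *m H) z - mu * dotp w0 z by rewrite dotpBl dotpZl.
  have := first_order u; have := first_order (- u).
  by rewrite !dotpNr mulrN; move: (uE u); lra.
have mub : b <= mu.
  apply: Hb; apply/eigenvalueP; exists w0 => //.
  by rewrite -enorm_gt0 w01.
by move=> w; apply: le_trans (mu_le w); rewrite ler_wpM2r// dotp_ge0.
Qed.

Lemma form_upper_bound H (b : R) : H^T = H ->
  (forall x, eigenvalue H x -> x <= b) ->
  forall w, dotp (w *m H) w <= b * dotp w w.
Proof.
move=> Hsym Hb w; have := @form_lower_bound (- H) (- b) _ _ w.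
rewrite mulmxN dotpNl mulNr lerN2; apply; first by rewrite linearN /= Hsym.
move=> x /eigenvalueP[v vH v0]; rewrite lerNl; apply: Hb; apply/eigenvalueP.
by exists v => //; rewrite scaleNr -vH mulmxN opprK.
Qed.

End SpectralBounds.

Section Taylor.
Context {R : realType} {m : nat}.
Variables (Omega : set 'rV[R]_m) (eta : 'rV[R]_m -> R).
Hypotheses (cO : convex Omega) (C2 : C2_closure Omega eta).
Implicit Types (u v w : 'rV[R]_m).

Lemma closure_convex : convex (closure Omega).
Proof.
move=> x y t /closure_enormP Ox /closure_enormP Oy /andP[t0 t1].
apply/closure_enormP => e e0; have [x' Ox' xx'] := Ox e e0; have [y' Oy' yy'] := Oy e e0.
exists (t *: x' + (1 - t) *: y'); first by apply: cO => //; apply/andP.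
have -> : t *: x' + (1 - t) *: y' - (t *: x + (1 - t) *: y) =
    t *: (x' - x) + (1 - t) *: (y' - y) by apply/rowP => i; rewrite !mxE; ring.
apply: le_lt_trans (ler_enormD _ _) _; rewrite !enormZ !ger0_norm ?subr_ge0//.
have : t * enorm (x' - x) <= t * Num.max (enorm (x' - x)) (enorm (y' - y)).
  by rewrite ler_wpM2l// le_max lexx.
have : (1 - t) * enorm (y' - y) <= (1 - t) * Num.max (enorm (x' - x)) (enorm (y' - y)).
  by rewrite ler_wpM2l ?subr_ge0// le_max lexx orbT.
have : Num.max (enorm (x' - x)) (enorm (y' - y)) < e by rewrite gt_max xx'.
by rewrite !mulrBl !mul1r; lra.
Qed.

Lemma C2_closureP : exists2 U, closure Omega `<=` U & C2_on U eta.
Proof. by have [U [oU OU UC]] := C2; exists U. Qed.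

Lemma eta_differentiable u : closure Omega u -> differentiable eta u.
Proof. by have [U OU [_ UC]] := C2_closureP; move=> /OU/UC[]. Qed.

(** By convexity the segment stays in the closure of [Omega], where the bounds
    on the Hessian hold. *)
Lemma taylor_lagrange u v : closure Omega u -> closure Omega v ->
  exists2 x, closure Omega x & eta v = eta u + 'D_(v - u) eta u +
    dotp ((v - u) *m hessian eta x) (v - u) / 2.
Proof.
move=> Ou Ov; have [U OU CU] := C2_closureP; have [oU UC] := CU.
set w := v - u.
have Ot (t : R) : 0 <= t <= 1 -> closure Omega (u + t *: w).
  move=> t01; have -> : u + t *: w = t *: v + (1 - t) *: u.
    by apply/rowP => i; rewrite !mxE; ring.
  exact: closure_convex.
pose phi (t : R) : R := eta (u + t *: w); pose dphi (t : R) : R := 'D_w eta (u + t *: w).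
have dphiE (t : R) : 0 <= t <= 1 -> is_derive t 1 phi (dphi t).
  by move=> /Ot/OU/UC[dt _]; exact: is_derive_line.
pose q := 2 * (phi 1 - phi 0 - dphi 0).
(* [q] makes [psi] take the same value at both ends, so [psi'] vanishes at some [c] *)
pose psi : R -> R := phi - (dphi 0 \*: (id : R -> R)) - ((q / 2) \*: ((id : R -> R) ^+ 2)).
have psiE t : psi t = phi t - dphi 0 * t - q / 2 * t ^+ 2 by [].
have dpsi (t : R) : 0 <= t <= 1 -> is_derive t 1 psi (dphi t - dphi 0 - q * t).
  move=> /dphiE dt; apply: is_derive_eq.
  rewrite /= !scaler1 expr1 /GRing.scale /=; lra.
have [c /andP[c0 c1] cE] := mean_value ltr01 dpsi.
have {cE} cE : dphi c - dphi 0 = q * c by move: cE; rewrite !psiE /q; lra.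
have ddphi (s : R) : 0 <= s <= c -> is_derive s 1 dphi ('D_w ('D_w eta) (u + s *: w)).
  move=> s0c; have /Ot/OU/UC[_ /(_ w)[dd _]] : 0 <= s <= 1 by lra.
  exact: is_derive_line.
have [b /andP[b0 bc] bE] := mean_value c0 ddphi.
have Ob : closure Omega (u + b *: w) by apply: Ot; lra.
exists (u + b *: w) => //; rewrite -(derive2_hessian w CU (OU _ Ob)).
have -> : 'D_w ('D_w eta) (u + b *: w) = q.
  by apply: (mulIf (lt0r_neq0 c0)); rewrite -cE bE subr0.
rewrite /q /phi /dphi scale0r scale1r addr0; have -> : u + w = v by rewrite /w addrC subrK.
lra.
Qed.

End Taylor.

Section C2Bounded.
Context {R : realType} {m : nat}.
Variables (Omega : set 'rV[R]_m) (g : 'rV[R]_m -> R).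

Lemma C2_bounded : bounded_set Omega -> C2_closure Omega g ->
  exists2 M, 0 <= M & forall u, closure Omega u -> `|g u| <= M.
Proof.
move=> /bounded_enormP[B OB] [U [oU OU UC]].
have [[u0 Ou0]|O0] := pselect (closure Omega !=set0); last first.
  by exists 0 => // u Ou; exfalso; apply: O0; exists u.
have bcl : bounded_set (closure Omega).
  apply/bounded_enormP; exists (B + 1) => u /closure_enormP/(_ 1 ltr01)[y Oy yu].
  rewrite -(subrK y u) addrC; apply: le_trans (ler_enormD _ _) _.
  by rewrite lerD ?OB// enormB ltW.
have compact_cl := bounded_closed_compact bcl (@closed_closure _ Omega).
have cg : {within closure Omega, continuous (fun u => `|g u|)}.
  apply: continuous_in_subspaceT => u; rewrite inE => /OU/UC[dg _].
  apply: (@continuous_comp _ _ _ g Num.norm); last exact: norm_continuous.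
  exact: differentiable_continuous.
have [|c _ cmax] := EVT_max_rV _ compact_cl cg; first by exists u0.
exists `|g c| => // u Ou; apply: cmax; by rewrite inE.
Qed.

End C2Bounded.

(** * The scheme: invariance and entropy dissipation *)

(** Nonnegativity of the weighted squares of [x i - t], at the best [t]. *)
Lemma weighted_cauchy_schwarz (R : realType) (I : eqType) (s : seq I) (c x : I -> R) :
  (forall i, i \in s -> 0 <= c i) ->
  (\sum_(i <- s) c i * x i) ^+ 2 <= (\sum_(i <- s) c i) * \sum_(i <- s) c i * x i ^+ 2.
Proof.
move=> c0; set B := \sum_(i <- s) c i * x i; set C := \sum_(i <- s) c i.
set A := \sum_(i <- s) c i * x i ^+ 2.
have pos t : 0 <= A - 2 * t * B + t ^+ 2 * C.
  have -> : A - 2 * t * B + t ^+ 2 * C = \sum_(i <- s) c i * (x i - t) ^+ 2.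
    rewrite /A /B /C !mulr_sumr -sumrB -big_split; apply: eq_bigr => i _ /=; ring.
  by rewrite big_seq sumr_ge0// => i /c0 ci; rewrite mulr_ge0// sqr_ge0.
have C0 : 0 <= C by rewrite /C big_seq sumr_ge0.
have [C00|C00] := eqVneq C 0.
  have [B0|B0] := eqVneq B 0; first by rewrite B0 C00 mul0r expr0n.
  have := pos ((A + 1) / (2 * B)); rewrite C00 mulr0 addr0 (_ : 2 * _ * B = A + 1).
    by move=> ?; lra.
  by field.
have Cp : 0 < C by rewrite lt_neqAle eq_sym C00.
have := pos (B / C); rewrite (_ : A - _ + _ = (C * A - B ^+ 2) / C); last by field.
by rewrite pmulr_lge0 ?invr_gt0// subr_ge0.
Qed.

Section Scheme.
Context {R : realType} {m d : nat}.
Local Notation cell := (set 'rV[R]_d).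
Variables (Omega : set 'rV[R]_m) (eta : 'rV[R]_m -> R) (xi : 'I_d -> 'rV[R]_m -> R)
  (f : 'I_d -> 'rV[R]_m -> 'rV[R]_m) (Th : set cell) (nrm : cell -> cell -> 'rV[R]_d)
  (G : cell -> cell -> 'rV[R]_m -> 'rV[R]_m -> 'rV[R]_m)
  (Xi : cell -> cell -> 'rV[R]_m -> 'rV[R]_m -> R)
  (h a lam dt zeta beta0 beta1 : R)
  (u0 : 'rV[R]_d -> 'rV[R]_m) (u : nat -> cell -> 'rV[R]_m).
Hypotheses (d0 : (0 < d)%N) (cO : convex Omega) (bO : bounded_set Omega)
  (eta_C2 : C2_closure Omega eta) (eta_ge0 : forall u, closure Omega u -> 0 <= eta u)
  (u0_Omega : forall x, Omega (u0 x))
  (u0_measurable : forall i, measurable_fun [set: d.-tuple R]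
     (fun t => u0 (row_of_tuple t) 0 i))
  (a0 : 0 < a) (zeta0 : 0 < zeta) (zeta1 : zeta < 1) (lam0 : 0 < lam)
  (beta0_gt0 : 0 < beta0) (beta01 : beta0 <= beta1)
  (h0 : 0 < h) (mesh : admissible_mesh Th nrm h a)
  (flux : admissible_flux Th nrm Omega f eta xi G lam)
  (entropy : numerical_entropy_flux Th nrm Omega f eta xi G lam Xi)
  (dt0 : 0 < dt)
  (cfl : dt <= beta0 / beta1 * (a ^+ 2 / lam) * (1 - zeta) * h)
  (scheme : scheme_solution Th G dt u0 u).
Implicit Types (K L : cell) (v w : 'rV[R]_m).

Local Notation nb K := (elements (neighbours Th K)).

Lemma mem_nb K L : Th K -> (L \in nb K) <-> neighbours Th K L.
Proof. by move=> TK; exact: (mem_neighbours h0 a0 mesh TK). Qed.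

Lemma fdot_sum w (I : Type) (s : seq I) (c : I -> R) (n : I -> 'rV[R]_d) :
  fdot f w (\sum_(i <- s) c i *: n i) = \sum_(i <- s) c i *: fdot f w (n i).
Proof.
rewrite /fdot; under [RHS]eq_bigr do rewrite scaler_sumr.
rewrite [RHS]exchange_big; apply: eq_bigr => al _ /=.
by rewrite summxE scaler_suml; apply: eq_bigr => i _; rewrite mxE scalerA.
Qed.

Lemma xidot_sum w (I : Type) (s : seq I) (c : I -> R) (n : I -> 'rV[R]_d) :
  xidot xi w (\sum_(i <- s) c i *: n i) = \sum_(i <- s) c i * xidot xi w (n i).
Proof.
rewrite /xidot; under [RHS]eq_bigr do rewrite mulr_sumr.
rewrite [RHS]exchange_big; apply: eq_bigr => al _ /=.
by rewrite summxE mulr_suml; apply: eq_bigr => i _; rewrite mxE mulrA.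
Qed.

(** The quantity to be estimated: what the flux through one interface adds to
    the flux of the state of [K] alone. *)
Definition gap K L v w : 'rV[R]_m := G K L v w - fdot f v (nrm K L).

Lemma sum_sigma_gap K v (w : cell -> 'rV[R]_m) : Th K ->
  \sum_(L <- nb K) sigma K L *: gap K L v (w L) = \sum_(L <- nb K) sigma K L *: G K L v (w L).
Proof.
move=> TK; under eq_bigr do rewrite scalerBr.
rewrite sumrB -fdot_sum (sum_sigma_normal h0 a0 mesh TK).
by rewrite [fdot f v 0]big1 ?subr0// => al _; rewrite mxE scale0r.
Qed.

Lemma vol_gt0 K : Th K -> 0 < vol K.
Proof.
move=> TK; apply: lt_le_trans (cell_vol h0 a0 mesh TK).
by rewrite mulr_gt0// exprn_gt0.
Qed.

(** As the unit normals weighted by area sum to zero, the update only involves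
    the gaps. *)
Lemma update n K : Th K -> u n.+1 K = u n K -
  (dt / vol K) *: \sum_(L <- nb K) sigma K L *: gap K L (u n K) (u n L).
Proof.
move=> TK; have [_ /(_ n K TK)] := scheme; have V0 := vol_gt0 TK.
rewrite fsum_elements; last exact: (finite_neighbours h0 a0 mesh TK).
rewrite -(sum_sigma_gap _ _ TK) -/(vol K) => /eqP; rewrite addr_eq0 => /eqP E.
have : (dt / vol K) *: ((vol K / dt) *: (u n.+1 K - u n K)) = u n.+1 K - u n K.
  by rewrite scalerA mulrA divfK ?lt0r_neq0// divff ?scale1r// lt0r_neq0.
by rewrite E scalerN => /eqP; rewrite eq_sym subr_eq addrC => /eqP.
Qed.

Lemma perimeter K : Th K -> \sum_(L <- nb K) sigma K L <= h ^+ d.-1 / a.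
Proof.
move=> TK; rewrite -fsum_elements; first exact: (mesh_perimeter mesh).
exact: (finite_neighbours h0 a0 mesh TK).
Qed.

Lemma sum_sigma_ge0 K : 0 <= \sum_(L <- nb K) sigma K L.
Proof. by rewrite sumr_ge0// => L _; exact: sigma_ge0. Qed.

(** The form in which the restriction on the time step is used: the ratio
    of perimeter to volume of a cell is at most of order [1 / h]. *)
Lemma courant K : Th K ->
  dt / vol K * (\sum_(L <- nb K) sigma K L) <= beta0 / beta1 * (1 - zeta) / lam.
Proof.
move=> TK; have V0 := vol_gt0 TK; have b1 : 0 < beta1 by exact: lt_le_trans beta01.
have hd : h ^+ d = h * h ^+ d.-1 by rewrite -exprS prednK.
have h1 : 0 < h ^+ d.-1 by rewrite exprn_gt0.
have ah : 0 < a * h ^+ d by rewrite mulr_gt0// exprn_gt0.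
apply: (@le_trans _ _ (dt / (a * h ^+ d) * (h ^+ d.-1 / a))).
  apply: ler_pM; [|exact: sum_sigma_ge0| |exact: perimeter].
    by rewrite divr_ge0// ltW.
  by rewrite ler_wpM2l ?(ltW dt0)// lef_pV2 ?posrE// (cell_vol h0 a0 mesh).
have -> : dt / (a * h ^+ d) * (h ^+ d.-1 / a) = dt / (a ^+ 2 * h).
  by rewrite hd; field; rewrite !lt0r_neq0.
rewrite ler_pdivrMr; last by rewrite mulr_gt0// exprn_gt0.
apply: le_trans cfl _; rewrite le_eqVlt; apply/orP; left; apply/eqP.
by field; rewrite !lt0r_neq0.
Qed.

Lemma cell_average_Omega K : Th K -> Omega (cell_average u0 K).
Proof.
move=> TK; apply: (@mean_in_convex _ _ R (lebesgue R d) m (row_of_tuple @^-1` K)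
  (fun t => u0 (row_of_tuple t))) => //.
- exact: (cell_Borel mesh TK).
- exact: (cell_vol_gt0 h0 a0 mesh TK).
- rewrite -ge0_fin_numE; last exact: volume_ge0.
  exact/volume_fin/(cell_bounded h0 a0 mesh TK).
- by move=> i; apply: measurable_funTS.
Qed.

(** The update is a convex combination of [u n K] and of upwind states. These
    belong to [Omega] for the parameter [lam / (1 - zeta)], larger than [lam]. *)
Lemma invariant n K : Th K -> Omega (u n K).
Proof.
elim: n K => [|n IH] K TK.
  by have [E _] := scheme; rewrite (E K TK); exact: cell_average_Omega.
have V0 := vol_gt0 TK; have b1 : 0 < beta1 by exact: lt_le_trans beta01.
have z1 : 0 < 1 - zeta by rewrite subr_gt0.
pose mu := lam / (1 - zeta).
have mu0 : 0 < mu by exact: divr_gt0.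
have lam_mu : lam < mu by rewrite ltr_pdivlMr// gtr_pMr// gtrBl.
pose c L := dt / vol K * sigma K L * mu.
have c0 L : 0 <= c L by rewrite !mulr_ge0 ?sigma_ge0 ?invr_ge0// ltW.
have c1 : \sum_(L <- nb K) c L <= 1.
  rewrite -mulr_suml -mulr_sumr; apply: (@le_trans _ _ (beta0 / beta1)).
    rewrite -ler_pdivlMr//; apply: le_trans (courant TK) _.
    by rewrite /mu le_eqVlt; apply/orP; left; apply/eqP; field; rewrite !lt0r_neq0.
  by rewrite ler_pdivrMr// mul1r.
pose W (o : option cell) := if o is Some L then c L else 1 - \sum_(L <- nb K) c L.
pose X (o : option cell) := if o is Some L
  then upwind_state nrm f G mu K L (u n K) (u n L) else u n K.
have W1 : \sum_(o <- None :: [seq Some L | L <- nb K]) W o = 1.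
  by rewrite big_cons big_map /= subrK.
have := @convex_comb R m _ (None :: [seq Some L | L <- nb K]) W X Omega cO.
rewrite W1 invr1 scale1r ltr01 => /(_ _ isT)/wrap[].
  move=> o; rewrite inE => /predU1P[->|/mapP[L /(mem_nb L TK) KL ->]] /=.
    by split; [rewrite subr_ge0|exact: IH].
  split=> //; have [TL _ _] := KL.
  by apply: (flux_invariant flux TK KL lam_mu); exact: IH.
congr (Omega _); rewrite (update n TK) big_cons big_map /= scalerBl scale1r.
rewrite -addrA; congr (_ + _); rewrite scaler_suml scaler_sumr -sumrN -sumrN -big_split.
apply: eq_bigr => L _ /=; rewrite /c /upwind_state -/(gap K L _ _).
rewrite scalerBr scalerA addrA addNr add0r; congr (- _).
by rewrite !scalerA; congr (_ *: _); field; rewrite !lt0r_neq0.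
Qed.

(** The upwind state for [lam] is a limit of those for larger parameters. *)
Lemma upwind_closure K L v w : Th K -> neighbours Th K L -> Omega v -> Omega w ->
  closure Omega (upwind_state nrm f G lam K L v w).
Proof.
move=> TK KL Ov Ow; apply/closure_enormP => e e0.
set g := gap K L v w; have g1 : 0 < enorm g + 1 by rewrite ltr_wpDl ?enorm_ge0.
pose s := Num.min (1 / 2) (e * lam / (enorm g + 1)).
have s0 : 0 < s by rewrite lt_min !divr_gt0// mulr_gt0.
have s1 : s <= 1 / 2 by rewrite ge_min lexx.
have s1' : 0 < 1 - s by lra.
have mu_gt : lam < lam / (1 - s).
  by rewrite ltr_pdivlMr// gtr_pMr// gtrBl.
exists (upwind_state nrm f G (lam / (1 - s)) K L v w).
  exact: (flux_invariant flux TK KL mu_gt).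
have -> : upwind_state nrm f G (lam / (1 - s)) K L v w - upwind_state nrm f G lam K L v w =
    (s / lam) *: g.
  apply/rowP => i; rewrite !mxE; field; rewrite !lt0r_neq0//.
rewrite enormZ ger0_norm ?divr_ge0// ?ltW// mulrAC ltr_pdivrMr//.
have : s * (enorm g + 1) <= e * lam by rewrite -ler_pdivlMr// ge_min lexx orbT.
by rewrite mulrDr mulr1; lra.
Qed.

(** The state of the entropy inequality is [v - g / lam], where [g] is the gap:
    by strong convexity of [eta], the second order term of the expansion at [v]
    is a gain. *)
Lemma interface_entropy (b : R) K L v w :
  (forall v w, closure Omega v -> b * dotp w w <= dotp (w *m hessian eta v) w) ->
  Th K -> neighbours Th K L -> Omega v -> Omega w ->
  Xi K L v w - xidot xi v (nrm K L) <=
    'D_(gap K L v w) eta v - b / (2 * lam) * enorm (gap K L v w) ^+ 2.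
Proof.
move=> Hb TK KL Ov Ow; set g := gap K L v w; set p := upwind_state nrm f G lam K L v w.
apply: le_trans (entropy_flux_inequality entropy TK KL (lexx lam) Ov Ow) _.
rewrite -/p; have cv : closure Omega v by exact: subset_closure.
have cp : closure Omega p by exact: upwind_closure.
have [x cx ->] := taylor_lagrange cO eta_C2 cv cp.
have -> : p - v = - lam^-1 *: g by rewrite /p /upwind_state addrC addKr scaleNr.
have dv := eta_differentiable eta_C2 cv.
rewrite !deriveE// linearZ /=.
have := Hb x (- lam^-1 *: g) cx; set H := dotp (_ *m _) _.
rewrite dotpZl dotpZr -sqr_enorm => Hx.
have : - lam * (H / 2) <= - lam * ((b * (- lam^-1 * (- lam^-1 * enorm g ^+ 2))) / 2).
  by rewrite ler_nM2l ?oppr_lt0// ler_pM2r.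
rewrite (_ : - lam * (b * _ / 2) = - (b / (2 * lam) * enorm g ^+ 2)); last first.
  by field; rewrite lt0r_neq0.
have -> : - lam * (eta v + (- lam^-1) *: 'd eta v g + H / 2 - eta v) =
    'd eta v g + - lam * (H / 2).
  by rewrite /GRing.scale /=; field; rewrite lt0r_neq0.
by rewrite lerD2l.
Qed.

(** The expansion of [eta (u n.+1 K)] at [u n K] has a second order loss. By
    Cauchy-Schwarz and the restriction on the time step it is at most the
    fraction [1 - zeta] of the second order gains on the interfaces, while the
    first order terms cancel. *)
Lemma cell_entropy (b : R) n K :
  beta0 <= b ->
  (forall v w, closure Omega v -> b * dotp w w <= dotp (w *m hessian eta v) w) ->
  (forall v w, closure Omega v -> dotp (w *m hessian eta v) w <= beta1 * dotp w w) ->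
  Th K ->
  zeta * b / (2 * lam) * (dt * \sum_(L <- nb K) sigma K L * enorm (gap K L (u n K) (u n L)) ^+ 2)
  <= vol K * (eta (u n K) - eta (u n.+1 K)) - dt * \sum_(L <- nb K) sigma K L * Xi K L (u n K) (u n L).
Proof.
move=> b0 Hb Hb1 TK; have V0 := vol_gt0 TK.
have b1 : 0 < beta1 by exact: lt_le_trans beta01.
pose g L := gap K L (u n K) (u n L).
pose S := \sum_(L <- nb K) sigma K L *: g L.
pose Q := \sum_(L <- nb K) sigma K L * enorm (g L) ^+ 2.
have Q0 : 0 <= Q by rewrite sumr_ge0// => L _; rewrite mulr_ge0 ?sigma_ge0// sqr_ge0.
have cv : closure Omega (u n K) by exact/subset_closure/invariant.
have cv' : closure Omega (u n.+1 K) by exact/subset_closure/invariant.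
have dv := eta_differentiable eta_C2 cv.
have flux_part : \sum_(L <- nb K) sigma K L * Xi K L (u n K) (u n L) <=
    'D_S eta (u n K) - b / (2 * lam) * Q.
  have -> : \sum_(L <- nb K) sigma K L * Xi K L (u n K) (u n L) =
      \sum_(L <- nb K) sigma K L * (Xi K L (u n K) (u n L) - xidot xi (u n K) (nrm K L)).
    under [RHS]eq_bigr do rewrite mulrBr.
    rewrite sumrB -xidot_sum (sum_sigma_normal h0 a0 mesh TK).
    by rewrite [xidot xi _ 0]big1 ?subr0// => al _; rewrite mxE mul0r.
  have -> : 'D_S eta (u n K) - b / (2 * lam) * Q = \sum_(L <- nb K) sigma K L *
      ('D_(g L) eta (u n K) - b / (2 * lam) * enorm (g L) ^+ 2).
    rewrite deriveE// linear_sum /Q mulr_sumr -sumrB; apply: eq_bigr => L _.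
    by rewrite linearZ /= deriveE// /GRing.scale /=; ring.
  rewrite big_seq [leRHS]big_seq; apply: ler_sum => L /(mem_nb L TK) KL.
  rewrite ler_wpM2l ?sigma_ge0//; have [TL _ _] := KL.
  by apply: interface_entropy => //; exact: invariant.
have time_part : vol K * (eta (u n.+1 K) - eta (u n K)) <=
    - dt * 'D_S eta (u n K) + dt * (beta0 * (1 - zeta) / (2 * lam)) * Q.
  have [x cx ->] := taylor_lagrange cO eta_C2 cv cv'.
  have -> : u n.+1 K - u n K = - (dt / vol K) *: S.
    by rewrite (update n TK) addrC addKr scaleNr.
  have := Hb1 x (- (dt / vol K) *: S) cx; set H := dotp (_ *m _) _.
  rewrite dotpZl dotpZr -sqr_enorm => Hx; rewrite !deriveE// linearZ /GRing.scale/=.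
  set D := 'd eta (u n K) S.
  have S_le : enorm S ^+ 2 <= (\sum_(L <- nb K) sigma K L) * Q.
    apply: le_trans (@weighted_cauchy_schwarz _ _ (nb K) (sigma K) (fun L => enorm (g L)) _).
      rewrite lerXn2r ?nnegrE ?enorm_ge0//.
        by rewrite sumr_ge0// => L _; rewrite mulr_ge0 ?sigma_ge0// enorm_ge0.
      apply: le_trans (ler_enorm_sum _ _) _; apply: ler_sum => L _.
      by rewrite enormZ ger0_norm ?sigma_ge0.
    by move=> L _; exact: sigma_ge0.
  have step : dt / vol K * enorm S ^+ 2 <= beta0 / beta1 * (1 - zeta) / lam * Q.
    apply: (@le_trans _ _ (dt / vol K * ((\sum_(L <- nb K) sigma K L) * Q))).
      by rewrite ler_wpM2l// divr_ge0// ltW.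
    by rewrite mulrA ler_wpM2r// courant.
  have -> : vol K * (eta (u n K) + - (dt / vol K) * D + H / 2 - eta (u n K)) =
      - dt * D + vol K * (H / 2) by field; rewrite lt0r_neq0.
  rewrite lerD2l; apply: (@le_trans _ _ (dt * (beta1 / 2) * (dt / vol K * enorm S ^+ 2))).
    rewrite (_ : dt * _ * _ = vol K * ((beta1 * (- (dt / vol K) * (- (dt / vol K) * enorm S ^+ 2))) / 2)); last first.
      by field; rewrite lt0r_neq0.
    by rewrite ler_pM2l// ler_pM2r.
  rewrite (_ : dt * (beta0 * _ / _) * Q = dt * (beta1 / 2) * (beta0 / beta1 * (1 - zeta) / lam * Q)); last first.
    by field; rewrite !lt0r_neq0.
  by rewrite ler_wpM2l// mulr_ge0 ?divr_ge0// ltW.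
have : dt * (\sum_(L <- nb K) sigma K L * Xi K L (u n K) (u n L)) <=
    dt * ('D_S eta (u n K) - b / (2 * lam) * Q) by rewrite ler_pM2l.
have : dt * (beta0 * (1 - zeta) / (2 * lam)) * Q <= dt * (b * (1 - zeta) / (2 * lam)) * Q.
  rewrite ler_wpM2r// ler_pM2l// ler_pM2r ?invr_gt0 ?mulr_gt0//.
  by rewrite ler_wpM2r// subr_ge0 ltW.
have -> : dt * (b * (1 - zeta) / (2 * lam)) * Q = dt * (b / (2 * lam) * Q) - zeta * b / (2 * lam) * (dt * Q).
  by field; rewrite lt0r_neq0.
rewrite -/Q; move: time_part; rewrite !mulrBr; lra.
Qed.

End Scheme.

(** * Summation over space and time *)

Lemma ler_sum_sub (R : realType) (I : eqType) (s t : seq I) (F : I -> R) :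
  uniq s -> {subset s <= t} -> (forall i, i \in t -> 0 <= F i) ->
  \sum_(i <- s) F i <= \sum_(i <- t) F i.
Proof.
elim: s t => [|i s IH] t /=; first by move=> _ _ F0; rewrite big_nil big_seq sumr_ge0.
move=> /andP[nis us] st F0; have it : i \in t by apply: st; rewrite mem_head.
rewrite big_cons (perm_big _ (perm_to_rem it)) big_cons lerD2l; apply: IH => //.
  move=> j js; have := st j; rewrite (perm_mem (perm_to_rem it)) !inE js orbT.
  by move=> /(_ isT)/predU1P[ji|//]; rewrite -ji js in nis.
by move=> j /mem_rem; exact: F0.
Qed.

Section Dissipation.
Context {R : realType} {m d : nat}.
Local Notation cell := (set 'rV[R]_d).
Variables (Omega : set 'rV[R]_m) (eta : 'rV[R]_m -> R) (xi : 'I_d -> 'rV[R]_m -> R)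
  (f : 'I_d -> 'rV[R]_m -> 'rV[R]_m) (Th : set cell) (nrm : cell -> cell -> 'rV[R]_d)
  (G : cell -> cell -> 'rV[R]_m -> 'rV[R]_m -> 'rV[R]_m)
  (Xi : cell -> cell -> 'rV[R]_m -> 'rV[R]_m -> R)
  (h a lam dt zeta beta0 beta1 : R)
  (u0 : 'rV[R]_d -> 'rV[R]_m) (u : nat -> cell -> 'rV[R]_m).
Hypotheses (d0 : (0 < d)%N) (cO : convex Omega) (bO : bounded_set Omega)
  (eta_C2 : C2_closure Omega eta) (eta_ge0 : forall u, closure Omega u -> 0 <= eta u)
  (u0_Omega : forall x, Omega (u0 x))
  (u0_measurable : forall i, measurable_fun [set: d.-tuple R]
     (fun t => u0 (row_of_tuple t) 0 i))
  (a0 : 0 < a) (zeta0 : 0 < zeta) (zeta1 : zeta < 1) (lam0 : 0 < lam)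
  (beta0_gt0 : 0 < beta0) (beta01 : beta0 <= beta1)
  (h0 : 0 < h) (mesh : admissible_mesh Th nrm h a)
  (flux : admissible_flux Th nrm Omega f eta xi G lam)
  (entropy : numerical_entropy_flux Th nrm Omega f eta xi G lam Xi)
  (dt0 : 0 < dt)
  (cfl : dt <= beta0 / beta1 * (a ^+ 2 / lam) * (1 - zeta) * h)
  (scheme : scheme_solution Th G dt u0 u).
Implicit Types (K L : cell) (v w : 'rV[R]_m).
Variables (r Meta : R) (Mxi : 'I_d -> R).
Hypotheses (r0 : 0 < r) (h1 : h <= 1) (Meta0 : 0 <= Meta)
  (eta_le : forall u, closure Omega u -> `|eta u| <= Meta)
  (xi_le : forall al u, closure Omega u -> `|xi al u| <= Mxi al).

Local Notation nb K := (elements (neighbours Th K)).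
Local Notation gap := (gap f nrm G).

Lemma u_Omega n K : Th K -> Omega (u n K).
Proof.
exact: (invariant d0 cO bO u0_Omega u0_measurable a0 zeta0 zeta1 lam0 beta0_gt0 beta01
  h0 mesh flux dt0 cfl scheme n).
Qed.

(** The entropy inequality bounds the flux from above once [eta >= 0] is used at
    the upwind state; antisymmetry turns this into a bound from below. *)
Lemma entropy_flux_le K L v w : Th K -> neighbours Th K L -> Omega v -> Omega w ->
  Xi K L v w <= \sum_al Mxi al + lam * Meta.
Proof.
move=> TK KL Ov Ow; have cv : closure Omega v by exact: subset_closure.
have := entropy_flux_inequality entropy TK KL (lexx lam) Ov Ow.
set p := upwind_state _ _ _ _ _ _ _ _.
have p0 : 0 <= eta p by apply: eta_ge0; apply: (upwind_closure lam0 flux).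
have : lam * eta v <= lam * Meta.
  by rewrite ler_pM2l//; apply: le_trans (ler_norm _) (eta_le cv).
have : 0 <= lam * eta p by rewrite mulr_ge0// ltW.
have : xidot xi v (nrm K L) <= \sum_al Mxi al.
  apply: ler_sum => al _; apply: le_trans (ler_norm _) _; rewrite normrM.
  rewrite -[leRHS]mul1r; apply: ler_pM => //; last exact: xi_le.
  by apply: le_trans (ler_coord_enorm _ _) _; rewrite (enorm_nrm mesh TK KL).
rewrite mulrBr mulNr; lra.
Qed.

Definition entropy_flux_bound : R := \sum_al Mxi al + lam * Meta.

Lemma entropy_flux_bounded K L v w : Th K -> neighbours Th K L -> Omega v -> Omega w ->
  `|Xi K L v w| <= entropy_flux_bound.
Proof.
move=> TK KL Ov Ow; rewrite ler_norml entropy_flux_le// andbT lerNl.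
have [TL _ _] := KL.
rewrite (entropy_flux_conservative entropy TK KL Ov Ow) opprK.
exact: (entropy_flux_le TL (neighboursC TK KL) Ow Ov).
Qed.

(** A cutoff in space, sampled at one point per cell: it is 1 on the cells of
    the ball of radius [r], vanishes at distance 1 from it, and varies by
    [O(h)] between neighbours. The factor [h] gained in the summation by parts
    of the entropy fluxes compensates the number of interfaces. *)
Definition sample K : 'rV[R]_d := xget 0 K.

Definition cutoff K : R := Num.max 0 (Num.min 1 (r + 1 - enorm (sample K))).

Lemma sample_in K : Th K -> K (sample K).
Proof. by move=> /(cell_nonempty h0 a0 mesh)[x Kx]; exact: (@xgetPex _ 0 K (ex_intro _ x Kx)). Qed.

Lemma cutoff_ge0 K : 0 <= cutoff K.
Proof. by rewrite le_max lexx. Qed.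

Lemma cutoff_le1 K : cutoff K <= 1.
Proof. by rewrite ge_max ler01 ge_min lexx. Qed.

Lemma cutoff_in K : cells_in Th r K -> cutoff K = 1.
Proof.
move=> [TK /(_ _ (sample_in TK))]; rewrite /eball/= => Kr.
by rewrite /cutoff min_l ?max_r//; lra.
Qed.

Lemma cutoff_neq0 K : cutoff K != 0 -> enorm (sample K) < r + 1.
Proof.
apply: contraNT; rewrite -leNgt => rK; rewrite /cutoff max_l//.
by rewrite ge_min; apply/orP; right; lra.
Qed.

Lemma cutoff_lip K L : Th K -> neighbours Th K L -> `|cutoff K - cutoff L| <= 2 * h.
Proof.
move=> TK KL; have [TL _ _] := KL; have [x [Kx Lx]] := neighbours_touch KL.
have K1 := cell_diam_closure mesh TK (subset_closure (sample_in TK)) Kx.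
have L1 := cell_diam_closure mesh TL Lx (subset_closure (sample_in TL)).
have := ler_enorm_distD x (sample K) (sample L).
have := ler_enormB (sample K) (sample L); have := ler_enormB (sample L) (sample K).
rewrite (enormB (sample L) (sample K)) /cutoff ler_norml.
set k := enorm (sample K); set l := enorm (sample L); set e := enorm _.
move=> kl lk et; rewrite /Num.max /Num.min.
by do ![case: ifPn => //]; rewrite -?leNgt; move=> *; apply/andP; split; lra.
Qed.

(** Wide enough to contain the cells where the cutoff is nonzero and their
    neighbours, whatever [h <= 1]. *)
Definition region : seq cell := elements (cells_near Th (r + 4)).

Lemma mem_region K : (K \in region) <-> cells_near Th (r + 4) K.
Proof. exact: (mem_near h0 a0 mesh). Qed.

Lemma region_cell K : K \in region -> Th K.
Proof. by move=> /mem_region[]. Qed.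

Lemma cutoff_region K : Th K -> cutoff K != 0 -> K \in region.
Proof.
move=> TK /cutoff_neq0 Kr; apply/mem_region; split => //.
exists (sample K); last by move: Kr; lra.
by apply: subset_closure; exact: sample_in.
Qed.

Lemma cutoff_region_nb K L : Th K -> cutoff K != 0 -> neighbours Th K L -> L \in region.
Proof.
move=> TK /cutoff_neq0 Kr KL; have [TL _ _] := KL; have [x [Kx Lx]] := neighbours_touch KL.
apply/mem_region; split => //; exists x => //.
have := cell_diam_closure mesh TK Kx (subset_closure (sample_in TK)).
by have := ler_enormB x (sample K); move: Kr h1; lra.
Qed.

Definition region_volume : R := (2 * (r + 5)) ^+ d.

Lemma region_enorm K : K \in region -> Th K /\ forall x, K x -> enorm x <= r + 5.
Proof.
move=> Kr; have nK := proj1 (mem_region K) Kr; split; first exact: region_cell.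
by move=> x /subset_closure/(cells_near_enorm mesh nK); move: h1; lra.
Qed.

Lemma sum_vol_region : \sum_(K <- region) vol K <= region_volume.
Proof.
by apply: (sum_vol_cells h0 a0 mesh (elements_uniq _)); [move: r0; lra|exact: region_enorm].
Qed.

(** There are [O(h ^ - d)] cells, each of perimeter [O(h ^ (d - 1))]. *)
Lemma region_perimeter : h * (\sum_(K <- region) \sum_(L <- nb K) sigma K L) <=
  region_volume / a ^+ 2.
Proof.
apply: (@le_trans _ _ (h * ((size region)%:R * (h ^+ d.-1 / a)))).
  rewrite ler_pM2l// mulr_natl -iter_addr_0 -[size region](count_predT region) -big_const_seq.
  by rewrite big_seq [leRHS]big_seq; apply: ler_sum => K /region_cell; exact: (perimeter a0 h0 mesh).
have := @card_cells _ _ _ _ _ _ h0 a0 mesh region (r + 5) (elements_uniq _) _ region_enorm.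
rewrite -/region_volume => /(_ _)/wrap[|card]; first by move: r0; lra.
rewrite ler_pdivlMr ?exprn_gt0//; apply: le_trans card.
have -> : h ^+ d = h * h ^+ d.-1 by rewrite -exprS prednK.
by rewrite le_eqVlt; apply/orP; left; apply/eqP; field; rewrite lt0r_neq0.
Qed.

Lemma sum_nb_region K (F : cell -> R) : Th K -> cutoff K != 0 ->
  \sum_(L <- nb K) F L = \sum_(L <- region) if `[< neighbours Th K L >] then F L else 0.
Proof.
move=> TK cK; rewrite -big_mkcond -big_filter; apply: perm_big; apply: uniq_perm.
- exact: elements_uniq.
- exact/filter_uniq/elements_uniq.
move=> L; rewrite mem_filter; apply/idP/andP => [/(mem_nb a0 h0 mesh L TK) KL|[/asboolP KL _]].
  by split; [exact/asboolP|exact: cutoff_region_nb KL].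
exact/(mem_nb a0 h0 mesh L TK).
Qed.

(** Entropy fluxes are antisymmetric, so only differences of the cutoff remain
    after a summation by parts, and these are [O(h)]. *)
Lemma sum_entropy_flux n :
  `|\sum_(K <- region) cutoff K * \sum_(L <- nb K) sigma K L * Xi K L (u n K) (u n L)|
  <= entropy_flux_bound * (region_volume / a ^+ 2).
Proof.
pose s K L := if `[< neighbours Th K L >] then sigma K L * Xi K L (u n K) (u n L) else 0.
have sC K L : Th K -> Th L -> s K L = - s L K.
  move=> TK TL; rewrite /s; case: asboolP => KL; case: asboolP => LK; rewrite ?oppr0//.
  - rewrite (entropy_flux_conservative entropy TK KL) ?mulrN 1?sigmaC//; exact: u_Omega.
  - by case: LK; exact: neighboursC.
  - by case: KL; exact: neighboursC.
set F := \sum_(K <- region) _.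
have FE : F = \sum_(K <- region) \sum_(L <- region) cutoff K * s K L.
  rewrite /F big_seq [RHS]big_seq; apply: eq_bigr => K /region_cell TK.
  have [->|cK] := eqVneq (cutoff K) 0; first by rewrite mul0r big1// => L _; rewrite mul0r.
  by rewrite sum_nb_region// mulr_sumr.
have FE' : F = - \sum_(K <- region) \sum_(L <- region) cutoff L * s K L.
  rewrite FE exchange_big -sumrN big_seq [RHS]big_seq; apply: eq_bigr => L /region_cell TL.
  rewrite -sumrN big_seq [RHS]big_seq; apply: eq_bigr => K /region_cell TK /=.
  by rewrite sC// mulrN.
have F2 : 2 * F = \sum_(K <- region) \sum_(L <- region) (cutoff K - cutoff L) * s K L.
  have -> : 2 * F = F + F by ring.
  rewrite {1}FE FE' -sumrB; apply: eq_bigr => K _.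
  by rewrite -sumrB; apply: eq_bigr => L _; rewrite mulrBl.
have C0 : 0 <= entropy_flux_bound.
  rewrite addr_ge0 ?mulr_ge0 ?(ltW lam0)// sumr_ge0// => al _.
  have [x cx] : closure Omega !=set0 by exists (u0 0); exact: subset_closure.
  exact: le_trans (normr_ge0 _) (xi_le al cx).
suff : 2 * `|F| <= 2 * (entropy_flux_bound * (h * \sum_(K <- region) \sum_(L <- nb K) sigma K L)).
  rewrite ler_pM2l// => /le_trans; apply; rewrite ler_wpM2l//.
  exact: region_perimeter.
rewrite -[X in X * `|_|]ger0_norm// -normrM F2.
apply: le_trans (ler_norm_sum _ _ _) _; rewrite !mulr_sumr big_seq [leRHS]big_seq.
apply: ler_sum => K /region_cell TK; apply: le_trans (ler_norm_sum _ _ _) _.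
rewrite !mulr_sumr.
apply: (@le_trans _ _ (\sum_(L <- region | L \in nb K) 2 * (entropy_flux_bound * (h * sigma K L)))).
  rewrite [leRHS]big_mkcond; apply: ler_sum => L _; rewrite /s.
  case: asboolP => KL; last by rewrite mulr0 normr0; case: ifP => // _; rewrite !mulr_ge0 ?sigma_ge0// ltW.
  rewrite (proj2 (mem_nb a0 h0 mesh L TK) KL) !normrM (ger0_norm (sigma_ge0 _ _)).
  have [TL _ _] := KL.
  have X1 := entropy_flux_bounded TK KL (u_Omega n TK) (u_Omega n TL).
  have := ler_pM (normr_ge0 _) (mulr_ge0 (sigma_ge0 K L) (normr_ge0 _)) (cutoff_lip TK KL)
    (ler_wpM2l (sigma_ge0 K L) X1).
  by move/le_trans; apply; rewrite le_eqVlt; apply/orP; left; apply/eqP; ring.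
rewrite -big_filter; apply: ler_sum_sub.
- exact/filter_uniq/elements_uniq.
- by move=> L; rewrite mem_filter => /andP[].
- by move=> L _; rewrite !mulr_ge0 ?sigma_ge0// ltW.
Qed.

(** The entropy of the region at time 0 is bounded, it remains nonnegative, and
    what flows out of the region is controlled by the previous bound. *)
Lemma dissipation (b : R) N :
  beta0 <= b ->
  (forall v w, closure Omega v -> b * dotp w w <= dotp (w *m hessian eta v) w) ->
  (forall v w, closure Omega v -> dotp (w *m hessian eta v) w <= beta1 * dotp w w) ->
  zeta * b / (2 * lam) * \sum_(0 <= n < N) dt * \sum_(K <- region) cutoff K *
     \sum_(L <- nb K) sigma K L * enorm (gap K L (u n K) (u n L)) ^+ 2
  <= Meta * region_volume + N%:R * dt * (entropy_flux_bound * (region_volume / a ^+ 2)).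
Proof.
move=> b0 Hb Hb1.
have cu n K : Th K -> closure Omega (u n K) by move=> TK; exact/subset_closure/u_Omega.
pose Z n := \sum_(K <- region) cutoff K * (vol K * eta (u n K)).
set X := entropy_flux_bound * _.
have step n : zeta * b / (2 * lam) * (dt * \sum_(K <- region) cutoff K *
     \sum_(L <- nb K) sigma K L * enorm (gap K L (u n K) (u n L)) ^+ 2) <=
     (Z n - Z n.+1) + dt * X.
  apply: (@le_trans _ _ (\sum_(K <- region) cutoff K * (vol K * (eta (u n K) - eta (u n.+1 K)) -
      dt * \sum_(L <- nb K) sigma K L * Xi K L (u n K) (u n L)))).
    rewrite !mulr_sumr big_seq [leRHS]big_seq; apply: ler_sum => K /region_cell TK.
    rewrite (_ : _ / _ * _ = cutoff K * (zeta * b / (2 * lam) * (dt *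
        \sum_(L <- nb K) sigma K L * enorm (gap K L (u n K) (u n L)) ^+ 2))); last by ring.
    rewrite ler_wpM2l ?cutoff_ge0//.
    exact: (cell_entropy d0 cO bO eta_C2 u0_Omega u0_measurable a0 zeta0 zeta1 lam0
      beta0_gt0 beta01 h0 mesh flux entropy dt0 cfl scheme n b0 Hb Hb1 TK).
  have -> : \sum_(K <- region) cutoff K * (vol K * (eta (u n K) - eta (u n.+1 K)) -
      dt * \sum_(L <- nb K) sigma K L * Xi K L (u n K) (u n L)) =
      (Z n - Z n.+1) - dt * \sum_(K <- region) cutoff K * \sum_(L <- nb K) sigma K L * Xi K L (u n K) (u n L).
    rewrite /Z mulr_sumr -!sumrB; apply: eq_bigr => K _; ring.
  rewrite lerD2l -mulrN ler_pM2l//; apply: le_trans (ler_norm _) _.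
  by rewrite normrN; exact: sum_entropy_flux.
have Z_ge0 n : 0 <= Z n.
  rewrite /Z big_seq sumr_ge0// => K /region_cell TK.
  by rewrite mulr_ge0 ?cutoff_ge0// mulr_ge0 ?vol_ge0// eta_ge0//; exact: cu.
have Z0 : Z 0%N <= Meta * region_volume.
  apply: (@le_trans _ _ (Meta * \sum_(K <- region) vol K)); last first.
    by rewrite ler_wpM2l// sum_vol_region.
  rewrite mulr_sumr /Z big_seq [leRHS]big_seq; apply: ler_sum => K /region_cell TK.
  rewrite -[leRHS]mul1r; apply: ler_pM; rewrite ?cutoff_ge0 ?cutoff_le1//.
    by rewrite mulr_ge0 ?vol_ge0// eta_ge0//; exact: cu.
  rewrite mulrC ler_wpM2r ?vol_ge0//; exact: le_trans (ler_norm _) (eta_le (cu _ _ TK)).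
rewrite mulr_sumr; apply: (@le_trans _ _ (\sum_(0 <= n < N) ((Z n - Z n.+1) + dt * X))).
  exact: ler_sum.
rewrite big_split /=; apply: lerD; last by rewrite sumr_const_nat subn0 -mulrA mulr_natl.
rewrite (eq_bigr (fun n => - (Z n.+1 - Z n))); last by move=> n _; rewrite opprB.
rewrite sumrN telescope_sumr// opprB.
by have := Z_ge0 N; lra.
Qed.

End Dissipation.

(** * The weak total variation estimate *)

Unset Implicit Arguments.

Theorem corollary2p5 (R : realType) (m d : nat) (hm : (0 < m)%N) (hd : (0 < d)%N)
  (Omega : set 'rV[R]_m) (eta : 'rV[R]_m -> R) (xi : 'I_d -> 'rV[R]_m -> R)
  (u0 : 'rV[R]_d -> 'rV[R]_m) (T r a zeta lamstar : R)
  (Omega_convex : convex_set Omega)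
  (Omega_bounded : bounded_set Omega)
  (eta_C2 : C2_closure Omega eta)
  (eta_ge0 : forall u, closure Omega u -> 0 <= eta u)
  (xi_C2 : forall al, C2_closure Omega (xi al))
  (u0_Omega : forall x, Omega (u0 x))
  (u0_measurable : forall i, measurable_fun [set: d.-tuple R]
     (fun t => u0 (row_of_tuple t) 0 i))
  (T_gt0 : 0 < T) (r_gt0 : 0 < r) (a_gt0 : 0 < a)
  (zeta_gt0 : 0 < zeta) (zeta_lt1 : zeta < 1) (lamstar_gt0 : 0 < lamstar) :
  exists C_BV : R,
    forall (f : 'I_d -> 'rV[R]_m -> 'rV[R]_m) (beta0 beta1 : R),
      (forall al, C2_closure Omega (f al)) ->
      (forall al u, closure Omega u -> diagonalizable ('J (f al) u)) ->
      0 < beta0 -> beta0 <= beta1 ->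
      (forall u x, closure Omega u -> eigenvalue (hessian eta u) x ->
         beta0 <= x <= beta1) ->
      (forall al u v, Omega u -> 'D_v (xi al) u = 'D_('D_v (f al) u) eta u) ->
    forall (Th : set (set 'rV[R]_d))
      (nrm : set 'rV[R]_d -> set 'rV[R]_d -> 'rV[R]_d) (h : R)
      (G : set 'rV[R]_d -> set 'rV[R]_d -> 'rV[R]_m -> 'rV[R]_m -> 'rV[R]_m)
      (dt : R) (u : nat -> set 'rV[R]_d -> 'rV[R]_m)
      (E : set (set 'rV[R]_d * set 'rV[R]_d)),
      0 < h -> h <= 1 ->
      admissible_mesh Th nrm h a ->
      admissible_flux Th nrm Omega f eta xi G lamstar ->
      0 < dt ->
      dt <= beta0 / beta1 * (a ^+ 2 / lamstar) * (1 - zeta) * h ->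
      scheme_solution Th G dt u0 u ->
      oriented_interfaces Th r E ->
      \sum_(0 <= n < (Num.truncn (T / dt + 1)).+1)
         dt * (\sum_(KL \in E) sigma KL.1 KL.2 *
           enorm (G KL.1 KL.2 (u n KL.1) (u n KL.2)
                  - fdot f (u n KL.1) (nrm KL.1 KL.2)))
      <= C_BV / Num.sqrt h.
Proof.
have cO := convex_setP Omega_convex.
have [Meta Meta0 eta_le] := C2_bounded Omega_bounded eta_C2.
have /choice[Mxi xi_le] : forall al, exists M, forall v, closure Omega v -> `|xi al v| <= M.
  by move=> al; have [M _ HM] := C2_bounded Omega_bounded (xi_C2 al); exists M.
have hessian_bounds beta0 beta1 :
    (forall u x, closure Omega u -> eigenvalue (hessian eta u) x -> beta0 <= x <= beta1) ->
    (forall v w, closure Omega v -> beta0 * dotp w w <= dotp (w *m hessian eta v) w) /\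
    (forall v w, closure Omega v -> dotp (w *m hessian eta v) w <= beta1 * dotp w w).
  move=> spec; have [U OU CU] := C2_closureP eta_C2.
  split=> v w cv; [apply: form_lower_bound|apply: form_upper_bound];
    try exact: hessian_sym CU (OU _ cv).
    by move=> x /(spec _ _ cv)/andP[].
  by move=> x /(spec _ _ cv)/andP[].
(* [beta0] is chosen after the constant, so the constant is built from a
   convexity constant [b] of [eta] chosen here; if there is none, no [beta0] is
   admissible. *)
have [[b b0 Hb]|nob] := pselect (exists2 b, 0 < b & forall v w, closure Omega v ->
    b * dotp w w <= dotp (w *m hessian eta v) w); last first.
  exists 0 => f beta0 beta1 _ _ beta0_gt0 _ /hessian_bounds[Hb _].
  by exfalso; apply: nob; exists beta0.
pose B := region_volume (d := d) r.
pose X := entropy_flux_bound lamstar Meta Mxi * (B / a ^+ 2).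
pose T' := T + 2 * (a ^+ 2 / lamstar).
pose C2 := (Meta * B + T' * X) / (zeta * b / (2 * lamstar)).
exists (Num.sqrt (T' * (B / a ^+ 2) * C2)).
move=> f beta0 beta1 _ _ beta0_gt0 beta01 /hessian_bounds[Hb0 Hb1] _ Th nrm h G dt u E.
move=> h0 h1 mesh flux dt0 cfl scheme [orient _].
have [Xi entropy] := flux_entropy flux.
have a2 : 0 < a ^+ 2 by rewrite exprn_gt0.
have beta1_gt0 : 0 < beta1 by exact: lt_le_trans beta01.
have z1 : 0 < 1 - zeta by rewrite subr_gt0.
have aT : 0 < a ^+ 2 / lamstar by exact: divr_gt0.
(* the number of steps may exceed [T / dt] by 2 *)
have dt_le : dt <= a ^+ 2 / lamstar.
  apply: le_trans cfl _.
  have b01 : beta0 / beta1 <= 1 by rewrite ler_pdivrMr// mul1r.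
  rewrite mulrAC -mulrA mulrAC -[leRHS]mul1r ler_pM2r//.
  rewrite -[leRHS]mul1r mulrA -mulrA; apply: ler_pM => //.
  - by rewrite divr_ge0// ltW.
  - by rewrite mulr_ge0// ltW.
  - by rewrite mulr_ile1// ?ltW// ; lra.
set N := (Num.truncn _).+1.
have Ndt : N%:R * dt <= T'.
  have x0 : 0 <= T / dt + 1 by rewrite addr_ge0 ?divr_ge0// ltW.
  have : N%:R <= T / dt + 2 by rewrite /N -natr1; have /andP[+ _] := truncn_itv x0; lra.
  rewrite -(ler_pM2r dt0) mulrDl divfK ?lt0r_neq0//.
  by move=> /le_trans; apply; rewrite /T' lerD2l ler_pM2l.
have B0 : 0 <= B by rewrite exprn_ge0// mulr_ge0//; lra.
(* the restriction on the time step compares with [beta0], the constant with [b] *)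
pose b' := Num.max b beta0.
have Hb' v w : closure Omega v -> b' * dotp w w <= dotp (w *m hessian eta v) w.
  by rewrite /b' => cv; rewrite /Num.max; case: ifP => _; [exact: Hb0|exact: Hb].
have b'b : b <= b' by rewrite le_max lexx.
have b'0 : beta0 <= b' by rewrite le_max lexx orbT.
have diss := dissipation hd cO Omega_bounded eta_C2 eta_ge0 u0_Omega u0_measurable a_gt0
  zeta_gt0 zeta_lt1 lamstar_gt0 beta0_gt0 beta01 h0 mesh flux entropy dt0 cfl scheme
  r_gt0 h1 Meta0 eta_le xi_le N b'0 Hb' Hb1.

have lz : 0 < zeta * b / (2 * lamstar) by rewrite divr_gt0 ?mulr_gt0.
pose nb K := elements (neighbours Th K).
pose g n K L := enorm (gap f nrm G K L (u n K) (u n L)).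
have nb_fin K : Th K -> finite_set (neighbours Th K).
  exact: (finite_neighbours h0 a_gt0 mesh).
have X0 : 0 <= X.
  rewrite mulr_ge0 ?divr_ge0 ?(ltW a2)// addr_ge0 ?mulr_ge0 ?(ltW lamstar_gt0)//.
  rewrite sumr_ge0// => al _; apply: le_trans (normr_ge0 _) (xi_le al (u0 0) _).
  exact: subset_closure.
have T'0 : 0 <= T' by rewrite addr_ge0 ?(ltW T_gt0)// mulr_ge0// ltW.
have C20 : 0 <= C2.
  by rewrite divr_ge0 ?(ltW lz)// addr_ge0// mulr_ge0.
set region := region _ _ in diss.
pose inner n := \sum_(K <- region) cutoff r K * \sum_(L <- nb K) sigma K L * g n K L ^+ 2.
have inner0 n : 0 <= inner n.
  rewrite sumr_ge0// => K _; rewrite mulr_ge0 ?cutoff_ge0// sumr_ge0// => L _.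
  by rewrite mulr_ge0 ?sigma_ge0// sqr_ge0.
have D_le : \sum_(0 <= n < N) dt * inner n <= C2.
  rewrite ler_pdivlMr// mulrC; apply: (@le_trans _ _ (Meta * B + N%:R * dt * X)).
    apply: le_trans diss; rewrite ler_wpM2r//.
      by rewrite sumr_ge0// => n _; rewrite mulr_ge0// ltW.
    by rewrite ler_pM2r ?invr_gt0 ?mulr_gt0// ler_pM2l.
  by rewrite lerD2l ler_wpM2r.
have in_region K : cells_in Th r K -> K \in region.
  move=> Kr; have [TK _] := Kr; apply: (cutoff_region a_gt0 h0 mesh TK).
  by rewrite (cutoff_in a_gt0 h0 mesh Kr) oner_neq0.
pose pairs := [seq (K, L) | K <- region, L <- nb K].
have E_pairs : E `<=` [set` pairs].
  move=> [K L] /orient[/= Kr _ KL] /=; have [TK _] := Kr.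
  by apply: allpairs_f_dep; [exact: in_region|exact/(mem_nb a_gt0 h0 mesh L TK)].
have E_fin : finite_set E by apply: sub_finite_set E_pairs _; exact: finite_seq.
pose Es := elements E.
have Es_pairs : {subset Es <= pairs} by move=> p /(mem_elements _ E_fin)/E_pairs.
have Es_le (F : set 'rV[R]_d -> set 'rV[R]_d -> R) : (forall K L, 0 <= F K L) ->
    \sum_(p <- Es) F p.1 p.2 <= \sum_(K <- region) \sum_(L <- nb K) F K L.
  move=> F0; apply: (@le_trans _ _ (\sum_(p <- pairs) F p.1 p.2)).
    by apply: ler_sum_sub => //; exact: elements_uniq.
  by rewrite big_allpairs_dep.
have S1 : \sum_(0 <= n < N) dt * \sum_(p <- Es) sigma p.1 p.2 <= T' * (B / a ^+ 2) / h.
  rewrite sumr_const_nat subn0 -mulr_natl mulrA -[leRHS]mulrA; apply: ler_pM => //.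
    by rewrite mulr_ge0// ltW.
    by rewrite sumr_ge0// => p _; exact: sigma_ge0.
  rewrite ler_pdivlMr// mulrC.
  apply: le_trans (region_perimeter hd a_gt0 h0 mesh r_gt0 h1).
  by rewrite ler_pM2l//; apply: Es_le => K L; exact: sigma_ge0.
have S2 : \sum_(0 <= n < N) dt * \sum_(p <- Es) sigma p.1 p.2 * g n p.1 p.2 ^+ 2 <= C2.
  apply: le_trans D_le; apply: ler_sum => n _; rewrite ler_pM2l//.
  have -> : \sum_(p <- Es) sigma p.1 p.2 * g n p.1 p.2 ^+ 2 =
      \sum_(p <- Es) cutoff r p.1 * (sigma p.1 p.2 * g n p.1 p.2 ^+ 2).
    rewrite big_seq [RHS]big_seq; apply: eq_bigr => p /(mem_elements _ E_fin)/orient[pr _ _].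
    by rewrite (cutoff_in a_gt0 h0 mesh pr) mul1r.
  rewrite /inner; under [leRHS]eq_bigr do rewrite mulr_sumr.
  apply: (Es_le (fun K L => cutoff r K * (sigma K L * g n K L ^+ 2))) => K L.
  by rewrite mulr_ge0 ?cutoff_ge0// mulr_ge0 ?sigma_ge0 ?sqr_ge0.
under eq_bigr do rewrite fsum_elements//.
set LHS := (X in X <= _).
have LHS0 : 0 <= LHS.
  rewrite sumr_ge0// => n _; rewrite mulr_ge0 ?(ltW dt0)// sumr_ge0// => p _.
  by rewrite mulr_ge0 ?sigma_ge0 ?enorm_ge0.
pose s := [seq (n, p) | n <- index_iota 0 N, p <- Es].
have CS : LHS ^+ 2 <= T' * (B / a ^+ 2) / h * C2.
  apply: (@le_trans _ _ ((\sum_(0 <= n < N) dt * \sum_(p <- Es) sigma p.1 p.2) *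
      \sum_(0 <= n < N) dt * \sum_(p <- Es) sigma p.1 p.2 * g n p.1 p.2 ^+ 2)).
    have big (F : nat -> set 'rV[R]_d * set 'rV[R]_d -> R) : \sum_(0 <= n < N) dt * \sum_(p <- Es) F n p = \sum_(q <- s) dt * F q.1 q.2.
      by rewrite big_allpairs_dep; apply: eq_bigr => n _; rewrite mulr_sumr.
    rewrite /LHS !big.
    have := @weighted_cauchy_schwarz R _ s (fun q => dt * sigma q.2.1 q.2.2)
      (fun q => g q.1 q.2.1 q.2.2).
    have wge q : q \in s -> 0 <= dt * sigma q.2.1 q.2.2.
      by rewrite mulr_ge0 ?sigma_ge0// ltW.
    move=> /(_ wge); under eq_bigr do rewrite -mulrA.
    by under [X in _ <= _ * X -> _]eq_bigr do rewrite -mulrA.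
  apply: ler_pM S1 S2; rewrite sumr_ge0// => n _; rewrite mulr_ge0 ?(ltW dt0)// sumr_ge0// => p _.
    exact: sigma_ge0.
  by rewrite mulr_ge0 ?sigma_ge0 ?sqr_ge0.
have P0 : 0 <= T' * (B / a ^+ 2) * C2.
  by rewrite mulr_ge0// mulr_ge0// divr_ge0// ltW.
rewrite -sqrtrV ?(ltW h0)// -sqrtrM//.
rewrite -[leLHS](ger0_norm LHS0) -sqrtr_sqr ler_wsqrtr//.
by apply: le_trans CS _; rewrite le_eqVlt mulrAC eqxx.
Qed.
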